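(* Let $K$ be a field of characteristic zero, let $n\ge 0$, and let $R=K[X_0,X_1,\ldots,X_n]$ be standard graded ($\deg X_i=1$ for all $i$). Let $I$ be a homogeneous ideal of $R$, let $i\ge 0$, and let $M=H^i_I(R)$ be the $i$-th local cohomology module of $R$ with respect to $I$, regarded with its natural structure of left module over the Weyl algebra $A_{n+1}(K)=K\langle X_0,\ldots,X_n,\partial_0,\ldots,\partial_n\rangle$. Then $$\chi^c(\partial,M)=(-1)^{n+1}\chi^c(X,M),$$ where $\chi^c(\partial,M)$ and $\chi^c(X,M)$ are the Euler characteristics of the de Rham cohomology and of the Koszul cohomology of $M$, respectively.
   Context: For a left $A_{n+1}(K)$-module $N$, the maps $\partial_0,\ldots,\partial_n$ are pairwise commuting $K$-linear endomorphisms of $N$, and so are the multiplications by $X_0,\ldots,X_n$. The de Rham complex of $N$ is the Koszul (cochain) complex on $N$ of $\partial=\partial_0,\ldots,\partial_n$: in cohomological degree $p$ it is $\bigwedge^p K^{n+1}\otimes_K N$, with differential $e_J\otimes m\mapsto \sum_{i=0}^n e_i\wedge e_J\otimes \partial_i m$. Its cohomology is $H^p(\partial;N)$. The Koszul cohomology $H^p(X;N)$ is defined in the same way using $X=X_0,\ldots,X_n$ in place of $\partial$. When $N$ is holonomic, all $H^p(\partial;N)$ and $H^p(X;N)$ are finite-dimensional over $K$ (known), and one sets $$\chi^c(\partial,N)=\sum_{p=0}^{n+1}(-1)^p\dim_K H^p(\partial;N),\qquad \chi^c(X,N)=\sum_{p=0}^{n+1}(-1)^p\dim_K H^p(X;N).$$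 By a theorem of Lyubeznik, the local cohomology modules $H^i_I(R)$ are graded holonomic $A_{n+1}(K)$-modules (where $\deg\partial_j=-1$), so the Euler characteristics in the statement are defined. *)

(* Defs.v *)
From HB Require Import structures.
From mathcomp Require Import all_boot all_order all_algebra.
From mathcomp Require Import boolp classical_sets.
From mathcomp Require Import mpoly ring.

Set Implicit Arguments.
Unset Strict Implicit.
Unset Printing Implicit Defensive.

Import GRing.Theory.
Local Open Scope ring_scope.
Local Open Scope quotient_scope.

Record subspace (K : fieldType) (V : lmodType K) := Subspace {
  subspace_carrier :> V -> Prop;
  subspace0 : subspace_carrier 0;
  subspaceP : forall (a : K) (u v : V),
    subspace_carrier u -> subspace_carrier v -> subspace_carrier (a *: u + v) }.

Section SubspaceType.
Variables (K : fieldType) (V : lmodType K) (U : subspace V).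

Definition subspace_pred : pred V := fun v => `[< U v >].

Lemma subspace_pred_closed : submod_closed subspace_pred.
Proof.
split=> [|a u v /asboolP Uu /asboolP Uv]; apply/asboolP.
  exact: subspace0.
exact: subspaceP.
Qed.

HB.instance Definition _ :=
  GRing.isSubmodClosed.Build K V subspace_pred subspace_pred_closed.

Record subspace_type := SubspaceElt {
  subspace_val : V;
  _ : subspace_pred subspace_val }.

HB.instance Definition _ := [isSub for subspace_val].
HB.instance Definition _ := [Choice of subspace_type by <:].
HB.instance Definition _ := [SubChoice_isSubLmodule of subspace_type by <:].

Lemma subspace_typeP (x : subspace_type) : U (val x).
Proof. by apply/asboolP; case: x. Qed.

Definition subspace_elt (v : V) (Uv : U v) : subspace_type :=
  SubspaceElt (introT (asboolP _) Uv).

End SubspaceType.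

(* For subspaces Z and B of V, the vector space Z / (Z :&: B). *)
Section Subquotient.
Variables (K : fieldType) (V : lmodType K) (Z B : subspace V).

Definition subquot_rel : pred (subspace_type Z) :=
  fun z => subspace_pred B (val z).

Lemma subquot_rel_closed : submod_closed subquot_rel.
Proof.
rewrite /subquot_rel; split=> [|a u v] /=.
  by apply/asboolP; exact: subspace0.
by move=> /asboolP Bu /asboolP Bv; apply/asboolP; exact: subspaceP.
Qed.

HB.instance Definition _ :=
  GRing.isSubmodClosed.Build K (subspace_type Z) subquot_rel subquot_rel_closed.

Let subquot_zmod : zmodClosed (subspace_type Z) :=
  Algebra.ZmodClosed.clone (subspace_type Z) subquot_rel _.

Definition subquot : Type := Quotient.quot subquot_zmod.
HB.instance Definition _ := Choice.on subquot.
HB.instance Definition _ := EqQuotient.on subquot.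
HB.instance Definition _ := GRing.Zmodule.on subquot.

Definition subquot_class (z : subspace_type Z) : subquot := \pi_subquot z.

Definition subquot_scale (a : K) (q : subquot) : subquot :=
  subquot_class (a *: repr q).

Lemma subquot_classP z z' :
  subquot_class z = subquot_class z' <-> B (val z - val z').
Proof.
rewrite -raddfB /subquot_class; split.
  by move/eqmodP; rewrite /= Quotient.equivE unfold_in => /asboolP.
by move=> h; apply/eqmodP; rewrite /= Quotient.equivE unfold_in; apply/asboolP.
Qed.

Lemma subquot_classK q : subquot_class (repr q) = q.
Proof. exact: reprK. Qed.

Lemma subquot_classD z z' :
  subquot_class (z + z') = subquot_class z + subquot_class z'.
Proof. by rewrite /subquot_class (Quotient.pi_add subquot_zmod). Qed.

Lemma subquot_classZ a z :
  subquot_class (a *: z) = subquot_scale a (subquot_class z).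
Proof.
apply/subquot_classP.
have -> : val (a *: z) - val (a *: repr (subquot_class z))
        = a *: (val z - val (repr (subquot_class z))) + 0.
  by rewrite addr0 scalerBr.
apply: subspaceP; last exact: subspace0.
by apply/subquot_classP; rewrite subquot_classK.
Qed.

Fact subquot_scaleA a b q :
  subquot_scale a (subquot_scale b q) = subquot_scale (a * b) q.
Proof. by rewrite -(subquot_classK q) -!subquot_classZ scalerA. Qed.

Fact subquot_scale1 : left_id 1 subquot_scale.
Proof. by move=> q; rewrite -(subquot_classK q) -!subquot_classZ scale1r. Qed.

Fact subquot_scaleDr : right_distributive subquot_scale +%R.
Proof.
move=> a q r; rewrite -(subquot_classK q) -(subquot_classK r).
by rewrite -subquot_classD -!subquot_classZ -subquot_classD scalerDr.
Qed.

Fact subquot_scaleDl q : {morph subquot_scale^~ q : a b / a + b}.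
Proof.
move=> a b; rewrite -(subquot_classK q) -!subquot_classZ -subquot_classD.
by rewrite scalerDl.
Qed.

HB.instance Definition _ := GRing.Zmodule_isLmodule.Build K subquot
  subquot_scaleA subquot_scale1 subquot_scaleDr subquot_scaleDl.

End Subquotient.

Section SubquotientMap.
Variables (K : fieldType) (V : lmodType K) (Z B : subspace V).
Variable phi : {linear V -> V}.
Hypothesis phiZ : forall v, Z v -> Z (phi v).
Hypothesis phiB : forall v, B v -> B (phi v).

Definition subquot_map (q : subquot Z B) : subquot Z B :=
  subquot_class B (subspace_elt (phiZ (subspace_typeP (repr q)))).

Lemma subquot_mapE (z : subspace_type Z) :
  subquot_map (subquot_class B z)
  = subquot_class B (subspace_elt (phiZ (subspace_typeP z))).
Proof.
apply/subquot_classP => /=; rewrite -raddfB; apply: phiB.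
by apply/subquot_classP; rewrite subquot_classK.
Qed.

Lemma subquot_map_is_linear : linear subquot_map.
Proof.
move=> a q r; rewrite -(subquot_classK q) -(subquot_classK r).
have -> : a *: subquot_class B (repr q) + subquot_class B (repr r)
        = subquot_class B (a *: repr q + repr r).
  by rewrite subquot_classD subquot_classZ.
rewrite !subquot_mapE -[_ *: subquot_class _ _]subquot_classZ -subquot_classD.
by congr subquot_class; apply: val_inj; exact: linearP.
Qed.

Definition subquot_linear : {linear subquot Z B -> subquot Z B} :=
  HB.pack subquot_map (GRing.isLinear.Build K (subquot Z B) (subquot Z B) _
    subquot_map subquot_map_is_linear).

End SubquotientMap.

(* C p is the space of p-cochains inside one ambient space V, on which the
   differential d acts. *)
Section Cohomology.
Variables (K : fieldType) (V : lmodType K).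
Variables (C : nat -> subspace V) (d : {linear V -> V}).

Lemma cocycles_subproof p :
  (C p 0 /\ d 0 = 0) /\
  (forall (a : K) u v, C p u /\ d u = 0 -> C p v /\ d v = 0 ->
     C p (a *: u + v) /\ d (a *: u + v) = 0).
Proof.
split; first by split; [exact: subspace0|rewrite raddf0].
move=> a u v [Cu du] [Cv dv]; split; first exact: subspaceP.
by rewrite linearP du dv scaler0 addr0.
Qed.

Definition cocycles p : subspace V :=
  @Subspace K V (fun v => C p v /\ d v = 0)
    (cocycles_subproof p).1 (cocycles_subproof p).2.

Definition is_coboundary p (v : V) : Prop :=
  match p with
  | 0 => v = 0
  | q.+1 => exists2 u, C q u & v = d u
  end.

Lemma coboundaries_subproof p :
  is_coboundary p 0 /\
  (forall (a : K) u v, is_coboundary p u -> is_coboundary p v ->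
     is_coboundary p (a *: u + v)).
Proof.
case: p => [|p] /=; split=> //.
- by move=> a u v -> ->; rewrite scaler0 addr0.
- by exists 0; [exact: subspace0|rewrite raddf0].
move=> a _ _ [u Cu ->] [v Cv ->]; exists (a *: u + v).
  exact: subspaceP.
by rewrite linearP.
Qed.

Definition coboundaries p : subspace V :=
  Subspace (coboundaries_subproof p).1 (coboundaries_subproof p).2.

Definition cohomology p : lmodType K := subquot (cocycles p) (coboundaries p).

End Cohomology.

(* The dimension of V if V is finite-dimensional, and 0 otherwise. *)
Definition vdim (K : fieldType) (V : lmodType K) : nat :=
  xget 0%N [set d : nat | exists e : 'I_d -> V,
    forall v : V, exists! c : 'rV[K]_d, v = \sum_(j < d) c 0 j *: e j].

(* The Koszul cochain complex of a family phi of endomorphisms of N.  The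
   element \sum_J e_J (x) w(J) of the exterior algebra of K^m tensor N, where
   e_J is the wedge of the e_j for j in J in increasing order, is encoded as the
   function w.  As e_i /\ e_J = (-1)^#{j in J | j < i} e_(J U {i}) for i not in
   J, and e_i /\ e_J = 0 for i in J, the coefficient at L of the differential
   collects the sets J = L \ {i} for i in L. *)
Section Koszul.
Variables (K : fieldType) (m : nat) (N : lmodType K).
Variable phi : 'I_m -> {linear N -> N}.

Definition koszul_diff (w : {ffun {set 'I_m} -> N}) : {ffun {set 'I_m} -> N} :=
  [ffun L : {set 'I_m} =>
    \sum_(i in L) (-1) ^+ #|[set j in L | (j < i)%N]| *: phi i (w (L :\ i))].

Lemma koszul_diff_is_linear : linear koszul_diff.
Proof.
move=> a u v; apply/ffunP => L; rewrite !ffunE scaler_sumr -big_split /=.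
apply: eq_bigr => i _; rewrite !ffunE linearP /= scalerDr !scalerA.
by rewrite [a * _]mulrC.
Qed.

HB.instance Definition _ := GRing.isLinear.Build K _ _ _ koszul_diff
  koszul_diff_is_linear.

Lemma koszul_cochains_subproof p :
  (forall J : {set 'I_m}, #|J| <> p -> (0 : {ffun {set 'I_m} -> N}) J = 0) /\
  (forall (a : K) (u v : {ffun {set 'I_m} -> N}),
     (forall J : {set 'I_m}, #|J| <> p -> u J = 0) ->
     (forall J : {set 'I_m}, #|J| <> p -> v J = 0) ->
     forall J : {set 'I_m}, #|J| <> p -> (a *: u + v) J = 0).
Proof.
split=> [J _|a u v hu hv J hJ]; first by rewrite ffunE.
by rewrite !ffunE hu // hv // scaler0 addr0.
Qed.

Definition koszul_cochains p : subspace {ffun {set 'I_m} -> N} :=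
  @Subspace K {ffun {set 'I_m} -> N}
    (fun w => forall J : {set 'I_m}, #|J| <> p -> w J = 0)
    (koszul_cochains_subproof p).1 (koszul_cochains_subproof p).2.

Definition koszul_cohomology p : lmodType K :=
  cohomology koszul_cochains koszul_diff p.

Definition koszul_euler_char : int :=
  \sum_(p < m.+1) (-1) ^+ p * (vdim (koszul_cohomology p))%:Z.

End Koszul.

(* Left modules over the Weyl algebra A_m(K), through its presentation by
   generators and relations. *)
Record weylModule (K : fieldType) (m : nat) := WeylModule {
  weyl_sort :> lmodType K;
  weylX : 'I_m -> {linear weyl_sort -> weyl_sort};
  weylD : 'I_m -> {linear weyl_sort -> weyl_sort};
  weylXX : forall i j v, weylX i (weylX j v) = weylX j (weylX i v);
  weylDD : forall i j v, weylD i (weylD j v) = weylD j (weylD i v);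
  weylDX : forall i j v,
    weylD i (weylX j v) = weylX j (weylD i v) + v *+ (i == j) }.

Definition chi_deRham (K : fieldType) (m : nat) (N : weylModule K m) : int :=
  koszul_euler_char (weylD N).

Definition chi_Koszul (K : fieldType) (m : nat) (N : weylModule K m) : int :=
  koszul_euler_char (weylX N).

Section WeylFfun.
Variables (K : fieldType) (m : nat) (T : finType) (N : weylModule K m).

Definition ffun_map (phi : {linear N -> N}) (w : {ffun T -> N}) :
  {ffun T -> N} := [ffun t => phi (w t)].

Lemma ffun_map_is_linear phi : linear (ffun_map phi).
Proof. by move=> a u v; apply/ffunP => t; rewrite !ffunE linearP. Qed.

HB.instance Definition _ phi := GRing.isLinear.Build K _ _ _ (ffun_map phi)
  (ffun_map_is_linear phi).

Lemma weyl_ffunXX i j w :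
  ffun_map (weylX N i) (ffun_map (weylX N j) w)
  = ffun_map (weylX N j) (ffun_map (weylX N i) w).
Proof. by apply/ffunP => t; rewrite !ffunE weylXX. Qed.

Lemma weyl_ffunDD i j w :
  ffun_map (weylD N i) (ffun_map (weylD N j) w)
  = ffun_map (weylD N j) (ffun_map (weylD N i) w).
Proof. by apply/ffunP => t; rewrite !ffunE weylDD. Qed.

Lemma weyl_ffunDX i j w :
  ffun_map (weylD N i) (ffun_map (weylX N j) w)
  = ffun_map (weylX N j) (ffun_map (weylD N i) w) + w *+ (i == j).
Proof.
apply/ffunP => t; rewrite !ffunE weylDX.
by case: (i == j); rewrite ?mulr1n // ?mulr0n ffunE.
Qed.

Definition weyl_ffun : weylModule K m :=
  @WeylModule K m {ffun T -> N} (fun i => ffun_map (weylX N i))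
    (fun i => ffun_map (weylD N i)) weyl_ffunXX weyl_ffunDD weyl_ffunDX.

End WeylFfun.

Section WeylSubquotient.
Variables (K : fieldType) (m : nat) (N : weylModule K m) (Z B : subspace N).
Hypothesis XZ : forall i v, Z v -> Z (weylX N i v).
Hypothesis XB : forall i v, B v -> B (weylX N i v).
Hypothesis DZ : forall i v, Z v -> Z (weylD N i v).
Hypothesis DB : forall i v, B v -> B (weylD N i v).

Definition subquotX i : {linear subquot Z B -> subquot Z B} :=
  subquot_linear (XZ i) (XB i).
Definition subquotD i : {linear subquot Z B -> subquot Z B} :=
  subquot_linear (DZ i) (DB i).

Lemma weyl_subquotXX i j q :
  subquotX i (subquotX j q) = subquotX j (subquotX i q).
Proof.
rewrite -(subquot_classK q) /= !(subquot_mapE _ (XB _)); congr subquot_class.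
by apply: val_inj; exact: weylXX.
Qed.

Lemma weyl_subquotDD i j q :
  subquotD i (subquotD j q) = subquotD j (subquotD i q).
Proof.
rewrite -(subquot_classK q) /= !(subquot_mapE _ (DB _)); congr subquot_class.
by apply: val_inj; exact: weylDD.
Qed.

Lemma weyl_subquotDX i j q :
  subquotD i (subquotX j q) = subquotX j (subquotD i q) + q *+ (i == j).
Proof.
rewrite -(subquot_classK q) /= !(subquot_mapE _ (XB _), subquot_mapE _ (DB _)).
have -> : subquot_class B (repr q) *+ (i == j)
        = subquot_class B (repr q *+ (i == j)).
  case: (i == j); rewrite ?mulr1n // ?mulr0n.
  by rewrite -[LHS](subrr (subquot_class B 0)) -{1}[0]addr0 subquot_classD addrK.
rewrite -subquot_classD; congr subquot_class; apply: val_inj.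
have valMb (b : bool) : val (repr q) *+ b = val (repr q *+ b) by case: b.
by apply: etrans (weylDX i j (val (repr q))) _; rewrite valMb.
Qed.

Definition weyl_subquot : weylModule K m :=
  @WeylModule K m (subquot Z B) subquotX subquotD
    weyl_subquotXX weyl_subquotDD weyl_subquotDX.

End WeylSubquotient.

Fact quotient_rule_wd (R : comNzRingType) (a b c d a' b' c' d' : R) :
  a * d = c * b -> a' * d + a * d' = c' * b + c * b' ->
  (a' * b - a * b') * d ^+ 2 = (c' * d - c * d') * b ^+ 2.
Proof.
move=> /eqP; rewrite -subr_eq0 => /eqP e1 /eqP; rewrite -subr_eq0 => /eqP e2.
apply/eqP; rewrite -subr_eq0; apply/eqP.
transitivity (b * d * (a' * d + a * d' - (c' * b + c * b'))
              - (b' * d + b * d') * (a * d - c * b)); first by ring.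
by rewrite e1 e2 !mulr0 subr0.
Qed.

Fact quotient_rule_add (L : fieldType) (a b c d a' b' c' d' : L) :
  b != 0 -> d != 0 ->
  ((a' * d + a * d' + (c' * b + c * b')) * (b * d)
     - (a * d + c * b) * (b' * d + b * d')) / (b * d) ^+ 2
  = (a' * b - a * b') / b ^+ 2 + (c' * d - c * d') / d ^+ 2.
Proof. by move=> b0 d0; field; rewrite b0 d0. Qed.

Fact quotient_rule_mul (L : fieldType) (a b c d a' b' c' d' : L) :
  b != 0 -> d != 0 ->
  ((a' * c + a * c') * (b * d) - (a * c) * (b' * d + b * d')) / (b * d) ^+ 2
  = (a' * b - a * b') / b ^+ 2 * (c / d) + a / b * ((c' * d - c * d') / d ^+ 2).
Proof. by move=> b0 d0; field; rewrite b0 d0. Qed.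

Fact add_pow_fractions (L : fieldType) (a b f : L) k l :
  a / f ^+ k.+1 + b / f ^+ l.+1
  = (a * f ^+ l.+1 + b * f ^+ k.+1) / f ^+ (k + l.+1).+1.
Proof.
have [->|f0] := eqVneq f 0; first by rewrite !expr0n /= invr0 !mulr0 addr0.
by rewrite addf_div ?expf_neq0 // -exprD addSn.
Qed.

Fact mixed_terms_cancel (V : zmodType) (x y p q z : V) :
  x + p + (q + z) = y + q + (p + z) -> x = y.
Proof.
rewrite addrA [y + q + _]addrA => /addIr.
by rewrite [y + q + p]addrAC => /addIr /addIr.
Qed.

Definition ratfun (K : fieldType) (m : nat) : Type := {fraction {mpoly K[m]}}.
HB.instance Definition _ (K : fieldType) (m : nat) :=
  GRing.Field.copy (ratfun K m) {fraction {mpoly K[m]}}.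

Section RationalFunctions.
Variables (K : fieldType) (m : nat).
Local Notation R := {mpoly K[m]}.
Local Notation F := (ratfun K m).

Definition poly_ratfun (g : R) : F := FracField.tofrac g.

HB.instance Definition _ :=
  GRing.RMorphism.copy poly_ratfun (@FracField.tofrac R).

Lemma poly_ratfun0 : poly_ratfun 0 = 0. Proof. exact: tofrac0. Qed.
Lemma poly_ratfun1 : poly_ratfun 1 = 1. Proof. exact: tofrac1. Qed.
Lemma poly_ratfunD g h : poly_ratfun (g + h) = poly_ratfun g + poly_ratfun h.
Proof. exact: tofracD. Qed.
Lemma poly_ratfunB g h : poly_ratfun (g - h) = poly_ratfun g - poly_ratfun h.
Proof. exact: tofracB. Qed.
Lemma poly_ratfunM g h : poly_ratfun (g * h) = poly_ratfun g * poly_ratfun h.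
Proof. exact: tofracM. Qed.
Lemma poly_ratfunX g k : poly_ratfun (g ^+ k) = poly_ratfun g ^+ k.
Proof. exact: tofracXn. Qed.

Definition ratfun_scale (a : K) (x : F) : F := poly_ratfun a%:MP * x.

Fact ratfun_scaleA a b x :
  ratfun_scale a (ratfun_scale b x) = ratfun_scale (a * b) x.
Proof. by rewrite /ratfun_scale mulrA -poly_ratfunM -mpolyCM. Qed.

Fact ratfun_scale1 : left_id 1 ratfun_scale.
Proof. by move=> x; rewrite /ratfun_scale poly_ratfun1 mul1r. Qed.

Fact ratfun_scaleDr : right_distributive ratfun_scale +%R.
Proof. by move=> a x y; rewrite /ratfun_scale mulrDr. Qed.

Fact ratfun_scaleDl x : {morph ratfun_scale^~ x : a b / a + b}.
Proof. by move=> a b; rewrite /ratfun_scale mpolyCD poly_ratfunD mulrDl. Qed.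

HB.instance Definition _ := GRing.Zmodule_isLmodule.Build K F
  ratfun_scaleA ratfun_scale1 ratfun_scaleDr ratfun_scaleDl.

Lemma ratfun_scaleE a (x : F) : a *: x = poly_ratfun a%:MP * x.
Proof. by []. Qed.

Definition ratfun_num (x : F) : R := \n_(repr (x : {fraction R})).
Definition ratfun_den (x : F) : R := \d_(repr (x : {fraction R})).

Lemma poly_ratfun_eq0 g : (poly_ratfun g == 0) = (g == 0).
Proof. exact: tofrac_eq0. Qed.

Lemma poly_ratfun_inj : injective poly_ratfun.
Proof. by move=> g h /eqP; rewrite /poly_ratfun tofrac_eq => /eqP. Qed.

Lemma ratfun_den_neq0 x : ratfun_den x != 0.
Proof. exact: denom_ratioP. Qed.

Lemma ratfun_numden x :
  x = poly_ratfun (ratfun_num x) / poly_ratfun (ratfun_den x).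
Proof.
have nz : poly_ratfun (ratfun_den x) != 0.
  by rewrite poly_ratfun_eq0 ratfun_den_neq0.
apply: (mulIf nz); rewrite mulfVK // /poly_ratfun /ratfun_num /ratfun_den.
rewrite -{1}[x]reprK; case: (repr x) => [[a b] /= b0].
rewrite /GRing.mul /=; unlock FracField.tofrac; rewrite -FracField.pi_mul.
apply/eqmodP; rewrite /= FracField.equivfE /FracField.mulf /=.
by rewrite !numden_Ratio ?mulr1 ?oner_neq0 //= mulrC.
Qed.

Lemma ratfunW (P : F -> Prop) :
  (forall a b : R, b != 0 -> P (poly_ratfun a / poly_ratfun b)) ->
  forall x, P x.
Proof. by move=> h x; rewrite (ratfun_numden x); apply/h/ratfun_den_neq0. Qed.

Definition ratfun_X (i : 'I_m) (x : F) : F := poly_ratfun 'X_i * x.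

Lemma ratfun_X_is_linear i : linear (ratfun_X i).
Proof.
by move=> a x y; rewrite /ratfun_X mulrDr !ratfun_scaleE mulrCA.
Qed.

HB.instance Definition _ i := GRing.isLinear.Build K F F _ (ratfun_X i)
  (ratfun_X_is_linear i).

Definition ratfun_D (i : 'I_m) (x : F) : F :=
  let a := ratfun_num x in let b := ratfun_den x in
  poly_ratfun (a^`M(i) * b - a * b^`M(i)) / poly_ratfun b ^+ 2.

Lemma ratfun_DE i a b : b != 0 ->
  ratfun_D i (poly_ratfun a / poly_ratfun b)
  = poly_ratfun (a^`M(i) * b - a * b^`M(i)) / poly_ratfun b ^+ 2.
Proof.
move=> b0; rewrite /ratfun_D; set x := poly_ratfun a / poly_ratfun b.
have d0 := ratfun_den_neq0 x; have := ratfun_numden x; move: d0.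
move: (ratfun_num x) (ratfun_den x) => c d d0 xE.
have pb0 : poly_ratfun b != 0 by rewrite poly_ratfun_eq0.
have pd0 : poly_ratfun d != 0 by rewrite poly_ratfun_eq0.
have adcb : a * d = c * b.
  apply: poly_ratfun_inj; rewrite !poly_ratfunM; apply/eqP.
  by rewrite -(eqr_div _ _ pb0 pd0) -xE.
have dE : a^`M(i) * d + a * d^`M(i) = c^`M(i) * b + c * b^`M(i).
  by rewrite -!mderivM adcb.
apply/eqP; rewrite (eqr_div _ _ (expf_neq0 2 pd0) (expf_neq0 2 pb0)); apply/eqP.
rewrite -!poly_ratfunX -!poly_ratfunM.
by congr poly_ratfun; apply: quotient_rule_wd; [rewrite adcb|rewrite dE].
Qed.

Lemma ratfun_D_poly i a : ratfun_D i (poly_ratfun a) = poly_ratfun a^`M(i).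
Proof.
rewrite -[poly_ratfun a]divr1 -[1 in LHS](poly_ratfun1) ratfun_DE.
  by rewrite poly_ratfun1 expr1n divr1 mulr1 -mpolyC1 mderivC mulr0 subr0.
exact: oner_neq0.
Qed.

Lemma ratfun_DD i x y : ratfun_D i (x + y) = ratfun_D i x + ratfun_D i y.
Proof.
elim/ratfunW: x => a b b0; elim/ratfunW: y => c d d0.
have pb0 : poly_ratfun b != 0 by rewrite poly_ratfun_eq0.
have pd0 : poly_ratfun d != 0 by rewrite poly_ratfun_eq0.
rewrite (addf_div _ _ pb0 pd0) -!poly_ratfunM -poly_ratfunD.
rewrite (ratfun_DE _ _ b0) (ratfun_DE _ _ d0) (ratfun_DE _ _ (mulf_neq0 b0 d0)).
rewrite mderivD !mderivM !(poly_ratfunB, poly_ratfunM).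
rewrite !poly_ratfunD !poly_ratfunM.
exact: (quotient_rule_add (poly_ratfun a) (poly_ratfun c)
  (poly_ratfun a^`M(i)) (poly_ratfun b^`M(i)) (poly_ratfun c^`M(i))
  (poly_ratfun d^`M(i)) pb0 pd0).
Qed.

Lemma ratfun_DM i x y :
  ratfun_D i (x * y) = ratfun_D i x * y + x * ratfun_D i y.
Proof.
elim/ratfunW: x => a b b0; elim/ratfunW: y => c d d0.
have pb0 : poly_ratfun b != 0 by rewrite poly_ratfun_eq0.
have pd0 : poly_ratfun d != 0 by rewrite poly_ratfun_eq0.
rewrite mulf_div -!poly_ratfunM.
rewrite (ratfun_DE _ _ b0) (ratfun_DE _ _ d0) (ratfun_DE _ _ (mulf_neq0 b0 d0)).
rewrite !mderivM !(poly_ratfunB, poly_ratfunM).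
rewrite !poly_ratfunD !poly_ratfunM.
exact: (quotient_rule_mul (poly_ratfun a) (poly_ratfun c)
  (poly_ratfun a^`M(i)) (poly_ratfun b^`M(i)) (poly_ratfun c^`M(i))
  (poly_ratfun d^`M(i)) pb0 pd0).
Qed.

Lemma ratfun_D_is_linear i : linear (ratfun_D i).
Proof.
move=> a x y; rewrite ratfun_DD !ratfun_scaleE ratfun_DM ratfun_D_poly.
by rewrite mderivC poly_ratfun0 mul0r add0r.
Qed.

HB.instance Definition _ i := GRing.isLinear.Build K F F _ (ratfun_D i)
  (ratfun_D_is_linear i).

Lemma ratfun_XX i j (x : F) :
  ratfun_X i (ratfun_X j x) = ratfun_X j (ratfun_X i x).
Proof. exact: mulrCA. Qed.

Lemma ratfun_DDC i j (x : F) :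
  ratfun_D i (ratfun_D j x) = ratfun_D j (ratfun_D i x).
Proof.
elim/ratfunW: x => a b b0; set x := _ / _.
have pb0 : poly_ratfun b != 0 by rewrite poly_ratfun_eq0.
have xb : x * poly_ratfun b = poly_ratfun a by rewrite /x mulfVK.
have DDE k l : poly_ratfun (a^`M(l))^`M(k)
    = ratfun_D k (ratfun_D l x) * poly_ratfun b
      + ratfun_D l x * poly_ratfun b^`M(k)
      + (ratfun_D k x * poly_ratfun b^`M(l) + x * poly_ratfun (b^`M(l))^`M(k)).
  rewrite -!ratfun_D_poly -xb (ratfun_DM l x) ratfun_DD.
  by rewrite (ratfun_DM k (ratfun_D l x)) (ratfun_DM k x).
have := DDE i j; rewrite mderiv_comm (DDE j i) (mderiv_comm i j b).
by move=> /mixed_terms_cancel /(mulIf pb0) ->.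
Qed.

Lemma ratfun_DX i j (x : F) :
  ratfun_D i (ratfun_X j x) = ratfun_X j (ratfun_D i x) + x *+ (i == j).
Proof.
rewrite /ratfun_X ratfun_DM ratfun_D_poly addrC; congr (_ + _).
rewrite mderivX mnm1E eq_sym; case: eqVneq => [->|_].
  by rewrite -{1}[U_(j)%MM]add0m addmK mpolyX0 scale1r poly_ratfun1 mul1r.
by rewrite scale0r poly_ratfun0 mul0r.
Qed.

Definition ratfun_weyl : weylModule K m :=
  @WeylModule K m F (fun i => ratfun_X i) (fun i => ratfun_D i)
    ratfun_XX ratfun_DDC ratfun_DX.

(* The localization R_f, inside the fraction field of R.  Fractions are written
   with positive powers of f so that, 0^-1 being 0, R_f is 0 for f = 0. *)
Definition in_loc (f : R) (x : F) : Prop :=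
  exists (g : R) (k : nat), x = poly_ratfun g / poly_ratfun f ^+ k.+1.

Lemma in_loc0 f : in_loc f 0.
Proof. by exists 0, 0%N; rewrite poly_ratfun0 mul0r. Qed.

Lemma in_locP f (a : K) x y :
  in_loc f x -> in_loc f y -> in_loc f (a *: x + y).
Proof.
move=> [g [k ->]] [h [l ->]].
exists (a%:MP * g * f ^+ l.+1 + h * f ^+ k.+1), (k + l.+1)%N.
by rewrite ratfun_scaleE mulrA add_pow_fractions poly_ratfunD !poly_ratfunM !poly_ratfunX.
Qed.

Lemma in_locX f i x : in_loc f x -> in_loc f (ratfun_X i x).
Proof.
by move=> [g [k ->]]; exists ('X_i * g), k; rewrite /ratfun_X mulrA poly_ratfunM.
Qed.

Lemma in_locD f i x : in_loc f x -> in_loc f (ratfun_D i x).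
Proof.
move=> [g [k ->]]; have [->|f0] := eqVneq f 0.
  by rewrite poly_ratfun0 expr0n invr0 mulr0 raddf0; exact: in_loc0.
rewrite -poly_ratfunX (ratfun_DE _ _ (expf_neq0 k.+1 f0)).
eexists _, (k + k.+1)%N; congr (_ / _).
by rewrite poly_ratfunX -exprM muln2 -addnn addSn.
Qed.

End RationalFunctions.

(* The Cech complex of f_0, ..., f_(s-1) on R = K[X_0, ..., X_(m-1)]: a p-cochain
   w has a component w(J) in the localization of R at the product of the f_j,
   j in J, for each J of cardinal p.  Inside the fraction field of R the
   localization maps are inclusions, and the differential
     (d w)(L) = \sum_(i in L) (-1)^#{j in L | j < i} w(L \ {i})
   is the Koszul differential of identity maps.  The local cohomology of R with
   support in the ideal of the f_j is the cohomology of this complex, with the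
   operators induced by the X_i and the partial derivatives. *)
Section Cech.
Variables (K : fieldType) (m s : nat) (f : 'I_s -> {mpoly K[m]}).
Local Notation W := (weyl_ffun {set 'I_s} (ratfun_weyl K m)).

Definition cech_diff : {linear W -> W} :=
  koszul_diff (fun _ : 'I_s => idfun : {linear ratfun K m -> ratfun K m}).

Definition is_cech_cochain p (w : {ffun {set 'I_s} -> ratfun K m}) : Prop :=
  forall J : {set 'I_s}, (#|J| <> p -> w J = 0) /\
    in_loc (\prod_(j in J) f j) (w J).

Lemma cech_cochains_subproof p :
  is_cech_cochain p 0 /\
  (forall (a : K) u v, is_cech_cochain p u -> is_cech_cochain p v ->
     is_cech_cochain p (a *: u + v)).
Proof.
split=> [J|a u v hu hv J]; first by rewrite ffunE; split=> // ; exact: in_loc0.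
rewrite !ffunE; have [u0 uJ] := hu J; have [v0 vJ] := hv J.
split; last exact: in_locP.
by move=> hJ; rewrite u0 // v0 // scaler0 addr0.
Qed.

Definition cech_cochains p : subspace W :=
  @Subspace K W (is_cech_cochain p)
    (cech_cochains_subproof p).1 (cech_cochains_subproof p).2.

Lemma cech_diff_ffun_map (phi : {linear ratfun K m -> ratfun K m}) (w : W) :
  cech_diff (@ffun_map K m _ (ratfun_weyl K m) phi w)
  = @ffun_map K m _ (ratfun_weyl K m) phi (cech_diff w).
Proof.
apply/ffunP => L; rewrite !ffunE raddf_sum; apply: eq_bigr => i _.
by rewrite ffunE; symmetry; exact: linearZ_LR.
Qed.

Lemma cech_cochainsX p i w :
  cech_cochains p w -> cech_cochains p (weylX W i w).
Proof.
move=> hw J; have [w0 wJ] := hw J; rewrite ffunE; split; last exact: in_locX.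
by move=> hJ; rewrite w0 // raddf0.
Qed.

Lemma cech_cochainsD p i w :
  cech_cochains p w -> cech_cochains p (weylD W i w).
Proof.
move=> hw J; have [w0 wJ] := hw J; rewrite ffunE; split; last exact: in_locD.
by move=> hJ; rewrite w0 // raddf0.
Qed.

Local Notation Z := (cocycles cech_cochains cech_diff).
Local Notation B := (coboundaries cech_cochains cech_diff).

Lemma cech_cocyclesX p i w : Z p w -> Z p (weylX W i w).
Proof.
move=> [hw dw]; split; first exact: cech_cochainsX.
by rewrite cech_diff_ffun_map dw raddf0.
Qed.

Lemma cech_cocyclesD p i w : Z p w -> Z p (weylD W i w).
Proof.
move=> [hw dw]; split; first exact: cech_cochainsD.
by rewrite cech_diff_ffun_map dw raddf0.
Qed.

Lemma cech_coboundariesX p i w : B p w -> B p (weylX W i w).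
Proof.
case: p => [-> /=|p [u hu ->]]; first by rewrite raddf0.
by exists (weylX W i u); [exact: cech_cochainsX|rewrite cech_diff_ffun_map].
Qed.

Lemma cech_coboundariesD p i w : B p w -> B p (weylD W i w).
Proof.
case: p => [-> /=|p [u hu ->]]; first by rewrite raddf0.
by exists (weylD W i u); [exact: cech_cochainsD|rewrite cech_diff_ffun_map].
Qed.

Definition local_cohomology (p : nat) : weylModule K m :=
  weyl_subquot (@cech_cocyclesX p) (@cech_coboundariesX p)
    (@cech_cocyclesD p) (@cech_coboundariesD p).

End Cech.

Definition is_ideal (R : comNzRingType) (I : R -> Prop) : Prop :=
  I 0 /\ forall a u v : R, I u -> I v -> I (a * u + v).

Definition homogeneous_ideal (K : fieldType) (m : nat)
    (I : {mpoly K[m]} -> Prop) : Prop :=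
  is_ideal I /\ forall g, I g -> forall d, I (pihomog mdeg d g).

Definition generates (R : comNzRingType) (s : nat) (f : 'I_s -> R)
    (I : R -> Prop) : Prop :=
  forall g, I g <-> exists a : 'I_s -> R, g = \sum_(j < s) a j * f j.

(* Main.v *)
(* Let E = sum_i X_i D_i.  On the forms with coefficients in M the de Rham
   differential d and the contraction iota by X satisfy
   d iota + iota d = E + (form degree).  As I is homogeneous, E is
   diagonalizable on M, so both d and iota have their cohomology carried by the
   subspace C on which the right-hand side vanishes.  There d and iota
   anticommute, and (C, d + iota) is a Z/2-graded complex; filtering it by form
   degree from either end shows that its Euler characteristic equals that of
   (C, d) and that of (C, iota).  The Hodge star turns iota into the Koszul
   differential of X and reverses degrees, whence the sign (-1)^(n+1).

   Finite-dimensionality comes from filtrations of polynomial growth k^m: they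
   pass to all subquotients, and kernel and cokernel of one variable have growth
   k^(m-1).  Diagonalizability of E is clear on the Cech complex of homogeneous
   elements; it is carried to the given generators by adding and removing one
   element of the ideal at a time. *)
Require Import Defs.
From HB Require Import structures.
From mathcomp Require Import boolp classical_sets.
From mathcomp Require Import all_boot all_order all_algebra.
From mathcomp Require Import mpoly.
From mathcomp Require Import zify ring.

Import GRing.Theory.
Local Open Scope ring_scope.
Set Implicit Arguments.
Unset Strict Implicit.
Unset Printing Implicit Defensive.

(** * Relative dimension *)

Section RelativeDimension.
Variable K : fieldType.

(** The subspace C can be infinite-dimensional: for I = (X_0) and n > 0 the degree -1 part of
    H^1_I(R) contains every X_0^(-k) X_1^(k-1). So the Euler characteristics cannot be compared by
    counting cochains; only exact sequences between cohomology spaces are available, and these need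
    finite-dimensionality beforehand. That is proved once, for Koszul complexes of X over any
    operators satisfying the Weyl relations. The de Rham case is the same statement after the
    Fourier transform (X, D) -> (D, -X), which respects both the relations and the filtration. The
    given generators need not be homogeneous, and E need not be locally finite on R_f for such an f:
    its action can raise the pole order forever. Semisimplicity is therefore visible on cohomology
    only, and has to be carried over from another Cech complex. Cohomology is handled throughout as
    a pair of subspaces A, B of one ambient space, standing for A / (A :&: B), so that subquotients
    of subquotients stay inside that space. *)

Definition lincomb (V : lmodType K) n (e : 'I_n -> V) (c : 'rV[K]_n) : V :=
  \sum_(j < n) c 0 j *: e j.

Lemma lincomb_is_linear (V : lmodType K) n (e : 'I_n -> V) :
  linear (lincomb e).
Proof.
move=> a c c'; rewrite /lincomb scaler_sumr -big_split /=.
by apply: eq_bigr => j _; rewrite !mxE scalerDl scalerA.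
Qed.
HB.instance Definition _ (V : lmodType K) n (e : 'I_n -> V) :=
  GRing.isLinear.Build K _ _ _ (lincomb e) (lincomb_is_linear e).

Lemma lincomb_linear (V W : lmodType K) (phi : {linear V -> W}) n
    (e : 'I_n -> V) c : phi (lincomb e c) = lincomb (phi \o e) c.
Proof.
by rewrite /lincomb linear_sum; apply: eq_bigr => j _; rewrite linearZ.
Qed.

Lemma lincombB (V : lmodType K) n (e e' : 'I_n -> V) c :
  lincomb (fun j => e j - e' j) c = lincomb e c - lincomb e' c.
Proof.
by rewrite /lincomb -sumrB; apply: eq_bigr => j _; rewrite scalerBr.
Qed.

Section Subspaces.
Variable V : lmodType K.
Implicit Types (A B : subspace V) (u v : V).

Lemma subspaceD A u v : A u -> A v -> A (u + v).
Proof. by move=> Au Av; rewrite -[u]scale1r; apply: subspaceP. Qed.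

Lemma subspaceZ A (a : K) v : A v -> A (a *: v).
Proof.
by move=> Av; rewrite -[_ *: _]addr0; apply: subspaceP => //; apply: subspace0.
Qed.

Lemma subspaceZ_eq A (a : K) v : a != 0 -> A (a *: v) -> A v.
Proof.
by move=> a0 /(subspaceZ a^-1); rewrite scalerA mulVf // scale1r.
Qed.

Lemma subspaceN A v : A v -> A (- v).
Proof. by move=> Av; rewrite -scaleN1r; apply: subspaceZ. Qed.

Lemma subspaceB A u v : A u -> A v -> A (u - v).
Proof. by move=> Au Av; apply: subspaceD => //; apply: subspaceN. Qed.

Lemma subspace_subrr A v : A (v - v).
Proof. by rewrite subrr; exact: subspace0. Qed.

Lemma subspaceMn A v n : A v -> A (v *+ n).
Proof. by move=> Av; rewrite -scaler_nat; apply: subspaceZ. Qed.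

Lemma subspace_sub A u v : A (u - v) -> A v -> A u.
Proof. by move=> Auv Av; rewrite -[u](subrK v); apply: subspaceD. Qed.

Lemma subspace_sum A (I : Type) (r : seq I) (P : pred I) (F : I -> V) :
  (forall i, P i -> A (F i)) -> A (\sum_(i <- r | P i) F i).
Proof.
by move=> AF; apply: (big_ind A) => //; [exact: subspace0 | exact: subspaceD].
Qed.

Lemma subspace_lincomb A n (e : 'I_n -> V) c :
  (forall j, A (e j)) -> A (lincomb e c).
Proof. by move=> Ae; apply: subspace_sum => j _; apply: subspaceZ. Qed.

Definition sfull : subspace V := @Subspace K V (fun=> True) I (fun _ _ _ _ _ => I).

Lemma szero_subproof (a : K) u v : u = 0 -> v = 0 -> a *: u + v = 0.
Proof. by move=> -> ->; rewrite scaler0 addr0. Qed.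
Definition szero : subspace V :=
  @Subspace K V (fun v => v = 0) erefl szero_subproof.

Lemma sadd_subproof A B :
  (exists u v, [/\ A u, B v & 0 = u + v]) /\
  forall (a : K) u v, (exists u1 u2, [/\ A u1, B u2 & u = u1 + u2]) ->
    (exists v1 v2, [/\ A v1, B v2 & v = v1 + v2]) ->
    exists w1 w2, [/\ A w1, B w2 & a *: u + v = w1 + w2].
Proof.
split; first by exists 0, 0; split; rewrite ?addr0 //; exact: subspace0.
move=> a _ _ [u1 [u2 [? ? ->]]] [v1 [v2 [? ? ->]]].
exists (a *: u1 + v1), (a *: u2 + v2); split; try exact: subspaceP.
by rewrite scalerDr addrACA.
Qed.
Definition sadd A B : subspace V :=
  Subspace (sadd_subproof A B).1 (sadd_subproof A B).2.

Lemma sadd_l A B v : A v -> sadd A B v.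
Proof. by exists v, 0; split; rewrite ?addr0 //; exact: subspace0. Qed.

Lemma sadd_r A B v : B v -> sadd A B v.
Proof. by exists 0, v; split; rewrite ?add0r //; exact: subspace0. Qed.

Lemma scap_subproof A B :
  (A 0 /\ B 0) /\ forall (a : K) u v, A u /\ B u -> A v /\ B v ->
    A (a *: u + v) /\ B (a *: u + v).
Proof.
split; first by split; exact: subspace0.
by move=> a u v [? ?] [? ?]; split; exact: subspaceP.
Qed.
Definition scap A B : subspace V :=
  @Subspace K V (fun v => A v /\ B v) (scap_subproof A B).1 (scap_subproof A B).2.

End Subspaces.

Section Images.
Variables (V W : lmodType K) (phi : {linear V -> W}).

Lemma spre_subproof (B : subspace W) :
  B (phi 0) /\ forall (a : K) u v, B (phi u) -> B (phi v) -> B (phi (a *: u + v)).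
Proof.
split; first by rewrite linear0; exact: subspace0.
by move=> a u v Bu Bv; rewrite linearP; exact: subspaceP.
Qed.
Definition spre (B : subspace W) : subspace V :=
  @Subspace K V (fun v => B (phi v)) (spre_subproof B).1 (spre_subproof B).2.

Lemma simg_subproof (A : subspace V) :
  (exists2 v, A v & 0 = phi v) /\ forall (a : K) u v, (exists2 x, A x & u = phi x) ->
    (exists2 x, A x & v = phi x) -> exists2 x, A x & a *: u + v = phi x.
Proof.
split; first by exists 0; rewrite ?linear0 //; exact: subspace0.
move=> a _ _ [x Ax ->] [y Ay ->]; exists (a *: x + y); last by rewrite linearP.
exact: subspaceP.
Qed.
Definition simg (A : subspace V) : subspace W :=
  @Subspace K W (fun w => exists2 v, A v & w = phi v)
    (simg_subproof A).1 (simg_subproof A).2.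

Lemma simgI (A : subspace V) v : A v -> simg A (phi v).
Proof. by exists v. Qed.

End Images.

Section Indep.
Variable V : lmodType K.

Definition indep (A B : V -> Prop) n := exists e : 'I_n -> V,
  (forall j, A (e j)) /\ forall c, B (lincomb e c) -> c = 0.

(** One missing length is enough, as independent families can be shortened ([indepS]). *)
Definition fd (A B : V -> Prop) := exists n, ~ indep A B n.

(* The dimension of A / (A :&: B): B need not lie in A.  It is 0 when that
   quotient has infinite dimension. *)
Definition rdim (A B : V -> Prop) : nat :=
  xget 0%N (fun n => indep A B n /\ ~ indep A B n.+1).

Lemma indep0 A B : indep A B 0.
Proof. by exists (fun=> 0); split=> [[]//|c _]; apply/rowP => -[]. Qed.

Lemma indep_sub (A B A' B' : V -> Prop) n : (forall v, A v -> A' v) ->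
  (forall v, B' v -> B v) -> indep A B n -> indep A' B' n.
Proof.
by move=> AA BB [e [Ae Be]]; exists e; split=> [j|c /BB]; [exact/AA | exact: Be].
Qed.

Definition snoc n (e : 'I_n -> V) (v : V) (j : 'I_n.+1) : V :=
  oapp e v (unlift ord_max j).

Lemma snoc_lift n (e : 'I_n -> V) v j : snoc e v (lift ord_max j) = e j.
Proof. by rewrite /snoc liftK. Qed.

Lemma snoc_max n (e : 'I_n -> V) v : snoc e v ord_max = v.
Proof. by rewrite /snoc unlift_none. Qed.

Lemma lincomb_recr n (e : 'I_n.+1 -> V) c :
  lincomb e c = lincomb (e \o lift ord_max) (\row_j c 0 (lift ord_max j))
                + c 0 ord_max *: e ord_max.
Proof.
rewrite /lincomb big_ord_recr /=; congr (_ + _); apply: eq_bigr => j _.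
rewrite mxE; suff -> : widen_ord (leqnSn n) j = lift ord_max j by [].
by apply: val_inj; rewrite /= /bump leqNgt ltn_ord.
Qed.

Lemma indepS A B n : indep A B n.+1 -> indep A B n.
Proof.
move=> [e [Ae Be]]; exists (e \o lift ord_max); split=> [j|c Bc]; first exact: Ae.
pose c' : 'rV[K]_n.+1 := \row_j oapp (c 0) 0 (unlift ord_max j).
have c'0 : c' = 0.
  apply: Be; rewrite lincomb_recr mxE unlift_none /= scale0r addr0.
  suff -> : \row_j c' 0 (lift ord_max j) = c by [].
  by apply/rowP => j; rewrite !mxE liftK.
apply/rowP => j; have := congr1 (fun u : 'rV_ _ => u 0 (lift ord_max j)) c'0.
by rewrite !mxE liftK.
Qed.

Lemma indep_leq A B m n : (m <= n)%N -> indep A B n -> indep A B m.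
Proof.
by move/subnK <-; elim: (n - m)%N => [//|k IH]; rewrite addSn => /indepS.
Qed.

Lemma rdimP A B : fd A B -> indep A B (rdim A B) /\ ~ indep A B (rdim A B).+1.
Proof.
move=> [n nind].
suff [k indk] : exists k, indep A B k /\ ~ indep A B k.+1.
  by apply: (@xgetPex _ 0%N (fun n => indep A B n /\ ~ indep A B n.+1)); exists k.
elim: n nind => [|n IH] nind; first by have := indep0 A B.
by have [ind|/IH//] := pselect (indep A B n); exists n.
Qed.

Lemma rdim_unique A B n : indep A B n -> ~ indep A B n.+1 -> rdim A B = n.
Proof.
move=> ind nind; have [ind' nind'] : indep A B (rdim A B) /\ ~ indep A B (rdim A B).+1.
  by apply: rdimP; exists n.+1.
apply/eqP; rewrite eqn_leq; apply/andP; split; rewrite leqNgt; apply/negP => lt.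
  by apply: nind; apply: indep_leq ind'.
by apply: nind'; apply: indep_leq ind.
Qed.

Lemma fd_bound A B N : (forall n, indep A B n -> (n <= N)%N) -> fd A B.
Proof. by move=> h; exists N.+1 => /h; rewrite ltnn. Qed.

Lemma rdim_bound A B N : (forall n, indep A B n -> (n <= N)%N) -> (rdim A B <= N)%N.
Proof. by move=> h; exact: (h _ (rdimP (fd_bound h)).1). Qed.

Lemma indep_rdim A B n : fd A B -> indep A B n -> (n <= rdim A B)%N.
Proof.
move=> /rdimP[_ nind] ind; rewrite leqNgt; apply/negP => lt.
by apply: nind; apply: indep_leq ind.
Qed.

Lemma indep_spanned (A : V -> Prop) (B : subspace V) N (f : 'I_N -> V) n :
  (forall v, A v -> exists c, B (v - lincomb f c)) -> indep A B n -> (n <= N)%N.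
Proof.
move=> sp [e [Ae Be]]; rewrite leqNgt; apply/negP => ltNn.
have [M BM] := choice (fun j => sp _ (Ae j)).
pose MM : 'M[K]_(n, N) := \matrix_(i, j) M i 0 j.
(* With more than [N] vectors, the matrix of coordinates modulo [B] has a nonzero left kernel, and a
   row of that kernel is a relation modulo [B]. *)
have : kermx MM != 0.
  rewrite -mxrank_eq0 mxrank_ker -lt0n subn_gt0.
  by apply: leq_ltn_trans ltNn; apply: rank_leq_col.
case/rowV0Pn => c /sub_kermxP cM0 /eqP; apply; apply: Be.
have eqf : lincomb (fun j => lincomb f (M j)) c = lincomb f (c *m MM).
  have -> : c *m MM = \sum_j c 0 j *: M j.
    apply/rowP => k; rewrite mxE summxE; apply: eq_bigr => j _.
    by rewrite !mxE.
  by rewrite linear_sum; apply: eq_bigr => j _; rewrite linearZ.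
rewrite -[lincomb e c](subrK (lincomb f (c *m MM))) -{1}eqf -lincombB.
by rewrite cM0 linear0 addr0; apply: subspace_lincomb.
Qed.

Lemma fd_trivial (A : V -> Prop) (B : subspace V) : (forall v, A v -> v = 0) ->
  fd A B /\ rdim A B = 0%N.
Proof.
move=> A0; suff bound n : indep A B n -> (n <= 0)%N.
  split; first exact: fd_bound bound.
  by apply/eqP; rewrite -leqn0; exact: rdim_bound.
case: n => // n [e [Ae Be]]; have := Be (const_mx 1).
rewrite /lincomb big1 => [/(_ (subspace0 _)) /rowP /(_ ord0) /eqP|j _].
  by rewrite !mxE oner_eq0.
by rewrite (A0 _ (Ae j)) scaler0.
Qed.

Definition is_basis (A B : V -> Prop) n (e : 'I_n -> V) :=
  [/\ forall j, A (e j), forall c, B (lincomb e c) -> c = 0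
    & forall v, A v -> exists c, B (v - lincomb e c)].

Lemma basis_rdim (A B : subspace V) n (e : 'I_n -> V) :
  is_basis A B e -> fd A B /\ rdim A B = n.
Proof.
move=> [Ae Be sp]; have nind : ~ indep A B n.+1.
  by move/(indep_spanned sp); rewrite ltnn.
by split; [exists n.+1 | apply: rdim_unique => //; exists e].
Qed.

(** A family of maximal length spans: a vector outside its span modulo [B] could be appended with
    [snoc]. *)
Lemma exists_basis (A B : subspace V) : fd A B ->
  exists e : 'I_(rdim A B) -> V, is_basis A B e.
Proof.
move/rdimP => [[e [Ae Be]] nind]; exists e; split=> // v Av.
apply: contrapT => nc; apply: nind; exists (snoc e v); split=> [j|c].
  by case: (unliftP ord_max j) => [k|] ->; rewrite ?snoc_lift ?snoc_max.
rewrite lincomb_recr snoc_max.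
have -> : lincomb (snoc e v \o lift ord_max) = lincomb e.
  by apply/funext => c'; apply: eq_bigr => j _; rewrite /= snoc_lift.
set c1 := \row_j _; have [c0|c0 Bc] := eqVneq (c 0 ord_max) 0.
  rewrite c0 scale0r addr0 => /Be c10; apply/rowP => j; rewrite mxE.
  case: (unliftP ord_max j) => [k|] -> //.
  by have := congr1 (fun u : 'rV_ _ => u 0 k) c10; rewrite !mxE.
case: nc; exists (- (c 0 ord_max)^-1 *: c1).
have -> : v - lincomb e (- (c 0 ord_max)^-1 *: c1)
        = (c 0 ord_max)^-1 *: (lincomb e c1 + c 0 ord_max *: v).
  by rewrite linearZ /= scaleNr opprK scalerDr scalerA mulVf // scale1r addrC.
exact: subspaceZ.
Qed.

End Indep.

(** The hypotheses say that [phi] induces an isomorphism from A / (A :&: B) to A' / (A' :&: B'). The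
    conclusion is an equality of predicates so that [fd] and [rdim] both follow by rewriting. *)
Lemma indep_iso (V W : lmodType K) (phi : {linear V -> W}) (A B : subspace V)
    (A' B' : subspace W) :
  (forall v, A v -> A' (phi v)) ->
  (forall w, A' w -> exists2 v, A v & B' (w - phi v)) ->
  (forall v, A v -> B v <-> B' (phi v)) ->
  indep A B = indep A' B'.
Proof.
move=> AA onto BB; apply/funext => n; apply/propext; split=> -[e [Ae Be]].
  exists (phi \o e); split=> [j|c]; first exact/AA.
  rewrite -lincomb_linear => h; apply: Be; apply/BB => //.
  exact: subspace_lincomb.
have lift j : exists v, A v /\ B' (e j - phi v).
  by have [v] := onto _ (Ae j); exists v.
have [e' he'] := choice lift.
exists e'; split=> [j|c Bc]; first by case: (he' j).
apply: Be; apply: (subspace_sub (v := phi (lincomb e' c))).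
  rewrite lincomb_linear -lincombB; apply: subspace_lincomb => j.
  by case: (he' j).
apply/BB => //; apply: subspace_lincomb => j; by case: (he' j).
Qed.

Lemma fd_iso (V W : lmodType K) (phi : {linear V -> W}) (A B : subspace V)
    (A' B' : subspace W) :
  (forall v, A v -> A' (phi v)) ->
  (forall w, A' w -> exists2 v, A v & B' (w - phi v)) ->
  (forall v, A v -> B v <-> B' (phi v)) ->
  (fd A B <-> fd A' B') /\ rdim A B = rdim A' B'.
Proof. by move=> h1 h2 h3; rewrite /fd /rdim (indep_iso h1 h2 h3). Qed.

Lemma fd_inj (V W : lmodType K) (phi : {linear V -> W}) (A B : subspace V)
    (A' B' : subspace W) :
  (forall v, A v -> A' (phi v)) -> (forall v, A v -> B' (phi v) -> B v) ->
  fd A' B' -> fd A B.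
Proof.
move=> AA BB [n nind]; exists n => -[e [Ae Be]]; apply: nind.
exists (phi \o e); split=> [j|c]; first exact: AA.
rewrite -lincomb_linear => /BB h; apply/Be/h; exact: subspace_lincomb.
Qed.

Lemma fd_surj (V W : lmodType K) (phi : {linear V -> W}) (A B : subspace V)
    (A' B' : subspace W) :
  (forall w, A' w -> exists2 v, A v & B' (w - phi v)) ->
  (forall v, A v -> B v -> B' (phi v)) -> fd A B -> fd A' B'.
Proof.
move=> onto BB [n nind]; exists n => -[e [Ae Be]]; apply: nind.
have lift j : exists v, A v /\ B' (e j - phi v).
  by have [v] := onto _ (Ae j); exists v.
have [e' he'] := choice lift.
exists e'; split=> [j|c Bc]; first by case: (he' j).
apply: Be; apply: (subspace_sub (v := phi (lincomb e' c))).
  rewrite lincomb_linear -lincombB; apply: subspace_lincomb => j.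
  by case: (he' j).
by apply: BB => //; apply: subspace_lincomb => j; case: (he' j).
Qed.

Section Additivity.
Variables (V : lmodType K) (Z Y B : subspace V).
Hypotheses (BY : forall v, B v -> Y v) (YZ : forall v, Y v -> Z v).

Lemma fd_quot : fd Z B -> fd Z Y.
Proof. by move=> [n nind]; exists n; apply: contra_not nind; apply: indep_sub. Qed.

Lemma fd_sub : fd Z B -> fd Y B.
Proof. by move=> [n nind]; exists n; apply: contra_not nind; apply: indep_sub. Qed.

Lemma fd_rdim_add : fd Z Y -> fd Y B ->
  fd Z B /\ rdim Z B = (rdim Z Y + rdim Y B)%N.
Proof.
move=> /exists_basis[e [Ze Ye spe]] /exists_basis[f [Yf Bf spf]].
pose g j := match split j with inl i => e i | inr i => f i end.
have gE c : lincomb g c = lincomb e (lsubmx c) + lincomb f (rsubmx c).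
  rewrite /lincomb big_split_ord /=; congr (_ + _); apply: eq_bigr => j _.
    by rewrite /g (unsplitK (inl j)) mxE.
  by rewrite /g (unsplitK (inr j)) mxE.
apply: (@basis_rdim _ _ _ _ g); split=> [j|c|v Zv].
- by rewrite /g; case: split => i; [exact: Ze | exact/YZ/Yf].
- rewrite gE => Bc.
  have c10 : lsubmx c = 0.
    apply: Ye; rewrite -[lincomb e _](addrK (lincomb f (rsubmx c))).
    by apply: subspaceB; [exact: BY | exact: subspace_lincomb].
  move: Bc; rewrite c10 linear0 add0r => /Bf c20.
  by rewrite -[c]hsubmxK c10 c20 row_mx0.
have [c1 /spf[c2 h]] := spe _ Zv.
by exists (row_mx c1 c2); rewrite gE row_mxKl row_mxKr opprD addrA.
Qed.

Lemma rdim_add : fd Z B -> rdim Z B = (rdim Z Y + rdim Y B)%N.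
Proof. by move=> h; apply: (fd_rdim_add (fd_quot h) (fd_sub h)).2. Qed.

End Additivity.

(** Exactness in the middle: [Y / B2] is the kernel of [Z2 / B2 -> Z3 / B3], and each of its classes
    comes from [Z1] through [al]; the quotient by it embeds in [Z3 / B3]. *)
Lemma fd_exact (V1 V2 V3 : lmodType K) (al : {linear V1 -> V2})
    (be : {linear V2 -> V3}) (Z1 B1 : subspace V1) (Z2 B2 : subspace V2)
    (Z3 B3 : subspace V3) :
  (forall v, B2 v -> Z2 v) -> (forall v, B2 v -> B3 (be v)) ->
  (forall v, Z1 v -> B1 v -> B2 (al v)) ->
  (forall v, Z2 v -> Z3 (be v)) ->
  (forall v, Z2 v -> B3 (be v) -> exists2 u, Z1 u & B2 (v - al u)) ->
  fd Z1 B1 -> fd Z3 B3 -> fd Z2 B2.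
Proof.
move=> BZ B23 B12 Z23 ex fd1 fd3; pose Y := scap Z2 (spre be B3).
have BY v : B2 v -> Y v by move=> Bv; split; [exact: BZ | exact: B23].
have YZ v : Y v -> Z2 v by case.
apply: (proj1 (fd_rdim_add BY YZ _ _)).
  by apply: (fd_inj (phi := be)) fd3 => // v Zv Bv; split.
apply: (fd_surj (phi := al)) fd1 => // v [Zv Bv]; exact: ex.
Qed.

(** Both sides pick from the same set of integers, so the default value 0 also agrees in infinite
    dimension. *)
Lemma vdim_rdim (V : lmodType K) : vdim V = rdim (sfull V) (szero V).
Proof.
rewrite /vdim /rdim; congr xget; apply/seteqP; split=> [n [e he]|n [[e [Ae Be]] nind]].
  have [fdV rdV] : fd (sfull V) (szero V) /\ rdim (sfull V) (szero V) = n.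
    apply: (@basis_rdim _ _ _ _ e); split=> // [c c0|v _].
      have [c' [_ cu]] := he 0.
      have c'0 : c' = 0 by apply: cu; exact/esym/(linear0 (lincomb e)).
      by rewrite -c'0; apply/esym/cu/esym.
    by have [c [-> _]] := he v; exists c; rewrite /= subrr.
  by have := rdimP fdV; rewrite rdV.
have rd : rdim (sfull V) (szero V) = n by apply: rdim_unique => //; exists e.
have fdV : fd (sfull V) (szero V) by exists n.+1.
have := exists_basis fdV; rewrite rd => -[f [_ f0 fs]]; exists f => v.
have [c /eqP] := fs v I; rewrite subr_eq0 => /eqP vE; exists c; split=> // c' vE'.
apply/eqP; rewrite -subr_eq0; apply/eqP/f0.
by rewrite /= linearB /= -[lincomb f c]vE -[lincomb f c']vE' subrr.
Qed.

Lemma subquot_class_is_linear (V : lmodType K) (Z B : subspace V) :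
  linear (@subquot_class K V Z B).
Proof. by move=> a u v; rewrite subquot_classD subquot_classZ. Qed.
HB.instance Definition _ (V : lmodType K) (Z B : subspace V) :=
  GRing.isLinear.Build K (subspace_type Z) (subquot Z B) _
    (@subquot_class K V Z B) (@subquot_class_is_linear V Z B).

Lemma vdim_subquot (V : lmodType K) (Z B : subspace V) :
  vdim (subquot Z B) = rdim Z B.
Proof.
rewrite vdim_rdim; pose f : {linear subspace_type Z -> V} := val.
pose g : {linear subspace_type Z -> subquot Z B} := @subquot_class K V Z B.
have <- : rdim (sfull (subspace_type Z)) (spre f B) = rdim Z B.
  apply: (fd_iso (phi := f) _ _ _).2 => [v _|w Zw|//]; first exact: subspace_typeP.
  by exists (subspace_elt Zw) => //=; rewrite subrr; exact: subspace0.
apply/esym/(fd_iso (phi := g) _ _ _).2 => // [w _|v _].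
  by exists (repr w) => //=; rewrite subquot_classK subrr.
by rewrite /= -(linear0 g); rewrite subquot_classP /= subr0.
Qed.

End RelativeDimension.

Lemma indep_fin (K : fieldType) (V : lmodType K) (T : finType) (e : T -> V)
    (A B : V -> Prop) : (forall t, A (e t)) ->
  (forall c : T -> K, B (\sum_t c t *: e t) -> forall t, c t = 0) -> indep A B #|T|.
Proof.
move=> Ae Be; exists (e \o @enum_val T T); split=> [j|c Bc]; first exact: Ae.
apply/rowP => j; rewrite mxE -[j]enum_valK.
apply: (Be (fun t => c 0 (enum_rank t))) => {j}.
suff -> : \sum_t c 0 (enum_rank t) *: e t = lincomb (e \o @enum_val T T) c by [].
rewrite /lincomb (reindex (@enum_val T T)) /=; last exact/onW_bij/enum_val_bij.
by apply: eq_bigr => j _; rewrite enum_valK.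
Qed.

Lemma indep_spanned_fin (K : fieldType) (V : lmodType K) (T : finType) (f : T -> V)
    (A : V -> Prop) (B : subspace V) n :
  (forall v, A v -> exists c : T -> K, B (v - \sum_t c t *: f t)) ->
  indep A B n -> (n <= #|T|)%N.
Proof.
move=> sp; apply: (@indep_spanned _ _ _ _ _ (f \o @enum_val T T)) => v /sp[c Bc].
exists (\row_j c (enum_val j)).
suff -> : lincomb (f \o @enum_val T T) (\row_j c (enum_val j)) = \sum_t c t *: f t by [].
rewrite [RHS](reindex (@enum_val T T)) /=; last exact/onW_bij/enum_val_bij.
by apply: eq_bigr => j _; rewrite mxE.
Qed.

Lemma indep_sadd (K : fieldType) (V : lmodType K) (A B C : subspace V) :
  (forall v, C v -> B v) -> indep A B = indep (sadd A C) B.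
Proof.
move=> CB; apply: (indep_iso (phi := idfun)) => //= [v|w [u [v [Au Cv ->]]]].
  exact: sadd_l.
by exists u => //; rewrite addrC addKr; apply: CB.
Qed.

(** * Filtrations of polynomial growth *)

Section Growth.
Variables (K : fieldType) (V : lmodType K).

Record weyl_ops r (X D : 'I_r -> {linear V -> V}) : Prop := WeylOps {
  opsXX : forall i j v, X i (X j v) = X j (X i v);
  opsDD : forall i j v, D i (D j v) = D j (D i v);
  opsDX : forall i j v, D i (X j v) = X j (D i v) + v *+ (i == j) }.

Definition stable r (X : 'I_r -> {linear V -> V}) (A : subspace V) : Prop :=
  forall i v, A v -> A (X i v).

(* The associated graded space need not be finitely generated, unlike for a good
   Bernstein filtration: this is what makes subquotients immediate. *)
Record growth r (X D : 'I_r -> {linear V -> V}) (Z B : subspace V) (c : nat)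
    (F : nat -> subspace V) : Prop := Growth {
  growth_bot : forall k v, B v -> F k v;
  growth_top : forall k v, F k v -> Z v;
  growth_S : forall k v, F k v -> F k.+1 v;
  growth_X : forall i k v, F k v -> F k.+1 (X i v);
  growth_D : forall i k v, F k v -> F k.+1 (D i v);
  growth_ex : forall v, Z v -> exists k, F k v;
  growth_bound : forall k n, indep (F k) B n -> (n <= c * k.+1 ^ r)%N }.

Lemma growth_leq r (X D : 'I_r -> {linear V -> V}) (Z B : subspace V) c F k l v :
  growth X D Z B c F -> (k <= l)%N -> F k v -> F l v.
Proof.
move=> gF /subnK <-; elim: (l - k)%N => // j IH /IH; exact: (growth_S gF).
Qed.

(** The induced filtration, with [B'] added so that every step contains it; modulo [B'] this changes
    nothing. The constant [c] survives because independence modulo [B'] implies independence modulo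
    the smaller [B]. *)
Lemma growth_subquot r (X D : 'I_r -> {linear V -> V}) (Z B Z' B' : subspace V) c F :
  (forall v, Z' v -> Z v) -> (forall v, B v -> B' v) -> (forall v, B' v -> Z' v) ->
  stable X Z' -> stable D Z' -> stable X B' -> stable D B' ->
  growth X D Z B c F ->
  growth X D Z' B' c (fun k => sadd (scap (F k) Z') B').
Proof.
move=> ZZ BB BZ XZ DZ XB DB gF; split=> [k v Bv|k _ [u [v [[_ Zu] Bv ->]]]|||||].
- exact: sadd_r.
- by apply: subspaceD => //; apply: BZ.
- move=> k _ [u [v [[Fu Zu] Bv ->]]]; exists u, v; split=> //; split=> //.
  exact: growth_S gF _ _ Fu.
- move=> i k _ [u [v [[Fu Zu] Bv ->]]]; exists (X i u), (X i v).
  split; [split; [exact: (growth_X gF)|exact: XZ] | exact: XB | exact: linearD].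
- move=> i k _ [u [v [[Fu Zu] Bv ->]]]; exists (D i u), (D i v).
  split; [split; [exact: (growth_D gF)|exact: DZ] | exact: DB | exact: linearD].
- move=> v Zv; have [k Fv] := growth_ex gF (ZZ _ Zv); exists k.
  exact: sadd_l.
move=> k n; rewrite -indep_sadd // => ind; apply: (growth_bound gF).
by apply: indep_sub ind => // v [].
Qed.

(** For [r = 0] the bound is [c] at every step, and a finite family lies in a single step of the
    filtration. *)
Lemma growth0_fd (X D : 'I_0 -> {linear V -> V}) (Z B : subspace V) c F :
  growth X D Z B c F -> fd Z B.
Proof.
move=> gF; apply: (fd_bound (N := c)) => n [e [Ze Be]].
have [k Fk] := choice (fun j => growth_ex gF (Ze j)).
have := growth_bound gF (k := \sum_j k j) (n := n); rewrite expn0 muln1; apply.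
exists e; split=> // j; apply: growth_leq gF _ (Fk j).
by rewrite (bigD1 j) //= leq_addr.
Qed.

Section KernelCokernel.
Hypothesis charK : [pchar K] =i pred0.
Variables (r : nat) (X D : 'I_r.+1 -> {linear V -> V}) (k0 : 'I_r.+1).
Hypothesis ops : weyl_ops X D.
Variables (Z B : subspace V) (c : nat) (F : nat -> subspace V).
Hypotheses (XB : stable X B) (DB : stable D B) (gF : growth X D Z B c F).
Local Notation x := (X k0).
Local Notation d := (D k0).
Local Notation X' := (fun i => X (lift k0 i)).
Local Notation D' := (fun i => D (lift k0 i)).
Local Notation ker := (spre x B).

Lemma stable_X_top : stable X Z.
Proof.
move=> i v /(growth_ex gF)[k Fv]; apply: (growth_top gF (k := k.+1)).
exact: (growth_X gF).
Qed.

Lemma stable_D_top : stable D Z.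
Proof.
move=> i v /(growth_ex gF)[k Fv]; apply: (growth_top gF (k := k.+1)).
exact: (growth_D gF).
Qed.

(** The commutator of x with d^a is -a d^(a-1). At [a = 0] the truncated predecessor is harmless,
    its multiplicity being 0. *)
Lemma X_iter_D a v : x (iter a d v) = iter a d (x v) - iter a.-1 d v *+ a.
Proof.
elim: a => [|a IH]; first by rewrite mulr0n subr0.
rewrite iterS; have /eqP := opsDX ops k0 k0 (iter a d v).
rewrite eqxx mulr1n -subr_eq => /eqP <-; rewrite IH linearB linearMn /=.
rewrite -addrA; congr (_ + _); case: a {IH} => [|a]; first by rewrite mulr0n oppr0 add0r.
by rewrite -opprD -mulrSr.
Qed.

(** Modulo [B], x kills every [g a], hence sends d^a (g a) to -a d^(a-1) (g a). Applying x to the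
    relation shortens it by one term, and induction applies to the multiples [g a.+1 *+ a.+1]. *)
Lemma iter_D_indep k (g : nat -> V) : (forall a, B (x (g a))) ->
  B (\sum_(a < k) iter a d (g a)) -> forall a, (a < k)%N -> B (g a).
Proof.
have Bd a v : B v -> B (iter a d v) by move=> Bv; elim: a => //= a; apply: DB.
elim: k g => // k IH g Bxg Bs.
have gS a : (a < k)%N -> B (g a.+1).
  move=> ak; apply: (@subspaceZ_eq _ _ _ a.+1%:R).
    by rewrite (iffLR (pcharf0P K) charK).
  rewrite scaler_nat; move: a ak; apply: IH => [a|].
    by rewrite linearMn; apply: subspaceMn.
  have := XB k0 Bs; rewrite linear_sum big_ord_recl /= => Bs'.
  have Bsum : B (\sum_(i < k) iter i.+1 d (x (g i.+1))).
    by apply: subspace_sum => i _; apply: Bd.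
  have := subspaceB Bs' (Bxg 0%N); rewrite addrAC subrr add0r => /(subspaceB Bsum).
  rewrite -sumrB; congr (B _); apply: eq_bigr => i _.
  rewrite [X in _ - X](X_iter_D i.+1) subKr /=.
  have dMn l n v : iter l d (v *+ n) = iter l d v *+ n.
    by elim: l => //= l ->; rewrite linearMn.
  by rewrite dMn.
case=> [_|a]; last exact: gS.
move: Bs; rewrite big_ord_recl /= addrC => Bs.
rewrite -[g 0%N](addKr (\sum_(i < k) iter (lift ord0 i) d (g (lift ord0 i)))).
rewrite addrC; apply: subspaceB => //; apply: subspace_sum => i _.
apply: (Bd i.+1); exact: gS.
Qed.

Lemma growth_iter_D a k v : F k v -> F (a + k) (iter a d v).
Proof. by move=> Fv; elim: a => //= a; apply: (growth_D gF). Qed.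

(* If e is independent modulo B in F k :&: ker x, then so are the k + 1 families
   d^a e, a <= k, and they lie in F (2k). *)
Lemma growth_ker :
  growth X' D' (scap Z ker) B (c * 2 ^ r.+1) (fun k => scap (F k) ker).
Proof.
split.
- by move=> k v Bv; split; [exact: (growth_bot gF) | exact: XB].
- by move=> k v [/(growth_top gF) Zv kv].
- by move=> k v [/(growth_S gF) Zv kv].
- move=> i k v [Fv kv]; split; first exact: (growth_X gF).
  by rewrite /= (opsXX ops); apply: XB.
- move=> i k v [Fv kv]; split; first exact: (growth_D gF).
  have := opsDX ops (lift k0 i) k0 v; rewrite eq_sym (negPf (neq_lift k0 i)) mulr0n addr0 /= => <-.
  exact: DB.
- by move=> v [/(growth_ex gF)[k Fv] kv]; exists k.
move=> k n [e [Fe Be]].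
have ind : indep (F (k + k)%N) B #|{: 'I_k.+1 * 'I_n}|.
  apply: (@indep_fin _ _ _ (fun t : 'I_k.+1 * 'I_n => iter t.1 d (e t.2))) => [[a j]|b].
    have [Fj _] := Fe j; apply: (@growth_leq _ _ _ _ _ _ _ (a + k)%N _ _ gF).
      by rewrite leq_add2r -ltnS.
    exact: growth_iter_D.
  pose g a := lincomb e (\row_j b (inord a, j)).
  have -> : \sum_t b t *: iter (t.1 : 'I_k.+1) d (e t.2)
          = \sum_(a < k.+1) iter a d (g a).
    transitivity (\sum_(a < k.+1) \sum_(j < n) b (a, j) *: iter a d (e j)).
      by rewrite pair_bigA; apply: eq_bigr => -[].
    apply: eq_bigr => a _; rewrite /g inord_val.
    have -> : iter a d (lincomb e (\row_j b (a, j)))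
            = lincomb (fun j => iter a d (e j)) (\row_j b (a, j)).
      elim: (nat_of_ord a) => //= i ->; exact: lincomb_linear.
    by apply: eq_bigr => j _; rewrite mxE.
  move=> Bs; have Bg := @iter_D_indep _ g _ Bs.
  case=> a j; have := Be (\row_j b (a, j)).
  have -> : lincomb e (\row_j b (a, j)) = g a by rewrite /g inord_val.
  move=> /(_ (Bg _ _ _)) h.
  have /rowP /(_ j) : \row_j b (a, j) = 0; last by rewrite !mxE.
  apply: h => // i; rewrite /g lincomb_linear; apply: subspace_lincomb => l.
  by case: (Fe l).
have := growth_bound gF ind; rewrite card_prod !card_ord.
(* The bound at step 2k reads (k+1) n <= c (2k+1)^(r+1) <= c 2^(r+1) (k+1)^(r+1). Dividing by k+1
   lowers the exponent and gives the constant. *)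
have : ((k + k).+1 ^ r.+1 <= (2 * k.+1) ^ r.+1)%N by rewrite leq_exp2r //; lia.
move=> h1 h2; rewrite -(@leq_pmul2l k.+1) //; apply: leq_trans h2 _.
apply: (leq_trans (leq_mul (leqnn c) h1)).
by rewrite expnMn (expnS k.+1) mulnA mulnCA.
Qed.

(* Telescoping g (l + 1) <= f (l + 1) - f l + dim (F l :&: ker x), where f and g
   are the dimensions of the images of F l in Z / B and in Z / (B + xZ); g is
   nondecreasing. *)
Lemma growth_coker_sum k j :
  (j * rdim (F k) (sadd B (simg x Z)) + rdim (F k) B
   <= rdim (F (k + j)%N) B + \sum_(i < j) rdim (scap (F (k + i)%N) ker) B)%N.
Proof.
have fdF l : fd (F l) B by apply: fd_bound; exact: (growth_bound gF).
set B' := sadd _ _.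
have BB' v : B v -> B' v by exact: sadd_l.
have fdF' l : fd (F l) B'.
  by have [n h] := fdF l; exists n; apply: contra_not h; apply: indep_sub.
elim: j => [|j IH]; first by rewrite addn0 big_ord0 addn0 mul0n.
(* x induces an isomorphism from F l / (F l :&: ker x) onto (B + x F l) / B, which sits inside F
   (l+1) / B; what remains of F (l+1) maps onto its image modulo B + xZ. *)
have step l : (rdim (F l.+1) B' + rdim (F l) B
               <= rdim (F l.+1) B + rdim (scap (F l) ker) B)%N.
  have -> : rdim (F l) B = (rdim (F l) (scap (F l) ker) + rdim (scap (F l) ker) B)%N.
    apply: rdim_add => // v; last by case.
    by move=> Bv; split; [exact: (growth_bot gF) | exact: XB].
  rewrite addnA leq_add2r.
  have -> : rdim (F l) (scap (F l) ker) = rdim (sadd B (simg x (F l))) B.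
    apply: (fd_iso (phi := x) _ _ _).2 => [v Fv|_ [u [_ [Bu [v Fv ->] ->]]]|v Fv].
    - exact/sadd_r/simgI.
    - by exists v => //; rewrite addrK.
    - by split=> [[]|].
  have YF v : sadd B (simg x (F l)) v -> F l.+1 v.
    move=> [u [_ [Bu [w Fw ->] ->]]]; apply: subspaceD.
      exact: (growth_bot gF).
    exact: (growth_X gF).
  have BY v : B v -> sadd B (simg x (F l)) v by exact: sadd_l.
  rewrite (rdim_add BY YF (fdF _)) leq_add2r.
  apply: indep_rdim; first exact: fd_quot (fdF _).
  apply: indep_sub (rdimP (fdF' _)).1 => // v [u [_ [Bu [w Fw ->] ->]]].
  by exists u, (x w); split=> //; apply: simgI; apply: (growth_top gF) Fw.
have mono : (rdim (F k) B' <= rdim (F (k + j).+1) B')%N.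
  apply: indep_rdim => //; apply: indep_sub (rdimP (fdF' _)).1 => // v.
  by apply: growth_leq gF _; lia.
have := step (k + j)%N.
have -> : (\sum_(i < j.+1) rdim (scap (F (k + i)%N) ker) B
  = \sum_(i < j) rdim (scap (F (k + i)%N) ker) B + rdim (scap (F (k + j)%N) ker) B)%N.
  by rewrite big_ord_recr.
by rewrite addnS mulSn; move: IH mono; lia.
Qed.

(** [growth_coker_sum] with [j = k.+1] bounds (k+1) times the wanted dimension by dim F (2k+1) plus
    k+1 kernel dimensions. These are at most c (2(k+1))^(r+1) and c 2^(r+1) (2(k+1))^r each; after
    division by k+1 they yield the two summands of the constant. *)
Lemma growth_coker :
  growth X' D' Z (sadd B (simg x Z)) (c * 2 ^ r.+1 + c * 2 ^ r.+1 * 2 ^ r)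
    (fun k => sadd (F k) (simg x Z)).
Proof.
have XZ := stable_X_top; have DZ := stable_D_top.
split.
- move=> k _ [u [v [Bu xv ->]]]; exists u, v; split=> //; exact: (growth_bot gF).
- move=> k _ [u [_ [Fu [v Zv ->] ->]]]; apply: subspaceD; last exact: XZ.
  exact: growth_top gF _ _ Fu.
- move=> k _ [u [v [Fu xv ->]]]; exists u, v; split=> //; exact: (growth_S gF).
- move=> i k _ [u [_ [Fu [v Zv ->] ->]]]; exists (X' i u), (x (X' i v)); split.
  + exact: (growth_X gF).
  + exact/simgI/XZ.
  + by rewrite linearD /= (opsXX ops).
- move=> i k _ [u [_ [Fu [v Zv ->] ->]]]; exists (D' i u), (x (D' i v)); split.
  + exact: (growth_D gF).
  + exact/simgI/DZ.
  + rewrite linearD /= (opsDX ops) eq_sym (negPf (neq_lift k0 i)) mulr0n.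
    by rewrite addr0.
- by move=> v /(growth_ex gF)[k Fv]; exists k; apply: sadd_l.
move=> k n; rewrite -indep_sadd; last exact: sadd_r.
have fdF : fd (F k) (sadd B (simg x Z)).
  apply: (fd_bound (N := c * k.+1 ^ r.+1)%N) => l ind; apply: (growth_bound gF).
  by apply: indep_sub ind => // v; apply: sadd_l.
move=> /(indep_rdim fdF) le_n; apply: leq_trans le_n _.
have := growth_coker_sum k k.+1; set g := rdim _ (sadd _ _) => h.
have h1 : (rdim (F (k + k.+1)) B <= c * (2 * k.+1) ^ r.+1)%N.
  apply: rdim_bound => l /(growth_bound gF).
  suff -> : (k + k.+1).+1 = (2 * k.+1)%N by []. by lia.
have h2 : (\sum_(i < k.+1) rdim (scap (F (k + i)%N) ker) B
           <= k.+1 * (c * 2 ^ r.+1 * (2 * k.+1) ^ r))%N.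
  have -> : (k.+1 * (c * 2 ^ r.+1 * (2 * k.+1) ^ r)
             = \sum_(i < k.+1) c * 2 ^ r.+1 * (2 * k.+1) ^ r)%N.
    by rewrite sum_nat_const card_ord.
  apply: leq_sum => i _; apply: rdim_bound => l /(growth_bound growth_ker) h'.
  apply: leq_trans h' _; rewrite leq_mul2l; apply/orP; right.
  case: r => [|s]; first by rewrite !expn0.
  by rewrite leq_exp2r //; have := ltn_ord i; lia.
rewrite -(@leq_pmul2l k.+1) //.
rewrite expnMn in h1; rewrite expnMn in h2; rewrite [(k.+1 ^ r.+1)%N]expnS in h1.
have h3 : (k.+1 * g <= rdim (F (k + k.+1)) B
  + \sum_(i < k.+1) rdim (scap (F (k + i)%N) ker) B)%N.
  by apply: leq_trans h; apply: leq_addr.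
apply: (leq_trans h3); apply: (leq_trans (leq_add h1 h2)).
rewrite mulnDl mulnDr; apply: leq_add; rewrite leq_eqVlt; apply/orP; left; apply/eqP.
  by rewrite mulnA [RHS]mulnCA.
by rewrite !mulnA.
Qed.

End KernelCokernel.
End Growth.

Lemma big_ord_lift (T : Type) (idx : T) (op : Monoid.com_law idx) m (k : 'I_m.+1)
    (P : pred 'I_m.+1) (F : 'I_m.+1 -> T) :
  \big[op/idx]_(i | P i) F i
  = op (if P k then F k else idx) (\big[op/idx]_(i | P (lift k i)) F (lift k i)).
Proof. by rewrite big_mkcond (bigD1_ord k) // -big_mkcond. Qed.

Lemma ltn_lift2 m (k : 'I_m.+1) (i j : 'I_m) :
  (lift k i < lift k j)%N = (i < j)%N.
Proof. by rewrite /= /bump; do 2 case: leqP => /= ?; lia. Qed.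

(** * Koszul complexes *)

Section KoszulContraction.
Variables (K : fieldType) (m : nat) (N : lmodType K) (psi : 'I_m -> {linear N -> N}).

(** The interior product by the sum of the psi_i e_i^*: contracting e_(L U {i}) by e_i^* moves e_i
    to the front past the j < i in L. It lowers the degree by one. *)
Definition koszul_contract (w : {ffun {set 'I_m} -> N}) : {ffun {set 'I_m} -> N} :=
  [ffun L : {set 'I_m} =>
    \sum_(i | i \notin L) (-1) ^+ #|[set j in L | (j < i)%N]| *: psi i (w (i |: L))].

Lemma koszul_contract_is_linear : linear koszul_contract.
Proof.
move=> a u v; apply/ffunP => L; rewrite !ffunE scaler_sumr -big_split /=.
apply: eq_bigr => i _; rewrite !ffunE linearP /= scalerDr !scalerA.
by rewrite [a * _]mulrC.
Qed.
HB.instance Definition _ := GRing.isLinear.Build K _ _ _ koszul_contract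
  koszul_contract_is_linear.

End KoszulContraction.

Section KoszulSplit.
Variables (K : fieldType) (N : lmodType K) (m : nat) (k : 'I_m.+1).
Local Notation lk := (lift k).
Implicit Types (J : {set 'I_m}) (L : {set 'I_m.+1}) (w : {ffun {set 'I_m.+1} -> N}).

Definition set_up J : {set 'I_m.+1} := [set lk i | i in J].

Lemma mem_up J i : (lk i \in set_up J) = (i \in J).
Proof. by rewrite mem_imset //; exact: lift_inj. Qed.

Lemma mem_up_k J : (k \in set_up J) = false.
Proof. by apply/imsetP => -[i _ /eqP]; rewrite (negPf (neq_lift k i)). Qed.

Lemma mem_upk J i : (lk i \in k |: set_up J) = (i \in J).
Proof. by rewrite !inE mem_up eq_sym (negPf (neq_lift k i)). Qed.

Lemma set_lift_eq L L' : (k \in L) = (k \in L') ->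
  (forall i, (lk i \in L) = (lk i \in L')) -> L = L'.
Proof. by move=> ek el; apply/setP => i; case: (unliftP k i) => [j|] ->. Qed.

Definition set_down L : {set 'I_m} := [set i | lk i \in L].

Lemma set_upK J : set_down (set_up J) = J.
Proof. by apply/setP => i; rewrite inE mem_up. Qed.

Lemma set_upkK J : set_down (k |: set_up J) = J.
Proof. by apply/setP => i; rewrite inE mem_upk. Qed.

Lemma set_downK L :
  L = if k \in L then k |: set_up (set_down L) else set_up (set_down L).
Proof.
case: ifP => kL; apply: set_lift_eq => [|i].
- by rewrite kL setU11.
- by rewrite mem_upk inE.
- by rewrite kL mem_up_k.
- by rewrite mem_up inE.
Qed.

Lemma card_up J : #|set_up J| = #|J|.
Proof. by rewrite card_imset //; exact: lift_inj. Qed.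

Lemma card_upk J : #|k |: set_up J| = #|J|.+1.
Proof. by rewrite cardsU1 mem_up_k card_up. Qed.

Lemma up_D1 J i : set_up J :\ lk i = set_up (J :\ i).
Proof.
apply: set_lift_eq => [|j]; first by rewrite in_setD1 !mem_up_k andbF.
by rewrite in_setD1 !mem_up in_setD1 (inj_eq (@lift_inj _ k)).
Qed.

Lemma upk_D1 J i : (k |: set_up J) :\ lk i = k |: set_up (J :\ i).
Proof.
apply: set_lift_eq => [|j]; first by rewrite in_setD1 !setU11 (neq_lift k i).
by rewrite in_setD1 !mem_upk in_setD1 (inj_eq (@lift_inj _ k)).
Qed.

Lemma upk_Dk J : (k |: set_up J) :\ k = set_up J.
Proof. by rewrite setU1K ?mem_up_k. Qed.

Lemma up_U1 J i : lk i |: set_up J = set_up (i |: J).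
Proof.
apply: set_lift_eq => [|j]; first by rewrite in_setU1 !mem_up_k (negPf (neq_lift k i)).
by rewrite in_setU1 !mem_up in_setU1 (inj_eq (@lift_inj _ k)).
Qed.

Lemma upk_U1 J i : lk i |: (k |: set_up J) = k |: set_up (i |: J).
Proof. by rewrite setUCA up_U1. Qed.

Lemma card_below (n : nat) (L : {set 'I_n}) (i : nat) :
  #|[set j in L | (j < i)%N]| = (\sum_(j in L) (j < i)%N)%N.
Proof.
rewrite -sum1_card big_mkcond [RHS]big_mkcond; apply: eq_bigr => j _.
by rewrite !inE; case: (j \in L); case: (_ < _)%N.
Qed.

Lemma card_below_up J i :
  #|[set j in set_up J | (j < lk i)%N]| = #|[set j in J | (j < i)%N]|.
Proof.
rewrite !card_below (big_ord_lift _ k) /= mem_up_k add0n.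
by apply: eq_big => [j|j _]; rewrite ?mem_up ?ltn_lift2.
Qed.

Lemma card_below_upk J i :
  #|[set j in k |: set_up J | (j < lk i)%N]|
  = ((k < lk i) + #|[set j in J | (j < i)%N]|)%N.
Proof.
rewrite !card_below (big_ord_lift _ k) /= setU11; congr (_ + _)%N.
by apply: eq_big => [j|j _]; rewrite ?mem_upk ?ltn_lift2.
Qed.

(** The number of factors that e_k has to pass to reach the front of the monomial of
    [k |: set_up k J]. *)
Definition below J := #|[set j in J | (lk j < k)%N]|.

Lemma belowE J : below J = (\sum_(j in J) (lk j < k)%N)%N.
Proof.
rewrite /below -sum1_card big_mkcond [RHS]big_mkcond; apply: eq_bigr => j _.
by rewrite !inE; case: (j \in J); case: (_ < _)%N.
Qed.

Lemma card_below_k J : #|[set j in set_up J | (j < k)%N]| = below J.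
Proof.
rewrite card_below belowE (big_ord_lift _ k) /= mem_up_k add0n.
by apply: eq_bigl => j; rewrite mem_up.
Qed.

Lemma card_below_kk J : #|[set j in k |: set_up J | (j < k)%N]| = below J.
Proof.
rewrite card_below belowE (big_ord_lift _ k) /= setU11 ltnn add0n.
by apply: eq_bigl => j; rewrite mem_upk.
Qed.

Lemma ltn_lift_xor i : (lk i < k)%N = ~~ (k < lk i)%N.
Proof. by rewrite /= /bump; case: leqP => /= ?; lia. Qed.

(* Removing i from J changes the parity of below J exactly when lift k i < k,
   and the position of i among k |: J is shifted exactly when k < lift k i;
   together these always produce one sign change. *)
Lemma below_D1 J i : i \in J ->
  (-1) ^+ below J * (-1) ^+ (k < lk i)%N = - (-1) ^+ below (J :\ i) :> K.
Proof.
move=> iJ; rewrite !belowE (big_setD1 i) //= exprD mulrAC ltn_lift_xor.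
by case: (k < lk i)%N; rewrite /= ?expr0 ?expr1 ?mul1r ?mulN1r // mulr1.
Qed.

Lemma below_U1 J i : i \notin J ->
  (-1) ^+ below J * (-1) ^+ (k < lk i)%N = - (-1) ^+ below (i |: J) :> K.
Proof.
move=> iJ; have := @below_D1 (i |: J) i (setU11 _ _); rewrite setU1K //.
have sgn n : (-1) ^+ n * (-1) ^+ n = 1 :> K by rewrite -exprMn mulrNN mulr1 expr1n.
move=> h; rewrite -[_ ^+ below J]opprK -h mulNr -mulrA sgn mulr1 //.
Qed.

(* w is split into its components without and with e_k; the sign moves e_k to the
   front of the exterior monomials. *)
Definition koszul_res w : {ffun {set 'I_m} -> N} := [ffun J => w (set_up J)].
Definition koszul_link w : {ffun {set 'I_m} -> N} :=
  [ffun J : {set 'I_m} => (-1) ^+ below J *: w (k |: set_up J)].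

Lemma koszul_res_is_linear : linear koszul_res.
Proof. by move=> a u v; apply/ffunP => J; rewrite !ffunE. Qed.
HB.instance Definition _ := GRing.isLinear.Build K _ _ _ koszul_res
  koszul_res_is_linear.

Lemma koszul_link_is_linear : linear koszul_link.
Proof.
by move=> a u v; apply/ffunP => J; rewrite !ffunE scalerDr !scalerA mulrC.
Qed.
HB.instance Definition _ := GRing.isLinear.Build K _ _ _ koszul_link
  koszul_link_is_linear.

Lemma scale_signK n (v : N) : (-1) ^+ n *: ((-1) ^+ n *: v) = v.
Proof. by rewrite scalerA -exprMn mulrNN mulr1 expr1n scale1r. Qed.

Definition koszul_join (u v : {ffun {set 'I_m} -> N}) : {ffun {set 'I_m.+1} -> N} :=
  [ffun L : {set 'I_m.+1} => if k \in L then (-1) ^+ below (set_down L) *: v (set_down L)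
                  else u (set_down L)].

Lemma koszul_joinE u v : (koszul_res (koszul_join u v) = u)
  * (koszul_link (koszul_join u v) = v).
Proof.
split; apply/ffunP => J; rewrite !ffunE.
  by rewrite mem_up_k set_upK.
by rewrite setU11 set_upkK scale_signK.
Qed.

Lemma koszul_split_inj w w' : koszul_res w = koszul_res w' ->
  koszul_link w = koszul_link w' -> w = w'.
Proof.
move=> /ffunP er /ffunP el; apply/ffunP => L; rewrite (set_downK L).
case: ifP => _; last by have := er (set_down L); rewrite !ffunE.
have := el (set_down L); rewrite !ffunE => /(congr1 (GRing.scale ((-1) ^+ below (set_down L)))).
by rewrite !scale_signK.
Qed.

Lemma koszul_split_all (A : subspace N) w :
  (forall L, A (w L)) <->
  (forall J, A (koszul_res w J)) /\ (forall J, A (koszul_link w J)).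
Proof.
split=> [Aw|[Ar Al] L].
  by split=> J; rewrite ffunE //; apply: subspaceZ.
rewrite (set_downK L); case: ifP => _.
  have := Al (set_down L); rewrite ffunE => /(subspaceZ ((-1) ^+ below (set_down L))).
  by rewrite scale_signK.
by have := Ar (set_down L); rewrite ffunE.
Qed.

Definition fmap (T : finType) (f : {linear N -> N}) (w : {ffun T -> N}) : {ffun T -> N} :=
  [ffun t => f (w t)].

Variables phi : 'I_m.+1 -> {linear N -> N}.
Local Notation phi' := (fun i => phi (lk i)).

(** With w = u + e_k v, the differential is d' u + e_k (phi_k u - d' v): the Koszul complex is the
    cone of phi_k on the Koszul complex of the other maps. This and the next lemma are its two
    components, and they drive the inductions on the number of maps. *)
Lemma koszul_res_diff w : koszul_res (koszul_diff phi w) = koszul_diff phi' (koszul_res w).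
Proof.
apply/ffunP => J; rewrite !ffunE (big_ord_lift _ k) /= mem_up_k add0r.
apply: eq_big => [i|i _]; first by rewrite mem_up.
by rewrite card_below_up up_D1 ffunE.
Qed.

Lemma koszul_link_diff w : koszul_link (koszul_diff phi w)
  = fmap (phi k) (koszul_res w) - koszul_diff phi' (koszul_link w).
Proof.
apply/ffunP => J; rewrite !ffunE (big_ord_lift _ k) /= setU11 scalerDr.
rewrite card_below_kk scale_signK upk_Dk; congr (_ + _).
rewrite scaler_sumr -sumrN; apply: eq_big => [i|i]; rewrite mem_upk // => iJ.
rewrite card_below_upk upk_D1 ffunE [phi _ (_ *: _)]linearZ !scalerA -scaleNr; congr (_ *: _).
by rewrite exprD mulrA below_D1 // mulNr mulrC.
Qed.

(** Contraction sends u + e_k v to iota' u + phi_k v - e_k iota' v, the sign coming from passing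
    e_k. *)
Lemma koszul_res_contract w : koszul_res (koszul_contract phi w)
  = koszul_contract phi' (koszul_res w) + fmap (phi k) (koszul_link w).
Proof.
apply/ffunP => J; rewrite !ffunE (big_ord_lift _ k) /= mem_up_k /= addrC; congr (_ + _).
  apply: eq_big => [i|i _]; first by rewrite mem_up.
  by rewrite card_below_up up_U1 ffunE.
by rewrite card_below_k linearZ.
Qed.

Lemma koszul_link_contract w : koszul_link (koszul_contract phi w)
  = - koszul_contract phi' (koszul_link w).
Proof.
apply/ffunP => J; rewrite !ffunE (big_ord_lift _ k) /= setU11 /= add0r.
rewrite scaler_sumr -sumrN; apply: eq_big => [i|i]; rewrite mem_upk // => iJ.
rewrite card_below_upk upk_U1 ffunE [phi _ (_ *: _)]linearZ !scalerA -scaleNr; congr (_ *: _).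
by rewrite exprD mulrA below_U1 // mulNr mulrC.
Qed.

End KoszulSplit.

Lemma fmap_is_linear (K : fieldType) (N : lmodType K) (T : finType)
    (f : {linear N -> N}) : linear (@fmap K N T f).
Proof. by move=> a u v; apply/ffunP => t; rewrite !ffunE linearP. Qed.
HB.instance Definition _ (K : fieldType) (N : lmodType K) (T : finType)
  (f : {linear N -> N}) := GRing.isLinear.Build K _ _ _ (@fmap K N T f)
    (@fmap_is_linear K N T f).

Lemma koszul_diff_fmap (K : fieldType) (N : lmodType K) m
    (phi : 'I_m -> {linear N -> N}) (f : {linear N -> N}) w :
  (forall i v, phi i (f v) = f (phi i v)) ->
  koszul_diff phi (fmap f w) = fmap f (koszul_diff phi w).
Proof.
move=> fphi; apply/ffunP => L; rewrite !ffunE linear_sum; apply: eq_bigr => i _.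
by rewrite ffunE fphi [f (_ *: _)]linearZ.
Qed.

Lemma koszul_contract_fmap (K : fieldType) (N : lmodType K) m
    (phi : 'I_m -> {linear N -> N}) (f : {linear N -> N}) w :
  (forall i v, phi i (f v) = f (phi i v)) ->
  koszul_contract phi (fmap f w) = fmap f (koszul_contract phi w).
Proof.
move=> fphi; apply/ffunP => L; rewrite !ffunE linear_sum; apply: eq_bigr => i _.
by rewrite ffunE fphi [f (_ *: _)]linearZ.
Qed.

Lemma koszul_diff_diff (K : fieldType) (N : lmodType K) m
    (phi : 'I_m -> {linear N -> N}) w :
  (forall i j v, phi i (phi j v) = phi j (phi i v)) ->
  koszul_diff phi (koszul_diff phi w) = 0.
Proof.
elim: m phi w => [|m IH] phi w phiC.
  by apply/ffunP => L; rewrite !ffunE big1 // => -[].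
apply: (@koszul_split_inj _ _ _ ord0).
  by rewrite linear0 !koszul_res_diff IH.
rewrite linear0 !(koszul_link_diff, koszul_res_diff) linearB /= IH //.
by rewrite koszul_diff_fmap // subr0 subrr.
Qed.

(** Terms with two different indices cancel in pairs, and each diagonal index acts in one of the two
    orders according to whether it lies in L. Used twice: for Cartan's formula, and for contracting
    homotopies of Cech complexes. *)
Lemma koszul_diff_contract (K : fieldType) (N : lmodType K) m
    (phi psi : 'I_m -> {linear N -> N}) w :
  (forall i j v, i != j -> phi i (psi j v) = psi j (phi i v)) ->
  koszul_diff phi (koszul_contract psi w) + koszul_contract psi (koszul_diff phi w)
  = [ffun L : {set 'I_m} => \sum_i (if i \in L then phi i (psi i (w L))
                                    else psi i (phi i (w L)))].
Proof.
elim: m phi psi w => [|m IH] phi psi w comm.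
  by apply/ffunP => L; rewrite !ffunE !big1 ?addr0 // => -[].
have ne i : lift ord0 i != ord0 :> 'I_m.+1 by rewrite eq_sym neq_lift.
have comm' (i j : 'I_m) v : i != j ->
    phi (lift ord0 i) (psi (lift ord0 j) v) = psi (lift ord0 j) (phi (lift ord0 i) v).
  by move=> ij; apply: comm; rewrite (inj_eq lift_inj).
have IHw w' := IH (fun i => phi (lift ord0 i)) (fun i => psi (lift ord0 i)) w' comm'.
apply: (@koszul_split_inj _ _ _ ord0).
  rewrite linearD /= koszul_res_diff !koszul_res_contract koszul_res_diff linearD /=.
  rewrite koszul_link_diff [fmap _ (_ - _)]linearB /=.
  rewrite koszul_diff_fmap; last by move=> i v; apply: comm.
  rewrite addrACA IHw [X in _ + X]addrC subrK; apply/ffunP => J.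
  rewrite !ffunE (big_ord_lift _ ord0) /= mem_up_k addrC; congr (_ + _).
  by apply: eq_bigr => i _; rewrite mem_up.
rewrite linearD /= koszul_link_diff !koszul_link_contract koszul_res_contract.
rewrite koszul_link_diff !linearB linearN linearD /=.
rewrite [koszul_contract _ (fmap _ _)]koszul_contract_fmap; last first.
  by move=> i v; rewrite comm // eq_sym.
rewrite !opprK addrACA [X in X + _]addrAC subrr add0r IHw.
apply/ffunP => J; rewrite !ffunE (big_ord_lift _ ord0) /= setU11.
rewrite scalerDr [psi _ (_ *: _)]linearZ [phi _ (_ *: _)]linearZ; congr (_ + _).
rewrite scaler_sumr; apply: eq_bigr => i _; rewrite mem_upk.
case: ifP => _; first by rewrite [psi _ (_ *: _)]linearZ [phi _ (_ *: _)]linearZ.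
by rewrite [phi _ (_ *: _)]linearZ [psi _ (_ *: _)]linearZ.
Qed.

Lemma sffun_subproof (K : fieldType) (N : lmodType K) (T : finType) (A : subspace N) :
  (forall t, A ((0 : {ffun T -> N}) t)) /\
  (forall (a : K) (u v : {ffun T -> N}), (forall t, A (u t)) -> (forall t, A (v t)) ->
    forall t, A ((a *: u + v) t)).
Proof.
split=> [t|a u v Au Av t]; rewrite !ffunE; first exact: subspace0.
by apply: subspaceP.
Qed.
Definition sffun (K : fieldType) (N : lmodType K) (T : finType) (A : subspace N) :
  subspace {ffun T -> N} :=
  @Subspace K {ffun T -> N} (fun w => forall t, A (w t))
    (sffun_subproof T A).1 (sffun_subproof T A).2.

(** * Finite-dimensionality of Koszul cohomology *)

Section KoszulFiniteDimension.
Variable K : fieldType.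

(** Koszul cohomology of Z / B in all degrees at once, computed with representatives in V: a cocycle
    needs its differential to vanish only modulo [B], and [B]-valued cochains count as
    coboundaries. *)
Definition koszul_cocycles r (V : lmodType K) (X : 'I_r -> {linear V -> V})
    (Z B : subspace V) : subspace {ffun {set 'I_r} -> V} :=
  scap (sffun _ Z) (spre (koszul_diff X) (sffun _ B)).

Definition koszul_coboundaries r (V : lmodType K) (X : 'I_r -> {linear V -> V})
    (Z B : subspace V) : subspace {ffun {set 'I_r} -> V} :=
  sadd (simg (koszul_diff X) (sffun _ Z)) (sffun _ B).

Lemma sffun_diff r (V : lmodType K) (X : 'I_r -> {linear V -> V}) (A : subspace V) w :
  stable X A -> sffun _ A w -> sffun _ A (koszul_diff X w).
Proof.
move=> XA Aw L; rewrite ffunE; apply: subspace_sum => i _.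
by apply/subspaceZ/XA.
Qed.

Definition koszul_extend (V : lmodType K) m (k : 'I_m.+1)
  (u : {ffun {set 'I_m} -> V}) := koszul_join k u 0.

Lemma koszul_extend_is_linear (V : lmodType K) m (k : 'I_m.+1) :
  linear (@koszul_extend V m k).
Proof.
move=> a u v; apply: (@koszul_split_inj _ _ _ k).
  by rewrite linearP /= !koszul_joinE.
by rewrite linearP /= !koszul_joinE scaler0 addr0.
Qed.
HB.instance Definition _ (V : lmodType K) m (k : 'I_m.+1) :=
  GRing.isLinear.Build K _ _ _ (@koszul_extend V m k)
    (@koszul_extend_is_linear V m k).

Hypothesis charK : [pchar K] =i pred0.

(* Induction on r through the exact sequence
   H(ker X_0) -> H -> H(coker X_0) of Koszul cohomology in the other variables. *)
Theorem koszul_fd r (V : lmodType K) (X D : 'I_r -> {linear V -> V})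
    (Z B : subspace V) c F :
  weyl_ops X D -> stable X B -> stable D B -> growth X D Z B c F ->
  fd (koszul_cocycles X Z B) (koszul_coboundaries X Z B).
Proof.
elim: r X D Z B c F => [|r IH] X D Z B c F ops XB DB gF.
  have ev_lin : linear (fun w : {ffun {set 'I_0} -> V} => w set0 : V).
    by move=> a u v; rewrite !ffunE.
  pose ev : {linear {ffun {set 'I_0} -> V} -> V} :=
    HB.pack (fun w : {ffun {set 'I_0} -> V} => w set0 : V)
      (GRing.isLinear.Build K _ _ _ _ ev_lin).
  apply: (fd_inj (phi := ev)) (growth0_fd gF) => [w [Zw _]|w _ Bw]; first exact: Zw.
  apply: sadd_r => J; suff -> : J = set0 by [].
  by apply/setP => -[].
pose X' i := X (lift ord0 i); pose D' i := D (lift ord0 i).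
pose x := X ord0; pose Zk := scap Z (spre x B); pose Bc := sadd B (simg x Z).
have XZ := stable_X_top gF; have DZ := stable_D_top gF.
have XC i j v : X i (X j v) = X j (X i v) by exact: (opsXX ops).
have BZ v : B v -> Z v.
  by move=> Bv; apply: (growth_top gF); apply: (growth_bot gF 0%N).
have ops' : weyl_ops X' D'.
  split=> i j v; [exact: (opsXX ops) | exact: (opsDD ops) |].
  by rewrite /D' /X' (opsDX ops) (inj_eq lift_inj).
have fdk : fd (koszul_cocycles X' Zk B) (koszul_coboundaries X' Zk B).
  apply: IH (growth_ker charK ord0 ops XB DB gF) => // i v; [exact: XB|exact: DB].
have fdc : fd (koszul_cocycles X' Z Bc) (koszul_coboundaries X' Z Bc).
  apply: IH (growth_coker charK ord0 ops XB DB gF) => // i.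
    move=> _ [u [_ [Bu [v Zv ->] ->]]]; exists (X' i u), (x (X' i v)).
    by split; [exact: XB | exact/simgI/XZ | rewrite linearD /= /x XC].
  move=> _ [u [_ [Bu [v Zv ->] ->]]]; exists (D' i u), (x (D' i v)).
  split; [exact: DB | exact/simgI/DZ | rewrite linearD /=].
  by rewrite (opsDX ops) eq_sym (negPf (neq_lift ord0 i)) mulr0n addr0.
(* Extension by zero does not commute with the differentials: [d (al u)] acquires the e_0 component
   [x u]. This lies in [B] when u has values in ker x modulo [B]. *)
pose al : {linear {ffun {set 'I_r} -> V} -> {ffun {set 'I_r.+1} -> V}} :=
  koszul_extend ord0.
apply: (fd_exact (al := al) (be := koszul_link ord0)) fdk fdc.
- move=> _ [_ [v [[u Zu ->] Bv ->]]]; split.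
    apply: subspaceD; first exact: sffun_diff.
    by move=> L; apply/BZ/Bv.
  rewrite /= linearD /= koszul_diff_diff // add0r; exact: sffun_diff.
- move=> _ [_ [v [[u Zu ->] Bv ->]]]; rewrite linearD /= koszul_link_diff.
  have [Zr Zl] := (koszul_split_all ord0 Z u).1 Zu.
  have [Br Bl] := (koszul_split_all ord0 B v).1 Bv.
  exists (koszul_diff X' (- koszul_link ord0 u)).
  exists (fmap x (koszul_res ord0 u) + koszul_link ord0 v); split.
  + exists (- koszul_link ord0 u) => // J; rewrite ffunE; exact: subspaceN.
  + move=> J; rewrite !ffunE; exists ((-1) ^+ below ord0 J *: v (ord0 |: set_up ord0 J)).
    exists (x (u (set_up ord0 J))); rewrite addrC; split=> //; first exact: subspaceZ.
    by exists (u (set_up ord0 J)).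
  + by rewrite linearN addrA [- _ + _]addrC.
- move=> w _ [_ [v [[u Zu ->] Bv ->]]].
  exists (koszul_diff X (al u)), (koszul_join ord0 v (- fmap x u)); split.
  + exists (al u) => //; apply/(koszul_split_all ord0); rewrite !koszul_joinE.
    by split=> J; [case: (Zu J) | rewrite ffunE; exact: subspace0].
  + apply/(koszul_split_all ord0); rewrite !koszul_joinE; split=> // J.
    by rewrite !ffunE; apply: subspaceN; case: (Zu J).
  + apply: (@koszul_split_inj _ _ _ ord0); rewrite [RHS]linearD /=.
      by rewrite koszul_res_diff !koszul_joinE.
    by rewrite koszul_link_diff !koszul_joinE linear0 subr0 subrr.
- move=> w [Zw Bw].
  have [Zr Zl] := (koszul_split_all ord0 Z w).1 Zw.
  have [Br Bl] := (koszul_split_all ord0 B _).1 Bw.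
  split=> // J; have := Bl J; rewrite koszul_link_diff /= => BJ.
  exists (- (fmap x (koszul_res ord0 w) - koszul_diff X' (koszul_link ord0 w)) J).
  exists (fmap x (koszul_res ord0 w) J); split.
  + exact: subspaceN.
  + by rewrite ffunE; apply/simgI/Zr.
  + by rewrite !ffunE opprB addrNK.
move=> w [Zw Bw] [_ [be [[b Zb ->] Bbe ew]]].
have [Zr Zl] := (koszul_split_all ord0 Z w).1 Zw.
have [be1 hbe] : exists be1 : {ffun {set 'I_r} -> V * V},
    forall J, [/\ B (be1 J).1, Z (be1 J).2 & be J = (be1 J).1 + x (be1 J).2].
  have h J : exists p : V * V, [/\ B p.1, Z p.2 & be J = p.1 + x p.2].
    by have [u [_ [Bu [v Zv ->] ->]]] := Bbe J; exists (u, v).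
  have [g hg] := choice h; exists (finfun g) => J; rewrite ffunE; exact: hg.
pose z : {ffun {set 'I_r} -> V} := [ffun J => (be1 J).2].
pose b' : {ffun {set 'I_r} -> V} := [ffun J => (be1 J).1].
have beE : be = b' + fmap x z.
  by apply/ffunP => J; rewrite !ffunE; case: (hbe J).
(* The link of w is d' b + b' + x z with [b'] in [B], and that of d (z - e_0 b) is x z + d' b.
   Subtracting leaves a cocycle [w2] whose e_0 component is [b'], so that its restriction lies in
   ker x modulo [B] and represents it. *)
pose w1 := koszul_join ord0 z (- b).
have Zw1 : sffun _ Z w1.
  apply/(koszul_split_all ord0); rewrite !koszul_joinE; split=> J; rewrite ffunE.
    by case: (hbe J).
  exact: subspaceN.
pose w2 := w - koszul_diff X w1.
have Bw2 : sffun _ B (koszul_diff X w2).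
  by rewrite linearB /= koszul_diff_diff // subr0.
have l2 : koszul_link ord0 w2 = b'.
  rewrite linearB /= ew koszul_link_diff !koszul_joinE linearN opprK beE.
  by rewrite addrCA [X in _ - X]addrC addrK.
have Zw2 : sffun _ Z w2 by apply: subspaceB => //; exact: sffun_diff.
have [Z2r Z2l] := (koszul_split_all ord0 Z w2).1 Zw2.
have [B2r B2l] := (koszul_split_all ord0 B _).1 Bw2.
have Bb' J : B (b' J) by rewrite ffunE; case: (hbe J).
exists (koszul_res ord0 w2); first split.
- move=> J; split; first exact: Z2r.
  have := B2l J; rewrite koszul_link_diff l2 ffunE.
  rewrite [X in B (_ + X)]ffunE => /subspace_sub h.
  suff : B (fmap x (koszul_res ord0 w2) J) by rewrite ffunE.
  by apply: h; apply: sffun_diff => // i v; apply: XB.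
- by rewrite /= -koszul_res_diff.
exists (koszul_diff X w1), (koszul_join ord0 0 b'); split.
- by exists w1.
- by apply/(koszul_split_all ord0); rewrite !koszul_joinE; split=> J //; rewrite ffunE; exact: subspace0.
rewrite -[w](subrK (koszul_diff X w1)) -/w2 addrAC addrC; congr (_ + _).
apply: (@koszul_split_inj _ _ _ ord0).
  by rewrite linearB /= !koszul_joinE subrr.
by rewrite linearB /= !koszul_joinE l2 subr0.
Qed.

End KoszulFiniteDimension.

(** * Euler characteristics of complexes with two anticommuting differentials *)

Section EulerCharacteristic.
Variables (K : fieldType) (N : lmodType K) (T : finType) (deg : T -> nat) (m : nat).
(* Degrees start at 2 so that n.-1 and n.-2 are never truncated below. *)
Hypothesis deg_ge2 : forall t, (2 <= deg t)%N.
Hypothesis deg_le : forall t, (deg t <= m.+2)%N.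
Local Notation W := {ffun T -> N}.
Implicit Types (w : W).

Lemma supp_subproof (P : pred nat) :
  (forall t, ~~ P (deg t) -> (0 : W) t = 0) /\
  (forall (a : K) (u v : W), (forall t, ~~ P (deg t) -> u t = 0) ->
    (forall t, ~~ P (deg t) -> v t = 0) ->
    forall t, ~~ P (deg t) -> (a *: u + v) t = 0).
Proof.
split=> [t|a u v hu hv t ht]; rewrite !ffunE // hu // hv //.
by rewrite scaler0 addr0.
Qed.
Definition supp (P : pred nat) : subspace W :=
  @Subspace K W (fun w => forall t, ~~ P (deg t) -> w t = 0)
    (supp_subproof P).1 (supp_subproof P).2.

Definition deg_part n w : W := [ffun t => if deg t == n then w t else 0].

Lemma deg_part_is_linear n : linear (deg_part n).
Proof.
by move=> a u v; apply/ffunP => t; rewrite !ffunE; case: ifP; rewrite // scaler0 addr0.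
Qed.
HB.instance Definition _ n := GRing.isLinear.Build K W W _ (deg_part n)
  (deg_part_is_linear n).

Variables (C : subspace W) (d io D : {linear W -> W}).
Hypothesis DE : forall w, D w = d w + io w.
Hypothesis d_local : forall w t,
  (forall t', (deg t').+1 = deg t -> w t' = 0) -> d w t = 0.
Hypothesis io_local : forall w t,
  (forall t', deg t' = (deg t).+1 -> w t' = 0) -> io w t = 0.
Hypothesis Cd : forall w, C w -> C (d w).
Hypothesis Cio : forall w, C w -> C (io w).
Hypothesis Cpart : forall n w, C w -> C (deg_part n w).
Hypothesis dd : forall w, C w -> d (d w) = 0.
Hypothesis ioio : forall w, C w -> io (io w) = 0.
Hypothesis dio : forall w, C w -> d (io w) + io (d w) = 0.

(** Fixing the parity makes n -> [filt n] a complex for D = d + io, whose two parts change the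
    degree by +1 and -1: D maps [filt n] to [filt n.+1]. *)
Definition upto n : pred nat := fun k => (k <= n)%N && (odd k == odd n).

Definition filt n := scap C (supp (upto n)).
Definition piece n := scap C (supp (pred1 n)).
Definition tot_cocycles n := scap (filt n) (spre D (szero W)).
Definition tot_coboundaries n := simg D (filt n.-1).
Definition deg_cocycles n := scap (piece n) (spre d (szero W)).
Definition deg_coboundaries n := simg d (piece n.-1).
(** Top-degree terms of total cocycles: modulo coboundaries, the classes of H^n(d) killed by the
    connecting map. *)
Definition liftable n := simg (deg_part n) (tot_cocycles n).

Lemma CD w : C w -> C (D w).
Proof. by move=> Cw; rewrite DE; apply: subspaceD; [exact: Cd | exact: Cio]. Qed.

Lemma DD w : C w -> D (D w) = 0.
Proof.
move=> Cw; rewrite !DE !linearD /= dd // ioio // add0r addr0; exact: dio.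
Qed.

Lemma filt_D n w : filt n w -> filt n.+1 (D w).
Proof.
move=> [Cw sw]; split; first exact: CD.
move=> t; rewrite DE ffunE => nt; rewrite d_local ?io_local ?addr0 // => t' e; apply: sw.
  by apply: contra nt; rewrite /upto; lia.
by apply: contra nt; rewrite /upto; lia.
Qed.

Lemma filtS2 n w : filt n w -> filt n.+2 w.
Proof.
move=> [Cw sw]; split=> // t nt; apply: sw; apply: contra nt.
by rewrite /upto /= negbK; lia.
Qed.

Lemma filt_piece n w : piece n w -> filt n w.
Proof.
move=> [Cw sw]; split=> // t nt; apply: sw; apply: contra nt => /eqP ->.
by rewrite /upto leqnn eqxx.
Qed.

Lemma deg_part_piece n w : C w -> piece n (deg_part n w).
Proof. by move=> Cw; split; [exact: Cpart | move=> t /= /negPf nt; rewrite ffunE nt]. Qed.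

Lemma deg_part_id n w : piece n w -> deg_part n w = w.
Proof.
by move=> [_ sw]; apply/ffunP => t; rewrite ffunE; case: ifPn => // nt; rewrite sw.
Qed.

Lemma deg_part_filt0 n w : filt n w -> deg_part n w = 0 -> filt n.-2 w.
Proof.
move=> [Cw sw] /ffunP w0; split=> // t; rewrite /upto => nt.
have [dt|ndt] := eqVneq (deg t) n; first by have := w0 t; rewrite !ffunE dt eqxx.
by apply: sw; apply: contra nt; rewrite /upto; have := deg_ge2 t; lia.
Qed.

Lemma deg_part_filt n w : filt n w -> deg_part n.+2 w = 0.
Proof.
move=> [_ sw]; apply/ffunP => t; rewrite !ffunE; case: eqP => // e.
by apply: sw; rewrite /upto e; lia.
Qed.

Lemma deg_part_d n w : deg_part n.+1 (d w) = d (deg_part n w).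
Proof.
apply/ffunP => t; rewrite ffunE; case: eqP => [e|ne].
  apply/eqP; rewrite -subr_eq0 -[d w]/(d w) -[_ - _](_ : (d (w - deg_part n w)) t = _).
    by apply/eqP/d_local => t' et; rewrite !ffunE; case: eqP => [|]; rewrite ?subrr //; lia.
  by rewrite linearB !ffunE.
by apply/esym/d_local => t' et; rewrite ffunE; case: eqP => // e'; case: ne; lia.
Qed.

Lemma deg_part_D n w : filt n w -> deg_part n.+1 (D w) = d (deg_part n w).
Proof.
move=> [Cw sw]; rewrite DE linearD /= deg_part_d [X in _ + X](_ : _ = 0) ?addr0 //.
apply/ffunP => t; rewrite !ffunE; case: eqP => // e.
by apply: io_local => t' e'; apply: sw; rewrite /upto; lia.
Qed.

Lemma deg_coboundary_liftable n w : deg_coboundaries n.+1 w -> liftable n.+1 w.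
Proof.
move=> [u pu ->]; have fu := filt_piece pu.
exists (D u); last by rewrite /= deg_part_D // deg_part_id.
split; [exact: filt_D | by rewrite /= DD //; case: pu].
Qed.

Lemma liftable_cocycle n w : liftable n w -> deg_cocycles n w.
Proof.
move=> [z [fz /= Dz] ->]; split; first by apply: deg_part_piece; case: fz.
by rewrite /= -deg_part_D // Dz linear0.
Qed.

Lemma tot_coboundary_cocycle n w : tot_coboundaries n.+1 w -> tot_cocycles n.+1 w.
Proof.
move=> [u fu ->]; split; [exact: filt_D | by rewrite /= DD //; case: fu].
Qed.

Lemma tot_coboundaryS2 n w : tot_coboundaries n w -> tot_coboundaries n.+2 w.
Proof.
move=> [u fu ->]; exists u => //; case: n fu => [|n] fu; last exact: filtS2.
have -> : u = 0; last exact: subspace0.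
case: fu => _ su; apply/ffunP => t; rewrite ffunE; apply: su.
by rewrite /upto; have := deg_ge2 t; lia.
Qed.

Lemma tot_cocycleS2 n w : tot_cocycles n w -> tot_cocycles n.+2 w.
Proof. by move=> [fw Dw]; split=> //; apply: filtS2. Qed.

(* The long exact sequence H^n(filt) -> H^(n+2)(filt) -> H^(n+2)(d) -> H^(n+1)(filt),
   which exists because filt n is the part of filt (n+2) of degree at most n; the
   two ranks that appear are those of the connecting maps. *)
Lemma tot_recursion n :
  fd (deg_cocycles n.+2) (deg_coboundaries n.+2) ->
  fd (tot_cocycles n) (tot_coboundaries n) ->
  fd (tot_cocycles n.+2) (tot_coboundaries n.+2) /\
  (rdim (deg_cocycles n.+2) (deg_coboundaries n.+2)
     + rdim (tot_cocycles n) (tot_coboundaries n)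
   = rdim (tot_cocycles n.+2) (tot_coboundaries n.+2)
     + rdim (deg_cocycles n.+2) (liftable n.+2)
     + rdim (deg_cocycles n.+1) (liftable n.+1))%N.
Proof.
(* [Q] gives the image of H^n(filt) in H^(n+2)(filt); the cokernel is identified below, through
   top-degree terms, with the liftable classes of H^(n+2)(d). *)
move=> fdc fdh; pose Q := sadd (tot_cocycles n) (tot_coboundaries n.+2).
have BQ v : tot_coboundaries n.+2 v -> Q v by exact: sadd_r.
have QZ v : Q v -> tot_cocycles n.+2 v.
  move=> [u [b [Zu Bb ->]]]; apply: subspaceD; first exact: tot_cocycleS2.
  exact: tot_coboundary_cocycle.
have [fd1 rd1] : (fd (tot_cocycles n.+2) Q <-> fd (liftable n.+2) (deg_coboundaries n.+2))
    /\ rdim (tot_cocycles n.+2) Q = rdim (liftable n.+2) (deg_coboundaries n.+2).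
  apply: (fd_iso (phi := deg_part n.+2)) => [v Zv|_ [v Zv ->]|z Zz].
  - exact: simgI.
  - by exists v => //; exact: subspace_subrr.
  split=> [[u [_ [[fu _] [a fa ->] ->]]]|[a pa ea]].
    rewrite linearD /= (deg_part_filt fu) add0r deg_part_D //.
    by exists (deg_part n.+1 a) => //; apply: deg_part_piece; case: fa.
  exists (z - D a), (D a); rewrite subrK; split=> //; last first.
    by exists a => //; exact: filt_piece.
  have fa := filt_piece pa; have [fz Dz] := Zz.
  split; last by rewrite /= linearB /= Dz DD ?subr0 //; case: pa.
  apply: (@deg_part_filt0 n.+2); first by apply: subspaceB => //; exact: filt_D.
  by rewrite linearB /= deg_part_D // ea (deg_part_id pa) subrr.
have [fd2 rd2] : (fd (tot_cocycles n) (tot_coboundaries n.+2)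
    <-> fd Q (tot_coboundaries n.+2))
    /\ rdim (tot_cocycles n) (tot_coboundaries n.+2) = rdim Q (tot_coboundaries n.+2).
  apply: (fd_iso (phi := idfun)) => // [v|w [u [v [Zu Bv ->]]]]; first exact: sadd_l.
  by exists u => //; rewrite /= addrC addKr.
(* [S] modulo [tot_coboundaries n] is the kernel of H^n(filt) -> H^(n+2)(filt), hence the image of
   the connecting map out of H^(n+1)(d). *)
pose S := scap (tot_cocycles n) (tot_coboundaries n.+2).
have BS v : tot_coboundaries n v -> S v.
  move=> Bv; split; last exact: tot_coboundaryS2.
  case: n Bv {fdc fdh Q BQ QZ fd1 rd1 fd2 rd2 S} => [|n]; last exact: tot_coboundary_cocycle.
  move=> [u [Cu su] ->]; have -> : u = 0; last by rewrite linear0; exact: subspace0.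
  apply/ffunP => t; rewrite ffunE; apply: su.
  by rewrite /upto; have := deg_ge2 t; lia.
have SZ v : S v -> tot_cocycles n v by case.
have rd3 : rdim (tot_cocycles n) S = rdim (tot_cocycles n) (tot_coboundaries n.+2).
  by apply: (fd_iso (phi := idfun) _ _ _).2 => // [v Zv|v Zv /=];
     [exists v => //; exact: subspace_subrr | split=> [[]|]].
(* [R] consists of the elements whose top term is a d-cocycle. D maps it onto [S] and
   [deg_part n.+1] onto the d-cocycles; modulo the elements that D sends to [tot_coboundaries n],
   these two maps become isomorphisms to [S] modulo boundaries and to cocycles modulo liftable
   ones. *)
pose R := scap (filt n.+1) (spre D (filt n)).
have rdR1 : rdim R (spre D (tot_coboundaries n)) = rdim S (tot_coboundaries n).
  apply: (fd_iso (phi := D) _ _ _).2 => // [v [fv Dv]|w [[fw Dw] [v fv e]]].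
    split; last by exists v.
    by split=> //; rewrite /= DD //; case: fv.
  exists v; first by split=> //; rewrite /= -e.
  rewrite e; exact: subspace_subrr.
have rdR2 : rdim R (spre D (tot_coboundaries n)) = rdim (deg_cocycles n.+1) (liftable n.+1).
  apply: (fd_iso (phi := deg_part n.+1) _ _ _).2 => [v [fv Dv]|w [pw dw]|v [fv Dv]].
  - split; first by apply: deg_part_piece; case: fv.
    by rewrite /= -deg_part_D // deg_part_filt.
  - exists w; last by rewrite -{1}(deg_part_id pw); exact: subspace_subrr.
    split; first exact: filt_piece.
    apply: (@deg_part_filt0 n.+2); first exact/filt_D/filt_piece.
    by rewrite deg_part_D ?deg_part_id //; exact: filt_piece.
  split=> [[b fb e]|[z [fz Dz] e]].
    exists (v - b); first split.
    + apply: subspaceB => //; case: n fb {fdc fdh Q BQ QZ fd1 rd1 fd2 rd2 S BS SZ rd3 R rdR1 fv Dv e} => [|n] fb.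
        have -> : b = 0; last exact: subspace0.
        case: fb => _ su; apply/ffunP => t; rewrite ffunE; apply: su.
        by rewrite /upto; have := deg_ge2 t; lia.
      exact: filtS2.
    + by rewrite /= linearB /= e subrr.
    rewrite linearB /= [X in _ - X](_ : _ = 0) ?subr0 //.
    apply/ffunP => t; rewrite !ffunE; case: eqP => // et; case: fb => _; apply.
    by rewrite /upto et; case: n {fdc fdh Q BQ QZ fd1 rd1 fd2 rd2 S BS SZ rd3 R rdR1 fv Dv e} et => [|n] et; have := deg_ge2 t; lia.
  exists (v - z); last by rewrite linearB /= Dz subr0.
  apply: (@deg_part_filt0 n.+1); first exact: subspaceB.
  by rewrite linearB /= e subrr.
have fdS : fd (tot_cocycles n) (tot_coboundaries n.+2).
  have [k nk] := fdh; exists k; apply: contra_not nk; apply: indep_sub => // v.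
  exact: tot_coboundaryS2.
have BL v : deg_coboundaries n.+2 v -> liftable n.+2 v by exact: deg_coboundary_liftable.
have LC v : liftable n.+2 v -> deg_cocycles n.+2 v by exact: liftable_cocycle.
have [fdH rdH] := fd_rdim_add BQ QZ (fd1.2 (fd_sub LC fdc)) (fd2.1 fdS).
split=> //; rewrite rdH (rdim_add BL LC fdc) (rdim_add BS SZ fdh) rd1 -rd2 -rd3 -rdR2 rdR1.
by rewrite addnA [X in _ = (X + _)%N]addnC [X in _ = (X + _)%N]addnA.
Qed.

Lemma tot_low n : (n < 2)%N ->
  fd (tot_cocycles n) (tot_coboundaries n) /\ rdim (tot_cocycles n) (tot_coboundaries n) = 0%N.
Proof.
move=> n2; apply: fd_trivial => v [[_ sv] _]; apply/ffunP => t; rewrite ffunE.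
by apply: sv; rewrite /upto; have := deg_ge2 t; lia.
Qed.

Lemma piece_out_cocycles n : ~~ (1 < n < m.+3)%N -> forall A : subspace W,
  fd (deg_cocycles n) A /\ rdim (deg_cocycles n) A = 0%N.
Proof.
move=> n2 A; apply: fd_trivial => v [[_ sv] _]; apply/ffunP => t; rewrite ffunE.
by apply: sv => /=; have := deg_ge2 t; have := deg_le t; lia.
Qed.

Definition parity_part (b : bool) := scap C (supp (fun k => odd k == b)).
Definition parity_dim b :=
  rdim (scap (parity_part b) (spre D (szero W))) (simg D (parity_part (~~ b))).

(** No degree exceeds m+2, and m+2 does not have the parity of m+1, so the bound in [upto n] is
    already void at n = m+1. *)
Lemma filt_parity n : (m.+1 <= n)%N -> forall w, filt n w <-> parity_part (odd n) w.
Proof.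
move=> mn w; split=> -[Cw sw]; split=> // t nt; apply: sw; apply: contra nt.
  by case/andP.
by move=> e; rewrite /upto e andbT; have := deg_le t; lia.
Qed.

Lemma tot_parity n : (m.+2 <= n)%N ->
  rdim (tot_cocycles n) (tot_coboundaries n) = parity_dim (odd n).
Proof.
move=> mn; have mn1 : (m.+1 <= n.-1)%N by lia.
have e1 := filt_parity (ltnW mn); have e2 := filt_parity mn1.
have on : odd n.-1 = ~~ odd n by case: n mn {mn1 e1 e2} => //= n _; rewrite negbK.
apply: (fd_iso (phi := idfun) _ _ _).2 => [v [/e1 ? ?] //|w [pw Dw]|v _].
  exists w; first by split=> //; exact/e1.
  exact: subspace_subrr.
by rewrite -on; split=> -[u fu eu]; exists u => //; exact/e2.
Qed.

(** In the alternating sum of [tot_recursion] the ranks of the connecting maps cancel between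
    neighbours and the total dimensions telescope in steps of two. Only terms at the top remain,
    where the filtration has become the whole parity part. *)
Theorem euler_char_parity :
  (forall p, (p <= m)%N -> fd (deg_cocycles p.+2) (deg_coboundaries p.+2)) ->
  \sum_(p < m.+1) (-1) ^+ p * (rdim (deg_cocycles p.+2) (deg_coboundaries p.+2))%:Z
  = (parity_dim false)%:Z - (parity_dim true)%:Z.
Proof.
move=> fdc'.
have fdc p : fd (deg_cocycles p.+2) (deg_coboundaries p.+2).
  have [|lt] := leqP p m; first exact: fdc'.
  by apply: (piece_out_cocycles _ _).1; lia.
have fdh n : fd (tot_cocycles n) (tot_coboundaries n)
          /\ fd (tot_cocycles n.+1) (tot_coboundaries n.+1).
  elim: n => [|n [IH1 IH2]]; first by split; apply: (tot_low _).1.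
  by split=> //; apply: (tot_recursion (fdc n) IH1).1.
pose h n : int := (rdim (tot_cocycles n) (tot_coboundaries n))%:Z.
pose y n : int := (rdim (deg_cocycles n) (liftable n))%:Z.
pose c n : int := (rdim (deg_cocycles n) (deg_coboundaries n))%:Z.
have rec n : c n.+2 = h n.+2 + y n.+2 + y n.+1 - h n.
  by have := (tot_recursion (fdc n) (fdh n).1).2; rewrite /c /h /y; lia.
have sumE M : \sum_(p < M.+1) (-1) ^+ p * c p.+2
            = (-1) ^+ M * (h M.+2 - h M.+1 + y M.+2).
  elim: M => [|M IH].
    rewrite big_ord_recl big_ord0 !expr0 !mul1r addr0 rec.
    have -> : h 0%N = 0 by rewrite /h (tot_low _).2.
    have -> : h 1%N = 0 by rewrite /h (tot_low _).2.
    have -> : y 1%N = 0 by rewrite /y (piece_out_cocycles _ _).2.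
    by rewrite addr0 !subr0.
  rewrite big_ord_recr /= IH rec exprS mulN1r !mulNr -!mulrN -mulrDr; congr (_ * _).
  by lia.
rewrite sumE.
have ym : y m.+3 = 0 by rewrite /y (piece_out_cocycles _ _).2 //; lia.
have cm : c m.+3 = 0 by rewrite /c (piece_out_cocycles _ _).2 //; lia.
(* [h m.+1] is not yet a parity dimension, as its boundaries miss those coming from degree m+2. The
   recursion one degree above the top, where [c] and [y] vanish, trades it for [h m.+3]. *)
have -> : h m.+2 - h m.+1 + y m.+2 = h m.+2 - h m.+3.
  by move: (rec m.+1); rewrite ym cm; lia.
rewrite /h !tot_parity //= -signr_odd.
by case: (odd m); rewrite /= ?expr0 ?mul1r // expr1 mulN1r opprB.
Qed.

End EulerCharacteristic.

(** * Eulerian modules *)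

Section ShiftProduct.
Variables (K : fieldType) (V : lmodType K) (L : {linear V -> V}).
Implicit Types (s t : seq K) (v : V).

Definition shift_prod s v : V := foldr (fun a w => L w - a *: w) v s.

(** By partial fractions, v is then a finite sum of eigenvectors with eigenvalues in K; an
    annihilating product passes to subspaces and quotients without choosing them. *)
Definition semisimple_at v := exists2 s, uniq s & shift_prod s v = 0.

Lemma shift_prod_cons a s v : shift_prod (a :: s) v = shift_prod s (L v - a *: v).
Proof.
elim: s => //= b s <- /=; move: (shift_prod s v) => x.
rewrite ![L (_ - _)]linearB ![L (_ *: _)]linearZ !scalerBr !scalerA !opprB.
by rewrite addrACA [RHS]addrACA [- _ - _]addrC [b * a]mulrC.
Qed.

Lemma shift_prod0 s : shift_prod s 0 = 0.
Proof. by elim: s => //= a s ->; rewrite linear0 scaler0 subr0. Qed.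

Lemma shift_prod_rem a t v : a \in t ->
  shift_prod t v = shift_prod (rem a t) (L v - a *: v).
Proof.
elim: t => // b t IH; rewrite inE [rem _ _]/=; have [->|ab] := eqVneq a b.
  by rewrite shift_prod_cons.
by move=> /= /IH ->.
Qed.

Lemma shift_prod_subset s t v : uniq s -> {subset s <= t} ->
  shift_prod s v = 0 -> shift_prod t v = 0.
Proof.
elim: s t v => [|a s IH] t v /=; first by move=> _ _ ->; exact: shift_prod0.
case/andP=> as_ us st; rewrite -[_ - _]/(shift_prod (a :: s) v) shift_prod_cons => s0.
have at_ : a \in t by apply: st; rewrite mem_head.
rewrite (shift_prod_rem _ at_); apply: IH s0 => // b bs.
have : b \in t by apply: st; rewrite inE bs orbT.
rewrite (perm_mem (perm_to_rem at_)) inE => /orP[/eqP ba|//].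
by rewrite ba in bs; rewrite bs in as_.
Qed.

(** Division by L: the product of the L - a is c + L q(L), where c is [shift_const t] and
    [shift_rest t] is q(L). *)
Fixpoint shift_rest t v : V :=
  if t is a :: t' then shift_prod t' v - a *: shift_rest t' v else 0.

Definition shift_const t : K := \prod_(a <- t) (- a).

Lemma shift_const_neq0 t : 0 \notin t -> shift_const t != 0.
Proof.
rewrite /shift_const; elim: t => [|a t IH]; first by rewrite big_nil oner_neq0.
by rewrite inE negb_or eq_sym big_cons mulf_eq0 oppr_eq0 => /andP[/negPf -> /IH].
Qed.

Lemma shift_prodE t v : shift_prod t v = shift_const t *: v + L (shift_rest t v).
Proof.
rewrite /shift_const; elim: t => [|a t IH] /=; first by rewrite big_nil scale1r linear0 addr0.
rewrite big_cons [L (_ - _)]linearB [L (_ *: _)]linearZ mulNr scaleNr addrCA; congr (_ + _).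
by rewrite -/(shift_prod t v) IH scalerDr scalerA opprD.
Qed.

Lemma shift_prod_ker t v : L v = 0 -> shift_prod t v = shift_const t *: v.
Proof.
rewrite /shift_const => Lv; elim: t => [|a t IH] /=; first by rewrite big_nil scale1r.
by rewrite IH big_cons linearZ /= Lv scaler0 sub0r scalerA mulNr scaleNr.
Qed.

Lemma shift_prod_stable (A : subspace V) t v :
  (forall u, A u -> A (L u)) -> A v -> A (shift_prod t v).
Proof.
move=> AL Av; elim: t => //= a t IH; apply: subspaceB; [exact: AL | exact: subspaceZ].
Qed.

Lemma shift_rest_stable (A : subspace V) t v :
  (forall u, A u -> A (L u)) -> A v -> A (shift_rest t v).
Proof.
move=> AL Av; elim: t => [|a t IH] /=; first exact: subspace0.
by apply: subspaceB; [exact: shift_prod_stable | exact: subspaceZ].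
Qed.

Lemma shift_prod_morph t (g : {linear V -> V}) v :
  (forall u, g (L u) = L (g u)) -> g (shift_prod t v) = shift_prod t (g v).
Proof. by move=> gL; elim: t => //= a t <-; rewrite linearB linearZ gL. Qed.

Lemma shift_rest_morph t (g : {linear V -> V}) v :
  (forall u, g (L u) = L (g u)) -> g (shift_rest t v) = shift_rest t (g v).
Proof.
move=> gL; elim: t => [|a t IH] /=; first exact: linear0.
by rewrite linearB linearZ /= IH shift_prod_morph.
Qed.

(* A Laplacian L = dh + hd kills cohomology away from its kernel; it suffices
   that L is semisimple at the eigenvalue 0. *)
Lemma rdim_laplacian (A A' : subspace V) (d h : {linear V -> V}) :
  (forall v, L v = d (h v) + h (d v)) -> (forall v, d (d v) = 0) ->
  (forall v, exists2 t, 0 \notin t & L (shift_prod t v) = 0) ->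
  (forall v, A v -> A' (h v)) -> (forall v, A v -> A (L v)) ->
  (forall v, A' v -> A' (L v)) ->
  let AL := scap (spre L (szero V)) A in let A'L := scap (spre L (szero V)) A' in
  (fd (scap AL (spre d (szero V))) (simg d A'L)
     <-> fd (scap A (spre d (szero V))) (simg d A')) /\
  rdim (scap AL (spre d (szero V))) (simg d A'L)
  = rdim (scap A (spre d (szero V))) (simg d A').
Proof.
move=> LE dd ss hA LA LA' AL A'L.
have dL v : d (L v) = L (d v) by rewrite !LE linearD /= !dd linear0 add0r addr0.
apply: (fd_iso (phi := idfun)) => [v [[Lv Av] dv]|w [Aw dw]|v [[Lv Av] dv]].
- by split.
- have [t t0 Lt] := ss w; have c0 := shift_const_neq0 t0.
  set c := shift_const t in c0.
  (* The product over [t] divided by its constant term c projects to the kernel of L. It equals 1 +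
     c^-1 L q(L), and L acts on cocycles as d h, so w changes by a coboundary only. *)
  exists (c^-1 *: shift_prod t w).
    split; first split.
    + by rewrite /= linearZ /= Lt scaler0.
    + exact/subspaceZ/shift_prod_stable.
    + by rewrite /= linearZ /= shift_prod_morph // dw shift_prod0 scaler0.
  exists (- c^-1 *: h (shift_rest t w)).
    exact/subspaceZ/hA/shift_rest_stable.
  rewrite /= shift_prodE -/c scalerDr scalerA mulVf // scale1r opprD addrA subrr.
  rewrite add0r LE (shift_rest_morph _ _ dL) dw.
  have -> : shift_rest t 0 = 0 by elim: (t) => //= a s ->; rewrite shift_prod0 scaler0 subr0.
  by rewrite linear0 addr0 [d (_ *: _)]linearZ /= scaleNr.
split=> [[y [Ly A'y] ->]|[y A'y e]]; first by exists y.
(* The same projection makes the primitive y harmonic and leaves d y = v unchanged, because L v =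
   0. *)
have [t t0 Lt] := ss y; have c0 := shift_const_neq0 t0.
set c := shift_const t in c0; exists (c^-1 *: shift_prod t y).
  split; last exact/subspaceZ/shift_prod_stable.
  by rewrite /= linearZ /= Lt scaler0.
rewrite linearZ /= shift_prod_morph // -e shift_prod_ker // -/c.
by rewrite scalerA mulVf // scale1r.
Qed.

End ShiftProduct.

(** * The Hodge star *)

Section HodgeStar.
Variables (K : fieldType) (m : nat) (N : lmodType K).
Local Notation W := {ffun {set 'I_m} -> N}.
Implicit Types (w : W) (J : {set 'I_m}).

(** Up to a sign depending only on the cardinal of J, this is the sign of the permutation listing J
    before its complement. Adding i changes it by (-1)^i, and i is the number of indices below i in
    J plus that in its complement; hence the star exchanges differential and contraction without
    extra sign. *)
Definition hodge_sign J : K := (-1) ^+ (\sum_(j in J) j)%N.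

Lemma hodge_signK J : hodge_sign J * hodge_sign J = 1.
Proof. by rewrite /hodge_sign -exprMn mulrNN mulr1 expr1n. Qed.

Definition hodge_star w : W := [ffun J : {set 'I_m} => hodge_sign J *: w (~: J)].

Lemma hodge_star_is_linear : linear hodge_star.
Proof.
by move=> a u v; apply/ffunP => J; rewrite !ffunE scalerDr !scalerA mulrC.
Qed.
HB.instance Definition _ := GRing.isLinear.Build K W W _ hodge_star hodge_star_is_linear.

Lemma hodge_star_surj w : exists w', w = hodge_star w'.
Proof.
exists [ffun J : {set 'I_m} => hodge_sign (~: J) *: w (~: J)]; apply/ffunP => J.
by rewrite !ffunE setCK scalerA hodge_signK scale1r.
Qed.

Lemma hodge_star_inj : injective hodge_star.
Proof.
move=> w w' /ffunP h; apply/ffunP => J; have := h (~: J); rewrite !ffunE setCK.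
by move/(congr1 (GRing.scale (hodge_sign (~: J)))); rewrite !scalerA hodge_signK !scale1r.
Qed.

Lemma card_below_setC J (i : 'I_m) :
  (#|[set j in J | (j < i)%N]| + #|[set j in ~: J | (j < i)%N]|)%N = i.
Proof.
rewrite !card_below [X in (X + _)%N]big_mkcond [X in (_ + X)%N]big_mkcond -big_split /=.
have -> : (\sum_(j < m) ((if j \in J then (j < i)%N : nat else 0)
            + (if j \in ~: J then (j < i)%N : nat else 0)) = \sum_(j < m) (j < i)%N)%N.
  by apply: eq_bigr => j _; rewrite inE; case: (j \in J); rewrite ?addn0 ?add0n.
rewrite -big_mkcond /= -(big_ord_widen _ (fun=> 1%N)) ?sum1_card ?card_ord //.
exact: ltnW.
Qed.

Lemma hodge_star_diff (phi : 'I_m -> {linear N -> N}) w :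
  hodge_star (koszul_diff phi w) = koszul_contract phi (hodge_star w).
Proof.
apply/ffunP => J; rewrite !ffunE scaler_sumr; apply: eq_big => [i|i]; first by rewrite inE.
rewrite inE => iJ; rewrite ffunE [phi _ (_ *: _)]linearZ !scalerA; congr (_ *: phi i (w _)).
  rewrite /hodge_sign big_setU1 //= exprD mulrA mulrC; congr (_ * _).
  rewrite -[in X in _ * (-1) ^+ X](card_below_setC J i) exprD mulrA -exprMn.
  by rewrite mulrNN mulr1 expr1n mul1r.
by apply/setP => j; rewrite !inE negb_or.
Qed.

End HodgeStar.

(** * Cartan's formula and harmonic forms *)

Section Eulerian.
Variables (K : fieldType) (m : nat) (M : weylModule K m).
Local Notation W := {ffun {set 'I_m} -> M}.
Implicit Types (w : W) (J : {set 'I_m}) (v : M).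

Definition euler v : M := \sum_i weylX M i (weylD M i v).

Lemma euler_is_linear : linear euler.
Proof.
move=> a u v; rewrite /euler scaler_sumr -big_split; apply: eq_bigr => i _.
by rewrite !linearP.
Qed.
HB.instance Definition _ := GRing.isLinear.Build K M M _ euler euler_is_linear.

Definition lie_euler w : W := [ffun J : {set 'I_m} => euler (w J) + #|J|%:R *: w J].

Lemma lie_euler_is_linear : linear lie_euler.
Proof.
move=> a u v; apply/ffunP => J; rewrite !ffunE linearP /= [in RHS]scalerDr.
by rewrite scalerDr !scalerA [a * _]mulrC addrACA.
Qed.
HB.instance Definition _ := GRing.isLinear.Build K W W _ lie_euler lie_euler_is_linear.

(** For i in J the order is D_i X_i = X_i D_i + 1, and these units add up to the form degree. *)
Lemma cartan w :
  koszul_diff (weylD M) (koszul_contract (weylX M) w)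
  + koszul_contract (weylX M) (koszul_diff (weylD M) w) = lie_euler w.
Proof.
rewrite koszul_diff_contract => [|i j v /negPf ij]; last by rewrite weylDX ij addr0.
apply/ffunP => J; rewrite !ffunE /euler.
have -> : #|J|%:R *: w J = \sum_i (if i \in J then w J else 0).
  by rewrite -big_mkcond sumr_const scaler_nat.
rewrite -big_split; apply: eq_bigr => i _ /=; case: ifP => _; last by rewrite addr0.
by rewrite weylDX eqxx.
Qed.

Lemma lie_euler_semisimple : (forall v, semisimple_at euler v) ->
  forall w, exists2 t, 0 \notin t & lie_euler (shift_prod lie_euler t w) = 0.
Proof.
move=> ss w.
have /choice[s hs] J : exists s, uniq s /\ shift_prod euler s (w J) = 0.
  by have [s] := ss (w J); exists s.
(* On the J-component the operator is E plus the cardinal of J, so the eigenvalues are shifted by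
   it. The value 0 is dropped from the list, the remaining factor [lie_euler] in the goal accounting
   for it once. *)
pose t := [seq a <- flatten [seq [seq a + #|J|%:R | a <- s J] | J <- enum {set 'I_m}] | a != 0].
exists t; first by rewrite mem_filter eqxx.
apply/ffunP => J; rewrite !ffunE.
have -> r : shift_prod lie_euler r w J = shift_prod euler [seq a - #|J|%:R | a <- r] (w J).
  by elim: r => //= a r IH; rewrite !ffunE IH scalerBl opprB -addrA.
have -> x : euler x + #|J|%:R *: x = shift_prod euler [:: - #|J|%:R] x.
  by rewrite /= scaleNr opprK.
rewrite -[LHS]/(shift_prod euler (- #|J|%:R :: [seq a - #|J|%:R | a <- t]) (w J)).
have [us s0] := hs J; apply: shift_prod_subset us _ s0 => a as_.
rewrite inE; case: eqVneq => //= ne.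
apply/mapP; exists (a + #|J|%:R); last by rewrite addrK.
rewrite mem_filter addr_eq0 ne /=; apply/flatten_mapP; exists J; first by rewrite mem_enum.
by apply: map_f.
Qed.

Local Notation dD := (koszul_diff (weylD M)).
Local Notation iX := (koszul_contract (weylX M)).

Lemma deRham_diff_diff w : dD (dD w) = 0.
Proof. by apply: koszul_diff_diff => *; exact: weylDD. Qed.

Lemma contractX_contractX w : iX (iX w) = 0.
Proof.
have [w' ->] := hodge_star_surj w; rewrite -!hodge_star_diff koszul_diff_diff ?linear0 //.
by move=> *; exact: weylXX.
Qed.

(** Form degree and complementary degree, raised by 2 as the Euler characteristic section requires.
    For [degC] the contraction becomes the operator that raises degrees. *)
Definition degF J := #|J|.+2.
Definition degC J := #|~: J|.+2.

Lemma degFE J J' (i : 'I_m) : i \in J -> J' = J :\ i -> (degF J').+1 = degF J.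
Proof. by move=> iJ ->; rewrite /degF (cardsD1 i J) iJ. Qed.

Lemma degF_U J (i : 'I_m) : i \notin J -> degF (i |: J) = (degF J).+1.
Proof. by move=> iJ; rewrite /degF cardsU1 iJ. Qed.

Lemma degCE J : degC J = (m - #|J|).+2.
Proof. by rewrite /degC cardsCs setCK card_ord. Qed.

Lemma card_set_le J : (#|J| <= m)%N.
Proof. by rewrite -[X in (_ <= X)%N]card_ord max_card. Qed.

Lemma dD_localF w J : (forall J', (degF J').+1 = degF J -> w J' = 0) -> dD w J = 0.
Proof.
move=> h; rewrite ffunE big1 // => i iJ; rewrite h ?linear0 ?scaler0 //.
exact: degFE iJ _.
Qed.

Lemma iX_localF w J : (forall J', degF J' = (degF J).+1 -> w J' = 0) -> iX w J = 0.
Proof.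
move=> h; rewrite ffunE big1 // => i iJ; rewrite h ?linear0 ?scaler0 //.
exact: degF_U.
Qed.

Lemma degC_F J J' : (degC J' = (degC J).+1) <-> ((degF J').+1 = degF J).
Proof. by rewrite !degCE /degF; have := card_set_le J; have := card_set_le J'; lia. Qed.

Lemma dD_localC w J : (forall J', degC J' = (degC J).+1 -> w J' = 0) -> dD w J = 0.
Proof. by move=> h; apply: dD_localF => J' /degC_F; exact: h. Qed.

Lemma iX_localC w J : (forall J', (degC J').+1 = degC J -> w J' = 0) -> iX w J = 0.
Proof.
by move=> h; apply: iX_localF => J' e; apply: h; apply/esym/degC_F.
Qed.

Definition harmonic : subspace W := spre lie_euler (szero W).

Lemma lie_dD w : lie_euler (dD w) = dD (lie_euler w).
Proof. by rewrite -!cartan linearD /= !deRham_diff_diff linear0 addr0 add0r. Qed.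

Lemma lie_iX w : lie_euler (iX w) = iX (lie_euler w).
Proof. by rewrite -!cartan linearD /= !contractX_contractX linear0 addr0 add0r. Qed.

Lemma harmonic_dD w : harmonic w -> harmonic (dD w).
Proof. by rewrite /= lie_dD => ->; rewrite linear0. Qed.

Lemma harmonic_iX w : harmonic w -> harmonic (iX w).
Proof. by rewrite /= lie_iX => ->; rewrite linear0. Qed.

Lemma harmonic_part (deg : {set 'I_m} -> nat) n w :
  harmonic w -> harmonic (deg_part deg n w).
Proof.
move=> /ffunP hw; apply/ffunP => J; have := hw J; rewrite !ffunE.
by case: ifP => // _ _; rewrite linear0 scaler0 addr0.
Qed.

Lemma lie_euler_supp (deg : {set 'I_m} -> nat) P w : supp M deg P w -> supp M deg P (lie_euler w).
Proof. by move=> sw t nt; rewrite ffunE sw // linear0 scaler0 addr0. Qed.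

End Eulerian.

Section EulerianModule.
Variables (K : fieldType) (m : nat) (M : weylModule K m).
Hypothesis charK : [pchar K] =i pred0.
Local Notation W := {ffun {set 'I_m} -> M}.
Implicit Types (w : W) (J : {set 'I_m}) (v : M).
Local Notation dD := (koszul_diff (weylD M)).
Local Notation dX := (koszul_diff (weylX M)).
Local Notation iX := (koszul_contract (weylX M)).
Local Notation degF := (@degF m).
Local Notation degC := (@degC m).

Definition koszul_coc (phi : 'I_m -> {linear M -> M}) p : subspace W :=
  cocycles (koszul_cochains m M) (koszul_diff phi) p.
Definition koszul_cob (phi : 'I_m -> {linear M -> M}) p : subspace W :=
  coboundaries (koszul_cochains m M) (koszul_diff phi) p.

Lemma koszul_coc_supp phi p w : koszul_coc phi p w
  <-> scap (supp M degF (pred1 p.+2)) (spre (koszul_diff phi) (szero W)) w.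
Proof.
split=> -[hw dw]; split=> // J; last by move=> /eqP nJ; apply: hw.
by move=> /= nJ; apply: hw => /eqP; apply/negP.
Qed.

Lemma koszul_cob_supp phi p w : koszul_cob phi p w
  <-> simg (koszul_diff phi) (supp M degF (pred1 p.+1)) w.
Proof.
case: p => [|p] /=; split.
- by move=> ->; exists 0; rewrite ?linear0 // => t _; rewrite ffunE.
- move=> [u su ->]; have -> : u = 0; last exact: linear0.
  by apply/ffunP => J; rewrite su ?ffunE.
- by move=> [u su ->]; exists u => // J /= nJ; apply: su => /eqP; apply/negP.
by move=> [u su ->]; exists u => // J /eqP nJ; apply: su.
Qed.

Lemma koszul_coc_fd (X D : 'I_m -> {linear M -> M}) c F p : weyl_ops X D ->
  growth X D (sfull M) (szero M) c F -> fd (koszul_coc X p) (koszul_cob X p).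
Proof.
move=> ops gF.
have st (Y : 'I_m -> {linear M -> M}) : stable Y (szero M).
  by move=> i v /= ->; rewrite linear0.
apply: (fd_inj (phi := idfun)) (koszul_fd charK ops (st X) (st D) gF) => [w [hw dw]|w [hw dw]].
  by split=> // J; rewrite /= dw ffunE.
move=> [_ [v [[u _ ->] v0 e]]]; apply/koszul_cob_supp.
have {v0 e} wE : w = koszul_diff X u.
  by rewrite -[w]/(idfun w) e -[RHS]addr0; congr (_ + _); apply/ffunP => J; rewrite v0 ffunE.
(* [koszul_fd] treats all degrees together; only the part of u one degree below contributes to w. *)
rewrite wE; exists (deg_part degF p.+1 u); first by move=> J /= /negPf nJ; rewrite ffunE nJ.
have Xloc (w' : W) J : (forall J', (degF J').+1 = degF J -> w' J' = 0) ->
    koszul_diff X w' J = 0.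
  move=> h; rewrite ffunE big1 // => i iL; rewrite h ?linear0 ?scaler0 //.
  exact: degFE iL _.
apply/ffunP => J; rewrite -(deg_part_d Xloc) [RHS]ffunE.
by case: eqP => // nJ; rewrite -wE; apply: hw => cJ; apply: nJ; rewrite /degF cJ.
Qed.

Lemma supp_degC_setC n w :
  supp M degC (pred1 n) (hodge_star w) <-> supp M degF (pred1 n) w.
Proof.
split=> sw J nJ.
  have := sw (~: J); rewrite /degC setCK ffunE setCK => /(_ nJ) /eqP.
  rewrite scaler_eq0 => /orP[/eqP h|/eqP //].
  by have := hodge_signK K (~: J); rewrite h mul0r => /eqP; rewrite eq_sym oner_eq0.
by rewrite ffunE sw ?scaler0.
Qed.

Lemma koszul_coc_star p :
  (fd (koszul_coc (weylX M) p) (koszul_cob (weylX M) p)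
   <-> fd (scap (supp M degC (pred1 p.+2)) (spre iX (szero W)))
          (simg iX (supp M degC (pred1 p.+1)))) /\
  rdim (koszul_coc (weylX M) p) (koszul_cob (weylX M) p)
  = rdim (scap (supp M degC (pred1 p.+2)) (spre iX (szero W)))
         (simg iX (supp M degC (pred1 p.+1))).
Proof.
apply: (fd_iso (phi := @hodge_star K m M)) => [w /koszul_coc_supp[sw dw]|w [sw dw]|w _].
- split; first exact/supp_degC_setC.
  by rewrite /= -hodge_star_diff dw linear0.
- have [w' e] := hodge_star_surj w; rewrite e in sw dw *.
  exists w'; last exact: subspace_subrr.
  apply/koszul_coc_supp; split; first exact/supp_degC_setC.
  by apply: (@hodge_star_inj K m M); rewrite hodge_star_diff linear0.
split=> [/koszul_cob_supp[u su ->]|[u su]].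
  by exists (hodge_star u); [exact/supp_degC_setC | exact: hodge_star_diff].
have [u' e] := hodge_star_surj u; rewrite {}e in su *.
move=> e; apply/koszul_cob_supp; exists u'; first exact/supp_degC_setC.
by apply: (@hodge_star_inj K m M); rewrite hodge_star_diff.
Qed.

Hypothesis ss : forall v, semisimple_at (@euler K m M) v.
Local Notation lie := (@lie_euler K m M).
Local Notation H := (@harmonic K m M).

Lemma deRham_harmonic p :
  (fd (deg_cocycles degF H dD p.+2) (deg_coboundaries degF H dD p.+2)
   <-> fd (koszul_coc (weylD M) p) (koszul_cob (weylD M) p)) /\
  rdim (deg_cocycles degF H dD p.+2) (deg_coboundaries degF H dD p.+2)
  = rdim (koszul_coc (weylD M) p) (koszul_cob (weylD M) p).
Proof.
have eqA : (koszul_coc (weylD M) p : W -> Prop)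
    = scap (supp M degF (pred1 p.+2)) (spre dD (szero W)).
  by apply/funext => w; apply/propext; exact: koszul_coc_supp.
have eqB : (koszul_cob (weylD M) p : W -> Prop) = simg dD (supp M degF (pred1 p.+1)).
  by apply/funext => w; apply/propext; exact: koszul_cob_supp.
rewrite eqA eqB.
apply: (rdim_laplacian (L := lie) (h := iX)) => //.
- by move=> w; exact/esym/cartan.
- exact: deRham_diff_diff.
- exact: lie_euler_semisimple.
- move=> w sw J nJ; apply: iX_localF => J' e; apply: sw.
  by rewrite /= e eqSS.
- by move=> w; apply: lie_euler_supp.
- by move=> w; apply: lie_euler_supp.
Qed.

Lemma koszul_harmonic p :
  (fd (deg_cocycles degC H iX p.+2) (deg_coboundaries degC H iX p.+2)
   <-> fd (koszul_coc (weylX M) p) (koszul_cob (weylX M) p)) /\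
  rdim (deg_cocycles degC H iX p.+2) (deg_coboundaries degC H iX p.+2)
  = rdim (koszul_coc (weylX M) p) (koszul_cob (weylX M) p).
Proof.
have [fds rds] := koszul_coc_star p; rewrite fds rds.
apply: (rdim_laplacian (L := lie) (h := dD)) => //.
- by move=> w; rewrite addrC; exact/esym/cartan.
- exact: contractX_contractX.
- exact: lie_euler_semisimple.
- move=> w sw J nJ; apply: dD_localC => J' e; apply: sw.
  by rewrite /= e eqSS.
- by move=> w; apply: lie_euler_supp.
- by move=> w; apply: lie_euler_supp.
Qed.

(** [degF J] and [degC J] add up to m + 4, so parities are exchanged exactly when m is odd; the sign
    of the theorem arises here. *)
Lemma parity_dim_dual (D : {linear W -> W}) b :
  parity_dim degC H D b = parity_dim degF H D (b (+) odd m).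
Proof.
have E c w : parity_part degC H c w <-> parity_part degF H (c (+) odd m) w.
  have o J : (odd (degC J) == c) = (odd (degF J) == c (+) odd m).
    rewrite degCE /degF /= !negbK oddB ?card_set_le //.
    by case: (odd m); case: (odd #|J|); case: c.
  by split=> -[hw sw]; split=> // J nJ; apply: sw; rewrite /= o in nJ *.
rewrite /parity_dim -addNb.
apply: (fd_iso (phi := idfun) _ _ _).2 => [v [/E ? ?] //|w [/E ? ?]|v _].
  by exists w => //; exact: subspace_subrr.
by split=> -[u /E pu e]; exists u.
Qed.

Theorem euler_char_eulerian c F :
  growth (weylX M) (weylD M) (sfull M) (szero M) c F ->
  chi_deRham M = (-1) ^+ m * chi_Koszul M.
Proof.
move=> gF; rewrite /chi_deRham /chi_Koszul /koszul_euler_char.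
have ops : weyl_ops (weylX M) (weylD M).
  by split=> *; [exact: weylXX | exact: weylDD | exact: weylDX].
(* Fourier transform: D and -X satisfy the relations of X and D, and the filtration is unchanged, so
   the de Rham complex is a Koszul complex to which the same finiteness applies. *)
pose X' i : {linear M -> M} := \- weylX M i.
have X'E i v : X' i v = - weylX M i v by [].
have ops' : weyl_ops (weylD M) X'.
  split=> i j v; first exact: weylDD.
    by rewrite !X'E ![weylX M _ (- _)]linearN weylXX.
  by rewrite !X'E [weylD M _ (- _)]linearN weylDX eq_sym opprD addrNK.
have gF' : growth (weylD M) X' (sfull M) (szero M) c F.
  case: gF => h1 h2 h3 h4 h5 h6 h7; split=> // i k v Fv; exact/subspaceN/h4.
pose DD : {linear W -> W} := dD \+ iX.
have Cpart deg n w : H w -> H (deg_part deg n w) by exact: harmonic_part.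
have dF : forall J, (degF J <= m.+2)%N by move=> J; rewrite /degF !ltnS card_set_le.
have dC : forall J, (degC J <= m.+2)%N by move=> J; rewrite /degC !ltnS card_set_le.
have eF := @euler_char_parity K M _ degF m (fun=> isT) dF H dD iX DD (fun=> erefl)
  (@dD_localF K m M) (@iX_localF K m M) (@harmonic_dD K m M) (@harmonic_iX K m M)
  (Cpart degF) (fun w _ => deRham_diff_diff w) (fun w _ => contractX_contractX w) _ _.
have eC := @euler_char_parity K M _ degC m (fun=> isT) dC H iX dD DD _
  (@iX_localC K m M) (@dD_localC K m M) (@harmonic_iX K m M) (@harmonic_dD K m M)
  (Cpart degC) (fun w _ => contractX_contractX w) (fun w _ => deRham_diff_diff w) _ _.
have -> : \sum_(p < m.+1) (-1) ^+ p * (vdim (koszul_cohomology (weylD M) p))%:Z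
  = (parity_dim degF H DD false)%:Z - (parity_dim degF H DD true)%:Z.
  rewrite -eF => [|w hw|p _]; last exact/(deRham_harmonic p).1/(koszul_coc_fd p ops' gF').
    by apply: eq_bigr => p _; rewrite (deRham_harmonic p).2 vdim_subquot.
  by rewrite cartan.
have -> : \sum_(p < m.+1) (-1) ^+ p * (vdim (koszul_cohomology (weylX M) p))%:Z
  = (parity_dim degC H DD false)%:Z - (parity_dim degC H DD true)%:Z.
  rewrite -eC => [||w hw|p _]; last exact/(koszul_harmonic p).1/(koszul_coc_fd p ops gF).
  - by apply: eq_bigr => p _; rewrite (koszul_harmonic p).2 vdim_subquot.
  - by move=> w; rewrite /= addrC.
  - by rewrite addrC cartan.
rewrite !parity_dim_dual /= -signr_odd.
by case: (odd m); rewrite /= ?expr0 ?mul1r // expr1 mulN1r opprB.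
Qed.

End EulerianModule.

(** * Growth of local cohomology *)

Section SubquotientGrowth.
Variables (K : fieldType) (m : nat) (N : weylModule K m) (Z B : subspace N).
Hypothesis XZ : forall i v, Z v -> Z (weylX N i v).
Hypothesis XB : forall i v, B v -> B (weylX N i v).
Hypothesis DZ : forall i v, Z v -> Z (weylD N i v).
Hypothesis DB : forall i v, B v -> B (weylD N i v).
Local Notation Q := (weyl_subquot XZ XB DZ DB).
Local Notation cl := (@subquot_class K N Z B).

Lemma weylX_class i z : exists2 z', val z' = weylX N i (val z) & weylX Q i (cl z) = cl z'.
Proof.
by exists (subspace_elt (XZ i (subspace_typeP z))) => //; exact: (subquot_mapE _ (XB _)).
Qed.

Lemma weylD_class i z : exists2 z', val z' = weylD N i (val z) & weylD Q i (cl z) = cl z'.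
Proof.
by exists (subspace_elt (DZ i (subspace_typeP z))) => //; exact: (subquot_mapE _ (DB _)).
Qed.

(** The type [subquot Z B] is Z / (Z :&: B); intersecting with [Z] puts the lower space inside the
    upper one, as [growth] demands. *)
Lemma growth_weyl_subquot c F : growth (weylX N) (weylD N) Z (scap B Z) c F ->
  exists F', growth (weylX Q) (weylD Q) (sfull Q) (szero Q) c F'.
Proof.
move=> gF; pose vl : {linear subspace_type Z -> N} := val.
pose clin : {linear subspace_type Z -> Q} := cl.
exists (fun k => simg clin (spre vl (F k))).
split=> [k v ->||k _ [z Fz ->]|i k _ [z Fz ->]|i k _ [z Fz ->]|v _|k n].
- exact: subspace0.
- by [].
- by exists z => //; exact: (growth_S gF).
- have [z' ez' ->] := weylX_class i z; exists z' => //=.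
  by rewrite ez'; exact: (growth_X gF).
- have [z' ez' ->] := weylD_class i z; exists z' => //=.
  by rewrite ez'; exact: (growth_D gF).
- have [k Fk] := growth_ex gF (subspace_typeP (repr v)).
  by exists k, (repr v) => //=; rewrite subquot_classK.
have <- : indep (spre vl (F k)) (spre vl B) = indep (simg clin (spre vl (F k))) (szero Q).
  apply: (indep_iso (phi := clin)) => [z Fz|_ [z Fz ->]|z _].
  - exact: simgI.
  - by exists z => //=; rewrite subrr.
  by rewrite /= -[0](linear0 clin) subquot_classP /= subr0.
have -> : indep (spre vl (F k)) (spre vl B) = indep (F k) (scap B Z).
  apply: (indep_iso (phi := vl)) => [z Fz //|z Fz|z Fz].
  - have Zz := growth_top gF Fz; exists (subspace_elt Zz) => //=.
    by rewrite subrr; split; exact: subspace0.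
  by split=> [Bz|[]//]; split=> //; exact: subspace_typeP.
exact: (growth_bound gF).
Qed.

End SubquotientGrowth.

Lemma div_exp_add (L : fieldType) (a f : L) j k : f != 0 ->
  a / f ^+ k.+1 = a * f ^+ j / f ^+ (j + k).+1.
Proof.
move=> f0; rewrite -addnS exprD invfM -mulrA; congr (_ * _).
by rewrite mulrA mulfV ?mul1r // expf_neq0.
Qed.

(** * The filtration of a localization by pole order *)

Section LocalizationFiltration.
Variables (K : fieldType) (m : nat).
Local Notation R := {mpoly K[m]}.
Local Notation F := (ratfun K m).
Local Notation P := (@poly_ratfun K m).

Lemma msizeM_bound d (a b : R) : (msize a <= d.+1)%N -> (msize (a * b) <= d + msize b)%N.
Proof.
move=> ad; have [->|a0] := eqVneq a 0; first by rewrite mul0r msize0.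
have [->|b0] := eqVneq b 0; first by rewrite mulr0 msize0.
by rewrite msizeM // -subn1 leq_subLR addnA add1n leq_add2r.
Qed.

Lemma msizeB_bound d (a b : R) :
  (msize a <= d)%N -> (msize b <= d)%N -> (msize (a - b) <= d)%N.
Proof.
move=> ad bd; apply: leq_trans (mmeasureD_le _ _ _) _.
by rewrite geq_max mmeasureN ad.
Qed.

Lemma msize_mderiv i (a : R) : (msize a^`M(i) <= msize a)%N.
Proof.
rewrite [X in (X <= _)%N]msizeE; apply/bigmax_leqP_seq => mu mus _.
have : a@_(mu + U_(i)) != 0.
  apply/eqP => h; move: mus; rewrite mcoeff_msupp mcoeff_deriv h mul0rn eqxx //.
rewrite -mcoeff_msupp => /msize_mdeg_lt; rewrite mdegD; lia.
Qed.

Lemma msize_mulrn (a : R) k : (msize (a *+ k) <= msize a)%N.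
Proof. by rewrite -scaler_nat; apply: msizeZ_le. Qed.

(** Bernstein's filtration of R_f: [msize] being the degree plus one, the numerator has degree at
    most D (k+1). A slope D above [msize f] leaves room for the factor f of the next denominator
    together with X_i. *)
Definition loc_filt_rel (f : R) (D k : nat) (x : F) : Prop :=
  exists2 g : R, (msize g <= (D * k.+1).+1)%N & x = P g / P f ^+ k.+1.

Lemma loc_filt_subproof f D k : loc_filt_rel f D k 0 /\
  forall (a : K) x y, loc_filt_rel f D k x -> loc_filt_rel f D k y ->
    loc_filt_rel f D k (a *: x + y).
Proof.
split; first by exists 0; rewrite ?msize0 // poly_ratfun0 mul0r.
move=> a _ _ [g sg ->] [h sh ->]; exists (a *: g + h); last first.
  by rewrite ratfun_scaleE -mul_mpolyC poly_ratfunD poly_ratfunM mulrDl mulrA.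
apply: leq_trans (mmeasureD_le _ _ _) _; rewrite geq_max sh andbT.
by apply: leq_trans sg; apply: msizeZ_le.
Qed.
Definition loc_filt f D k : subspace F :=
  Subspace (loc_filt_subproof f D k).1 (loc_filt_subproof f D k).2.

Section Fixed.
Variables (f : R) (D : nat).
Hypothesis fD : (msize f < D)%N.

Lemma frac_shift (g : R) k j : P g / P f ^+ k.+1 = P (g * f ^+ j) / P f ^+ (j + k).+1.
Proof.
have [->|f0] := eqVneq f 0.
  by rewrite poly_ratfun0 !expr0n /= invr0 !mulr0.
have Pf0 : P f != 0 by rewrite poly_ratfun_eq0.
rewrite poly_ratfunM poly_ratfunX; exact: (div_exp_add (P g) j k Pf0).
Qed.

Lemma loc_filtS k x : loc_filt f D k x -> loc_filt f D k.+1 x.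
Proof.
move=> [g sg ->]; exists (g * f); last by rewrite (frac_shift g k 1) expr1.
by apply: leq_trans (msizeM_bound f sg) _; nia.
Qed.

Lemma loc_filt_leq k l x : (k <= l)%N -> loc_filt f D k x -> loc_filt f D l x.
Proof. by move=> /subnK <-; elim: (l - k)%N => // j IH /IH; apply: loc_filtS. Qed.

Lemma loc_filtX i k x : loc_filt f D k x -> loc_filt f D k.+1 (ratfun_X i x).
Proof.
move=> [g sg ->]; exists ('X_i * g * f).
  have sX : (msize ('X_i * g) <= (D * k.+1 + 1).+1)%N.
    by have := msizeM_bound 'X_i sg; rewrite msizeX mdeg1 mulrC addn1 addn2.
  by apply: leq_trans (msizeM_bound f sX) _; nia.
rewrite /ratfun_X mulrA -poly_ratfunM; have := frac_shift ('X_i * g) k 1.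
by rewrite expr1 add1n => <-.
Qed.

Lemma ratfun_D_exp i (y : F) n : ratfun_D i (y ^+ n.+1) = n.+1%:R * y ^+ n * ratfun_D i y.
Proof.
elim: n => [|n IH]; first by rewrite expr1 expr0 !mul1r.
rewrite exprS ratfun_DM IH [n.+2%:R]mulrS exprS; ring.
Qed.

Lemma loc_filtD i k x : loc_filt f D k x -> loc_filt f D k.+1 (ratfun_D i x).
Proof.
move=> [g sg xE].
have [f0|f0] := eqVneq f 0.
  rewrite xE f0 poly_ratfun0 expr0n invr0 mulr0 raddf0; exact: subspace0.
have Pf0 : P f != 0 by rewrite poly_ratfun_eq0.
(* The numerator of the derivative of g / f^(k+1) over f^(k+2). *)
exists (g^`M(i) * f - (g * f^`M(i)) *+ k.+1).
  apply: msizeB_bound.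
    apply: leq_trans (msizeM_bound f (leq_trans (msize_mderiv i g) sg)) _; nia.
  apply: leq_trans (msize_mulrn _ _) _; apply: leq_trans (msizeM_bound _ sg) _.
  by have := msize_mderiv i f; nia.
have xg : x * P f ^+ k.+1 = P g by rewrite xE (mulfVK (expf_neq0 _ Pf0)).
have : ratfun_D i x * P f ^+ k.+1 + x * (k.+1%:R * P f ^+ k * P f^`M(i)) = P g^`M(i).
  by rewrite -(ratfun_D_poly i g) -xg ratfun_DM ratfun_D_exp ratfun_D_poly.
move=> e; apply/(canRL (mulfK (expf_neq0 _ Pf0))).
rewrite poly_ratfunB poly_ratfunM -e -(mulr_natl (g * _)) !poly_ratfunM -xg.
have -> : P k.+1%:R = k.+1%:R by rewrite rmorph_nat.
rewrite !exprS; ring.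
Qed.

Lemma loc_filt_in_loc k x : loc_filt f D k x -> in_loc f x.
Proof. by move=> [g _ ->]; exists g, k. Qed.

Lemma in_loc_filt x : in_loc f x -> exists k, loc_filt f D k x.
Proof.
(* Each extra factor f costs deg f in the numerator while the allowance grows by D > deg f, so
   [msize g] factors absorb the degree of g. *)
move=> [g [k ->]]; exists (msize g + k)%N, (g * f ^+ msize g); last exact: frac_shift.
have h j : (msize (g * f ^+ j) <= msize g + j * (msize f).-1)%N.
  elim: j => [|j IH]; first by rewrite expr0 mulr1 addn0.
  rewrite exprSr mulrA; set a := g * _ in IH *.
  have [->|a0] := eqVneq a 0; first by rewrite mul0r msize0.
  have [->|f0] := eqVneq f 0; first by rewrite mulr0 msize0.
  have f1 : (0 < msize f)%N by rewrite lt0n mmeasure_poly_eq0.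
  by rewrite msizeM // -{1}(prednK f1) addnS /= mulSn addnCA addnC leq_add2l.
apply: leq_trans (h _) _; move: fD; move: (msize f) (msize g) => a b aD.
have : (b * a.-1 + b <= b * D)%N by case: a aD => [|a] aD; nia.
by nia.
Qed.
End Fixed.

Lemma card_bmultinom d : (#|{: 'X_{1..m < d.+1}}| <= d.+1 ^ m)%N.
Proof.
have -> : (d.+1 ^ m = #|{ffun 'I_m -> 'I_d.+1}|)%N by rewrite card_ffun !card_ord.
pose enc (mu : 'X_{1..m < d.+1}) : {ffun 'I_m -> 'I_d.+1} := [ffun i => inord ((mu : 'X_{1..m}) i)].
apply: (@leq_card _ _ enc) => mu nu /ffunP e; apply/val_inj/mnmP => i.
have le (x : 'X_{1..m < d.+1}) : ((x : 'X_{1..m}) i < d.+1)%N.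
  apply: leq_ltn_trans (bmdeg x); rewrite mdegE (bigD1 i) //=; exact: leq_addr.
by have := congr1 val (e i); rewrite !ffunE /= !inordK.
Qed.

End LocalizationFiltration.

Section CechGrowth.
Variables (K : fieldType) (m s : nat) (f : 'I_s -> {mpoly K[m]}).
Local Notation W := (weyl_ffun {set 'I_s} (ratfun_weyl K m)).
Local Notation P := (@poly_ratfun K m).
Local Notation prodf J := (\prod_(j in J) f j).

Lemma loc_cochains_subproof :
  (forall J : {set 'I_s}, in_loc (prodf J) ((0 : {ffun {set 'I_s} -> ratfun K m}) J)) /\
  forall (a : K) (u v : {ffun {set 'I_s} -> ratfun K m}),
    (forall J : {set 'I_s}, in_loc (prodf J) (u J)) ->
    (forall J : {set 'I_s}, in_loc (prodf J) (v J)) ->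
    forall J : {set 'I_s}, in_loc (prodf J) ((a *: u + v) J).
Proof.
split=> [J|a u v hu hv J]; rewrite !ffunE; first exact: in_loc0.
exact: in_locP.
Qed.
Definition loc_cochains : subspace W :=
  @Subspace K W (fun w : {ffun {set 'I_s} -> ratfun K m} =>
      forall J : {set 'I_s}, in_loc (prodf J) (w J))
    loc_cochains_subproof.1 loc_cochains_subproof.2.

Definition cech_deg := (\sum_(J : {set 'I_s}) msize (prodf J)).+1.

Lemma cech_degP (J : {set 'I_s}) : (msize (prodf J) < cech_deg)%N.
Proof. by rewrite ltnS (bigD1 J) //= leq_addr. Qed.

Lemma cech_filt_subproof k :
  (forall J : {set 'I_s}, loc_filt (prodf J) cech_deg k
     ((0 : {ffun {set 'I_s} -> ratfun K m}) J)) /\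
  forall (a : K) (u v : {ffun {set 'I_s} -> ratfun K m}),
    (forall J : {set 'I_s}, loc_filt (prodf J) cech_deg k (u J)) ->
    (forall J : {set 'I_s}, loc_filt (prodf J) cech_deg k (v J)) ->
    forall J : {set 'I_s}, loc_filt (prodf J) cech_deg k ((a *: u + v) J).
Proof.
split=> [J|a u v hu hv J]; rewrite !ffunE; first exact: subspace0.
exact: subspaceP.
Qed.
Definition cech_filt k : subspace W :=
  @Subspace K W (fun w : {ffun {set 'I_s} -> ratfun K m} =>
      forall J : {set 'I_s}, loc_filt (prodf J) cech_deg k (w J))
    (cech_filt_subproof k).1 (cech_filt_subproof k).2.

(** Step k is spanned by the monomials of degree at most d = [cech_deg * k.+1] over a fixed
    denominator for each of the 2^s sets J, and there are at most (d+1)^m <= ([cech_deg] + 1)^m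
    (k+1)^m of them. *)
Lemma growth_cech : growth (weylX W) (weylD W) loc_cochains (szero W)
  (2 ^ s * cech_deg.+1 ^ m) cech_filt.
Proof.
split.
- by move=> k v ->; exact: subspace0.
- by move=> k w Fw J; apply: loc_filt_in_loc (Fw J).
- by move=> k w Fw J; apply: loc_filtS (cech_degP J) _ _ (Fw J).
- by move=> i k w Fw J; rewrite ffunE; apply: loc_filtX (cech_degP J) _ _ _ (Fw J).
- by move=> i k w Fw J; rewrite ffunE; apply: loc_filtD (cech_degP J) _ _ _ (Fw J).
- move=> w Zw; have [k hk] := choice (fun J => in_loc_filt (cech_degP J) (Zw J)).
  exists (\sum_J k J)%N => J; apply: loc_filt_leq (cech_degP J) _ _ _ _ (hk J).
  by rewrite (bigD1 J) //= leq_addr.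
move=> k n.
pose d := (cech_deg * k.+1)%N.
pose T : finType := ({set 'I_s} * 'X_{1..m < d.+1})%type.
pose e (t : {set 'I_s} * 'X_{1..m < d.+1}) : W := [ffun J : {set 'I_s} => if J == t.1
  then P 'X_[bmnm t.2] / P (prodf J) ^+ k.+1 else 0].
have bnd : (#|T| <= 2 ^ s * cech_deg.+1 ^ m * k.+1 ^ m)%N.
  rewrite card_prod -mulnA leq_mul //.
    by have := card_powerset [set: 'I_s]; rewrite powersetT !cardsT card_ord => ->.
  apply: leq_trans (card_bmultinom m d) _.
  case: (m) => [|m']; first by rewrite !expn0.
  by rewrite -expnMn leq_exp2r // /d; nia.
move=> ind; apply: leq_trans bnd; apply: indep_spanned_fin ind => w Fw.
have /choice[g hg] J : exists g, (msize g <= d.+1)%N /\ w J = P g / P (prodf J) ^+ k.+1.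
  by have [g] := Fw J; exists g.
pose c (t : {set 'I_s} * 'X_{1..m < d.+1}) : K := (g t.1)@_(bmnm t.2).
exists c; suff -> : w = \sum_(t : T) c t *: e t by exact: subrr.
have -> : \sum_(t : T) c t *: e t
        = \sum_(J : {set 'I_s}) \sum_(mu : 'X_{1..m < d.+1}) c (J, mu) *: e (J, mu).
  by rewrite pair_bigA; apply: eq_bigr => -[].
apply/ffunP => J; rewrite sum_ffunE (bigD1 J) //= [X in _ + X]big1 => [|J' J'J]; last first.
  rewrite sum_ffunE big1 // => mu _; rewrite !ffunE /=.
  by rewrite eq_sym (negPf J'J) scaler0.
rewrite addr0 sum_ffunE; have [sg ->] := hg J.
rewrite {1}(mpolywE sg) /poly_ratfun raddf_sum mulr_suml; apply: eq_bigr => mu _.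
by rewrite !ffunE /= eqxx ratfun_scaleE -mul_mpolyC -/(@poly_ratfun K m _) poly_ratfunM mulrA.
Qed.

Lemma growth_local_cohomology p :
  exists c F, growth (weylX (local_cohomology f p)) (weylD (local_cohomology f p))
    (sfull _) (szero _) c F.
Proof.
pose Z := cocycles (cech_cochains f) (cech_diff K m s) p.
pose B := coboundaries (cech_cochains f) (cech_diff K m s) p.
pose F := fun k => sadd (scap (cech_filt k) Z) (scap B Z).
exists (2 ^ s * cech_deg.+1 ^ m)%N; apply: (growth_weyl_subquot _ _ _ _ (F := F)).
apply: growth_subquot growth_cech => //.
- by move=> w [hw _] J; case: (hw J).
- by move=> w ->; exact: subspace0.
- by move=> w [].
- by move=> i w; exact: cech_cocyclesX.
- by move=> i w; exact: cech_cocyclesD.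
- by move=> i w [Bw Zw]; split; [exact: cech_coboundariesX | exact: cech_cocyclesX].
- by move=> i w [Bw Zw]; split; [exact: cech_coboundariesD | exact: cech_cocyclesD].
Qed.

End CechGrowth.

(** * The Euler operator on local cohomology *)

Lemma div_exp_shift (L : fieldType) (a q f : L) k : q != 0 -> f != 0 ->
  a / (q * f) ^+ k.+1 / q = a * f / (q * f) ^+ k.+2.
Proof.
move=> q0 f0; rewrite [in RHS]exprS; field.
by rewrite q0 f0 expf_neq0 // mulf_neq0.
Qed.

Lemma mul_exp_cancel (L : fieldType) (a q f : L) j k : f != 0 ->
  f ^+ (j + k) * (a / (f * q) ^+ k) = f ^+ j * a / q ^+ k.
Proof.
move=> f0; rewrite exprD exprMn invfM -!mulrA; congr (_ * _).
by rewrite mulrCA mulVKf ?expf_neq0.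
Qed.

Lemma mul_exp_div (L : fieldType) (a f q : L) k : q != 0 ->
  a * q ^+ k / (f * q) ^+ k = a / f ^+ k.
Proof.
by move=> q0; rewrite exprMn invfM mulrACA mulfV ?mulr1 ?expf_neq0.
Qed.

Section InLoc.
Variables (K : fieldType) (m : nat).
Local Notation R := {mpoly K[m]}.
Local Notation F := (ratfun K m).
Local Notation P := (@poly_ratfun K m).
Implicit Types (f g q : R) (x : F).

Lemma in_loc_poly f q x : in_loc f x -> in_loc f (P q * x).
Proof. by move=> [g [k ->]]; exists (q * g), k; rewrite poly_ratfunM mulrA. Qed.

Lemma in_loc_dvd f q x : q != 0 -> in_loc f x -> in_loc (f * q) x.
Proof.
move=> q0 [g [k ->]]; exists (g * q ^+ k.+1), k.
have Pq0 : P q != 0 by rewrite poly_ratfun_eq0.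
rewrite !poly_ratfunM poly_ratfunX; exact/esym/(mul_exp_div (P g) (P f) k.+1 Pq0).
Qed.

Lemma in_loc_div f q x : q != 0 -> in_loc (q * f) x -> in_loc (q * f) (x / P q).
Proof.
move=> q0 [g [k ->]]; have [->|f0] := eqVneq f 0.
  rewrite mulr0 poly_ratfun0 expr0n invr0 !mulr0 mul0r; exact: in_loc0.
exists (g * f), k.+1.
have Pq0 : P q != 0 by rewrite poly_ratfun_eq0.
have Pf0 : P f != 0 by rewrite poly_ratfun_eq0.
rewrite !poly_ratfunM; exact: (div_exp_shift (P g) k Pq0 Pf0).
Qed.

Lemma in_loc_clear f q x : f != 0 -> in_loc (f * q) x ->
  exists k0, forall k, (k0 <= k)%N -> in_loc q (P (f ^+ k) * x).
Proof.
move=> f0 [g [k0 ->]]; exists k0.+1 => k /subnK <-; exists (f ^+ (k - k0.+1) * g), k0.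
have Pf0 : P f != 0 by rewrite poly_ratfun_eq0.
rewrite !poly_ratfunM !poly_ratfunX; exact: (mul_exp_cancel (P g) (P q) (k - k0.+1) k0.+1 Pf0).
Qed.

Lemma in_loc_add f x y : in_loc f x -> in_loc f y -> in_loc f (x + y).
Proof. by move=> hx hy; rewrite -[x]scale1r; apply: in_locP. Qed.

Lemma in_loc_opp f x : in_loc f x -> in_loc f (- x).
Proof.
by move=> hx; rewrite -[_ x]addr0 -scaleN1r; apply: in_locP => //; exact: in_loc0.
Qed.

Lemma in_loc_sign f n x : in_loc f x -> in_loc f ((-1) ^+ n *: x).
Proof.
by move=> hx; rewrite -[_ *: x]addr0; apply: in_locP => //; exact: in_loc0.
Qed.

Definition ratfun_mul (y x : F) : F := y * x.

Lemma ratfun_mul_is_linear y : linear (ratfun_mul y).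
Proof. by move=> a u v; rewrite /ratfun_mul mulrDr !ratfun_scaleE mulrCA. Qed.
HB.instance Definition _ y := GRing.isLinear.Build K F F _ (ratfun_mul y)
  (ratfun_mul_is_linear y).

End InLoc.

Definition span_of (R : comNzRingType) s (f : 'I_s -> R) (x : R) : Prop :=
  exists a : 'I_s -> R, x = \sum_j a j * f j.

Section IdealSpan.
Variables (R : comNzRingType) (A : R -> Prop).
Hypothesis idA : is_ideal A.

Lemma idealD x y : A x -> A y -> A (x + y).
Proof. by move=> Ax Ay; rewrite -[x]mul1r; apply: idA.2. Qed.

Lemma idealM x y : A y -> A (x * y).
Proof. by move=> Ay; rewrite -[_ * _]addr0; apply: idA.2 => //; exact: idA.1. Qed.

Lemma ideal_sum (I : Type) (r : seq I) (Q : pred I) (G : I -> R) :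
  (forall i, Q i -> A (G i)) -> A (\sum_(i <- r | Q i) G i).
Proof. by move=> AG; apply: (big_ind A) => //; [exact: idA.1 | exact: idealD]. Qed.

Lemma ideal_radicalD x y k l : A (x ^+ k) -> A (y ^+ l) -> A ((x + y) ^+ (k + l)).
Proof.
move=> Ax Ay; rewrite exprDn; apply: ideal_sum => i _; rewrite -mulr_natl; apply: idealM.
have [li|il] := leqP l i; first by rewrite -(subnK li) exprD mulrA; apply: idealM.
rewrite mulrC -(subnK (_ : k <= k + l - i)%N); last by lia.
by rewrite exprD mulrA; apply: idealM.
Qed.

Lemma ideal_radical_span s (f : 'I_s -> R) x :
  (forall j, exists k, A (f j ^+ k)) -> span_of f x -> exists k, A (x ^+ k).
Proof.
move=> fk [a ->]; apply: (big_ind (fun y => exists k, A (y ^+ k))).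
- by exists 1%N; rewrite expr1; exact: idA.1.
- by move=> y z [k Ay] [l Az]; exists (k + l)%N; exact: ideal_radicalD.
by move=> j _; have [k Ak] := fk j; exists k; rewrite exprMn; apply: idealM.
Qed.
End IdealSpan.

Lemma span_ideal (R : comNzRingType) s (f : 'I_s -> R) : is_ideal (span_of f).
Proof.
split; first by exists (fun=> 0); rewrite big1 // => j _; rewrite mul0r.
move=> a _ _ [b ->] [c ->]; exists (fun j => a * b j + c j).
by rewrite mulr_sumr -big_split; apply: eq_bigr => j _; rewrite /= mulrDl mulrA.
Qed.

Lemma span_gen (R : comNzRingType) s (f : 'I_s -> R) i : span_of f (f i).
Proof.
exists (fun j => (j == i)%:R); rewrite (bigD1 i) //= eqxx mul1r big1 ?addr0 // => j ji.
by rewrite (negPf ji) mul0r.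
Qed.

Lemma span_trans (R : comNzRingType) s t (f : 'I_s -> R) (g : 'I_t -> R) x :
  (forall i, span_of g (f i)) -> span_of f x -> span_of g x.
Proof.
move=> fg [a ->]; apply: (ideal_sum (span_ideal g)) => j _.
exact/(idealM (span_ideal g)).
Qed.

(** * Acyclicity of the Cech complex localized at an element of the ideal *)

Section CechAcyclic.
Variables (K : fieldType) (m s : nat) (f : 'I_s -> {mpoly K[m]}) (g : {mpoly K[m]}).
Local Notation R := {mpoly K[m]}.
Local Notation F := (ratfun K m).
Local Notation P := (@poly_ratfun K m).
Local Notation C := {ffun {set 'I_s} -> F}.
Local Notation id_map := (fun _ : 'I_s => (idfun : {linear F -> F})).
Local Notation d := (koszul_diff id_map).
Local Notation prodf J := (\prod_(j in J) f j).
Hypothesis f_neq0 : forall j, f j != 0.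
Hypothesis g_neq0 : g != 0.
Hypothesis g_span : span_of f g.

(** The Cech complex of f localized at g, with degrees shifted by one: its J-component is the
    component at J with the index of g adjoined, in the Cech complex of f and g. *)
Definition local_cochain (p : nat) (c : C) := forall J : {set 'I_s},
  (#|J|.+1 <> p -> c J = 0) /\ in_loc (g * prodf J) (c J).

Lemma diff_mul y (c : C) : d (fmap (ratfun_mul y) c) = fmap (ratfun_mul y) (d c).
Proof. exact: koszul_diff_fmap. Qed.

(** Makes [contract_at j] the contraction by e_j^* alone. It is a homotopy from the identity to 0,
    but its value at J still has f_j in the denominator, so it leaves the Cech complex until
    multiplied by a power of f_j. *)
Definition select_map (j i : 'I_s) : {linear F -> F} := if i == j then (idfun : {linear F -> F}) else (\0 : {linear F -> F}).

Definition contract_at (j : 'I_s) : {linear C -> C} := koszul_contract (select_map j).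

Lemma contract_atE j (c : C) J : contract_at j c J
  = if j \in J then 0 else (-1) ^+ #|[set l in J | (l < j)%N]| *: c (j |: J).
Proof.
rewrite ffunE /select_map; case: ifPn => jJ.
  rewrite big1 // => i iJ; case: eqP => [ij|_]; last by rewrite scaler0.
  by rewrite ij jJ in iJ.
rewrite (bigD1 j) //= eqxx big1 ?addr0 // => i /andP[_ /negPf ->].
by rewrite scaler0.
Qed.

Lemma contract_at_homotopy j (c : C) : d (contract_at j c) + contract_at j (d c) = c.
Proof.
rewrite koszul_diff_contract //.
apply/ffunP => L; rewrite /select_map ffunE (bigD1 j) //= eqxx big1 ?addr0 => [|i /negPf ij].
  by case: ifP.
by rewrite ij; case: ifP.
Qed.

(* The r such that r v is the differential of an admissible cochain form an ideal.
   Contraction at j puts a power of f j in it, so it contains a power of g, which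
   is invertible. *)
Lemma local_acyclic p (v : C) : local_cochain p v -> d v = 0 ->
  exists2 c, v = d c & forall J : {set 'I_s},
    (#|J|.+2 <> p -> c J = 0) /\ in_loc (g * prodf J) (c J).
Proof.
move=> lv dv.
pose good (c : C) := forall J : {set 'I_s},
    (#|J|.+2 <> p -> c J = 0) /\ in_loc (g * prodf J) (c J).
pose A r := exists2 c, good c & fmap (ratfun_mul (P r)) v = d c.
have goodP r c c' : good c -> good c' -> good (fmap (ratfun_mul (P r)) c + c').
  move=> gc gc' J; have [c0 lc] := gc J; have [c0' lc'] := gc' J; rewrite !ffunE; split.
    by move=> e; rewrite c0 // c0' // linear0 addr0.
  by apply: in_loc_add => //; apply: in_loc_poly.
have idA : is_ideal A.
  split.
    exists 0; first by move=> J; rewrite ffunE; split=> //; exact: in_loc0.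
    rewrite linear0; apply/ffunP => J.
    by rewrite !ffunE /= /ratfun_mul poly_ratfun0 mul0r.
  move=> a r r' [c gc e] [c' gc' e']; exists (fmap (ratfun_mul (P a)) c + c').
    exact: goodP.
  rewrite linearD /= diff_mul -e -e'; apply/ffunP => J; rewrite !ffunE /= /ratfun_mul.
  by rewrite poly_ratfunD poly_ratfunM mulrDl mulrA.
have fA j : exists k, A (f j ^+ k).
  have /choice[k hk] (J : {set 'I_s}) : exists k0, forall k, (k0 <= k)%N ->
      in_loc (g * prodf J) (P (f j ^+ k) * contract_at j v J).
    rewrite contract_atE; case: ifPn => jJ.
      by exists 0%N => k _; rewrite mulr0; exact: in_loc0.
    have [_ l] := lv (j |: J); rewrite big_setU1 //= mulrCA in l.
    have [k0 hk] := in_loc_clear (f_neq0 j) (in_loc_sign #|[set l in J | (l < j)%N]| l).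
    by exists k0.
  exists (\sum_J k J)%N; exists (fmap (ratfun_mul (P (f j ^+ (\sum_J k J)%N))) (contract_at j v)).
    move=> J; rewrite ffunE; split; last by apply: hk; rewrite (bigD1 J) //= leq_addr.
    move=> cJ; rewrite contract_atE; case: ifPn => jJ; first by rewrite linear0.
    by have [-> //] := lv (j |: J); rewrite ?scaler0 ?linear0 // cardsU1 jJ.
  rewrite diff_mul; congr fmap; rewrite -[LHS](contract_at_homotopy j) dv.
  by rewrite [contract_at j 0]linear0 addr0.
(* Some power of each f_j lies in [A], hence so does some power of g, a combination of the f_j;
   dividing by it keeps the denominators admissible since g is inverted everywhere. *)
have [k [c gc e]] := ideal_radical_span idA fA g_span.
have Pg0 : P (g ^+ k) != 0 by rewrite poly_ratfun_eq0 expf_neq0.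
exists (fmap (ratfun_mul (P (g ^+ k))^-1) c).
  rewrite diff_mul -e; apply/ffunP => J; rewrite !ffunE /= /ratfun_mul mulrA mulVf //.
  by rewrite mul1r.
move=> J; have [c0 lc] := gc J; rewrite ffunE; split.
  by move=> cJ; rewrite c0 // linear0.
rewrite /= /ratfun_mul poly_ratfunX; elim: (k) => [|l IH]; first by rewrite expr0 invr1 mul1r.
by rewrite exprSr invfM mulrAC; exact: in_loc_div.
Qed.

End CechAcyclic.

Section CechSemisimple.
Variables (K : fieldType) (m : nat).
Local Notation R := {mpoly K[m]}.
Local Notation F := (ratfun K m).
Local Notation P := (@poly_ratfun K m).
Local Notation W s := (weyl_ffun {set 'I_s} (ratfun_weyl K m)).
Local Notation coc f := (cocycles (cech_cochains f) (cech_diff K m _)).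
Local Notation cob f := (coboundaries (cech_cochains f) (cech_diff K m _)).
Local Notation eul s := (@euler K m (W s)).
Local Notation eulF := (@euler K m (ratfun_weyl K m)).

Lemma euler_ffun s (w : W s) J : eul s w J = eulF (w J).
Proof.
by rewrite /euler sum_ffunE; apply: eq_bigr => i _; rewrite !ffunE.
Qed.

Lemma shift_prod_ffun s t (w : W s) J :
  shift_prod (eul s) t w J = shift_prod eulF t (w J).
Proof. by elim: t => //= a t IH; rewrite !ffunE euler_ffun IH. Qed.

Lemma coc_euler s (f : 'I_s -> R) p w : coc f p w -> coc f p (eul s w).
Proof.
by move=> Zw; apply: subspace_sum => i _; apply/cech_cocyclesX/cech_cocyclesD.
Qed.

(** Semisimplicity of the Euler operator on H^p, phrased with cocycles so that it can be carried
    along maps of Cech complexes without mapping quotients. *)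
Definition cech_semisimple s (f : 'I_s -> R) p := forall w, coc f p w ->
  exists2 t, uniq t & cob f p (shift_prod (eul s) t w).

Lemma local_cohomology_semisimple s (f : 'I_s -> R) p : cech_semisimple f p ->
  forall v : local_cohomology f p, semisimple_at (@euler K m (local_cohomology f p)) v.
Proof.
move=> ss v; rewrite -(subquot_classK v); set z := repr v.
have [t ut Bt] := ss _ (subspace_typeP z); exists t => //.
pose cl z' : local_cohomology f p := subquot_class (cob f p) z'.
suff [z' ez' ->] : exists2 z', val z' = shift_prod (eul s) t (val z)
    & shift_prod (@euler K m (local_cohomology f p)) t (cl z) = cl z'.
  have -> : (0 : local_cohomology f p) = cl 0 by apply/esym/linear0.
  by apply/subquot_classP; rewrite /= subr0 ez'.
have E z1 : exists2 z', val z' = eul s (val z1) & @euler K m (local_cohomology f p) (cl z1) = cl z'.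
  exists (subspace_elt (coc_euler (subspace_typeP z1))) => //.
  have h i : exists z2, val z2 = weylX (W s) i (weylD (W s) i (val z1))
      /\ weylX (local_cohomology f p) i (weylD (local_cohomology f p) i (cl z1)) = cl z2.
    have [za ea ->] := weylD_class (@cech_cocyclesX K m s f p) (@cech_coboundariesX K m s f p)
      (@cech_cocyclesD K m s f p) (@cech_coboundariesD K m s f p) i z1.
    have [zb eb ->] := weylX_class (@cech_cocyclesX K m s f p) (@cech_coboundariesX K m s f p)
      (@cech_cocyclesD K m s f p) (@cech_coboundariesD K m s f p) i za.
    by exists zb; rewrite eb ea.
  have [z2 hz2] := choice h.
  transitivity (cl (\sum_i z2 i)).
    rewrite [RHS]linear_sum; apply: eq_bigr => i _; by case: (hz2 i).
  congr subquot_class; apply: val_inj; rewrite raddf_sum /=; apply: eq_bigr => i _.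
  by case: (hz2 i).
elim: t {ut Bt} => [|a t [z1 e1 IH]] /=; first by exists z.
have [z2 e2 h2] := E z1; exists (z2 - a *: z1).
  have -> : val (z2 - a *: z1) = val z2 - a *: val z1 by rewrite raddfB.
  by rewrite e2 e1.
rewrite IH h2 -!scaleNr [z2 + _]addrC [cl z2 + _]addrC; exact/esym/(subquot_class_is_linear (cob f p)  (- a) z1 z2).
Qed.

End CechSemisimple.

Lemma in_loc_sign_inv (K : fieldType) m (f : {mpoly K[m]}) n (x : ratfun K m) :
  in_loc f ((-1) ^+ n *: x) -> in_loc f x.
Proof. by move/(in_loc_sign n); rewrite scale_signK. Qed.

Lemma fmap_idfun (K : fieldType) (N : lmodType K) (T : finType) (w : {ffun T -> N}) :
  fmap idfun w = w.
Proof. by apply/ffunP => t; rewrite ffunE. Qed.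

(** * Adjoining an element of the ideal to the generators *)

Section CechStep.
Variables (K : fieldType) (m s : nat) (h : 'I_s.+1 -> {mpoly K[m]}) (k : 'I_s.+1).
Local Notation R := {mpoly K[m]}.
Local Notation F := (ratfun K m).
Local Notation P := (@poly_ratfun K m).
Local Notation W s := (weyl_ffun {set 'I_s} (ratfun_weyl K m)).
Local Notation coc f := (cocycles (cech_cochains f) (cech_diff K m _)).
Local Notation cob f := (coboundaries (cech_cochains f) (cech_diff K m _)).
Local Notation cd n := (koszul_diff (fun _ : 'I_n => (idfun : {linear F -> F}))).
Local Notation f := (fun j => h (lift k j)).
Local Notation g := (h k).
Local Notation prodf J := (\prod_(j in J) h (lift k j)).
Hypothesis h_neq0 : forall j, h j != 0.
Hypothesis g_span : span_of f g.

Let f_neq0 j : f j != 0. Proof. exact: h_neq0. Qed.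

Lemma prod_up (J : {set 'I_s}) : \prod_(j in set_up k J) h j = prodf J.
Proof. by rewrite big_imset //= => i j _ _; exact: lift_inj. Qed.

Lemma prod_upk (J : {set 'I_s}) : \prod_(j in k |: set_up k J) h j = g * prodf J.
Proof. by rewrite big_setU1 ?mem_up_k //= prod_up. Qed.

Lemma cochain_split p (w : {ffun {set 'I_s.+1} -> F}) : is_cech_cochain h p w <->
  is_cech_cochain f p (koszul_res k w) /\ local_cochain f g p (koszul_link k w).
Proof.
split=> [hw|[hr hl] L].
  split=> J.
    by have := hw (set_up k J); rewrite ffunE card_up prod_up.
  have [w0 wl] := hw (k |: set_up k J); rewrite ffunE; split.
    by move=> cJ; rewrite w0 ?scaler0 // card_upk.
  by rewrite -prod_upk; apply: in_loc_sign.
rewrite (set_downK k L); case: ifP => _; last first.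
  by have := hr (set_down k L); rewrite ffunE card_up prod_up.
have [l0 ll] := hl (set_down k L); rewrite ffunE in l0 ll; rewrite card_upk prod_upk; split.
  by move/l0 => e; rewrite -[LHS](scale_signK (below k (set_down k L))) e scaler0.
exact: in_loc_sign_inv ll.
Qed.

(** The Cech complex of h is the cone of the map from that of f to its localization at g. The latter
    is acyclic, so u = d v there, and u + e_k v is a cocycle restricting to u. *)
Lemma cech_res_surj p u : coc f p u ->
  exists2 w, coc h p w & koszul_res k w = u :> {ffun {set 'I_s} -> F}.
Proof.
move=> [hu du].
have lu : local_cochain f g p.+1 u.
  move=> J; have [u0 ul] := hu J; split; first by move=> cJ; apply: u0 => e; rewrite e in cJ.
  by rewrite mulrC; apply: in_loc_dvd.
have [v uv hv] := local_acyclic f_neq0 (h_neq0 k) g_span lu du.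
exists (koszul_join k u v); last by rewrite koszul_joinE.
split.
  apply/cochain_split; rewrite !koszul_joinE; split=> // J.
  have [v0 vl] := hv J; split=> // cJ; apply: v0 => -[e]; exact: cJ.
apply: (@koszul_split_inj _ _ _ k).
  by rewrite koszul_res_diff koszul_joinE linear0.
by rewrite koszul_link_diff !koszul_joinE fmap_idfun -uv subrr linear0.
Qed.

Lemma cech_res_cocycle p w : coc h p w -> coc f p (koszul_res k w).
Proof.
move=> [/cochain_split[hr _] dw]; split=> //.
suff : cd s (koszul_res k w) = 0 by [].
have <- : koszul_res k (cd s.+1 w) = cd s (koszul_res k w) by exact: koszul_res_diff.
have -> : cd s.+1 w = 0 by exact: dw.
exact: linear0.
Qed.

Lemma cech_res_coboundary p w : cob h p w -> cob f p (koszul_res k w).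
Proof.
case: p => [->|p [u /cochain_split[hr _] ->]]; first exact: linear0.
by exists (koszul_res k u) => //; rewrite koszul_res_diff.
Qed.

(** Closedness gives res w = d (link w). If also res w = d b, then b - link w is closed in the
    acyclic complex, say d c, and w = d (b + e_k c). *)
Lemma cech_res_inj p w : coc h p w -> cob f p (koszul_res k w) -> cob h p w.
Proof.
move=> [/cochain_split[hr hl] dw].
have e : koszul_res k w = cd s (koszul_link k w).
  have := congr1 (koszul_link k) dw; rewrite koszul_link_diff fmap_idfun linear0.
  by move/eqP; rewrite subr_eq0 => /eqP.
(* In degree 0 the link vanishes, its J-component living in degree #|J| + 1. *)
case: p hr hl => [|p] hr hl.
  move=> r0; apply: (@koszul_split_inj _ _ _ k); rewrite linear0 //.
  by apply/ffunP => J; rewrite [RHS]ffunE; apply: (hl J).1.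
case=> b hb rb.
have lv : local_cochain f g p.+1 (b - koszul_link k w).
  move=> J; have [b0 bl] := hb J; have [v0 vl] := hl J.
  have -> : (b - koszul_link k w) J = b J - koszul_link k w J by rewrite !ffunE.
  split; first by move=> cJ; rewrite v0 // b0 ?subrr // => eJ; rewrite eJ in cJ.
  apply: in_loc_add; last exact: in_loc_opp.
  by rewrite mulrC; apply: in_loc_dvd.
have dv : cd s (b - koszul_link k w) = 0 by rewrite linearB /= -e -rb subrr.
have [c ec hc] := local_acyclic f_neq0 (h_neq0 k) g_span lv dv.
exists (koszul_join k b c).
  apply/cochain_split; rewrite !koszul_joinE; split=> // J.
  by have [c0 cl] := hc J; split=> // cJ; apply: c0 => -[]; exact: cJ.
apply: (@koszul_split_inj _ _ _ k).
  by rewrite koszul_res_diff koszul_joinE.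
by rewrite koszul_link_diff !koszul_joinE fmap_idfun -ec subKr.
Qed.

Lemma res_shift_prod t (w : W s.+1) :
  koszul_res k (shift_prod (@euler K m (W s.+1)) t w)
  = shift_prod (@euler K m (W s)) t (koszul_res k w) :> W s.
Proof.
by apply/ffunP => J; rewrite shift_prod_ffun !ffunE shift_prod_ffun.
Qed.

Lemma cech_semisimple_add p : cech_semisimple f p -> cech_semisimple h p.
Proof.
move=> ss w Zw; have [t ut Bt] := ss _ (cech_res_cocycle Zw); exists t => //.
apply: cech_res_inj; first by apply: shift_prod_stable Zw => u; exact: coc_euler.
by rewrite res_shift_prod.
Qed.

Lemma cech_semisimple_remove p : cech_semisimple h p -> cech_semisimple f p.
Proof.
move=> ss u Zu; have [w Zw <-] := cech_res_surj Zu.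
have [t ut Bt] := ss _ Zw; exists t => //.
by rewrite -res_shift_prod; exact: cech_res_coboundary.
Qed.

End CechStep.

Lemma shift_prodD (K : fieldType) (V : lmodType K) (L : {linear V -> V}) t u v :
  shift_prod L t (u + v) = shift_prod L t u + shift_prod L t v.
Proof.
by elim: t => //= a t ->; rewrite linearD scalerDr opprD addrACA.
Qed.

Lemma shift_prod_eigen (K : fieldType) (V : lmodType K) (L : {linear V -> V}) t a v :
  a \in t -> L v = a *: v -> shift_prod L t v = 0.
Proof.
move=> at_ Lv; apply: (@shift_prod_subset _ _ _ [:: a]) => //.
  by move=> b; rewrite inE => /eqP ->.
by rewrite /= Lv subrr.
Qed.

(** * Homogeneous fractions as Euler eigenvectors *)

Section HomogeneousFractions.
Variables (K : fieldType) (m : nat).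
Local Notation R := {mpoly K[m]}.
Local Notation F := (ratfun K m).
Local Notation P := (@poly_ratfun K m).
Local Notation eulF := (@euler K m (ratfun_weyl K m)).

Lemma ratfun_scaleAr (a : K) (x y : F) : x * (a *: y) = a *: (x * y).
Proof. by rewrite !ratfun_scaleE mulrCA. Qed.

Lemma ratfun_scaleAl (a : K) (x y : F) : (a *: x) * y = a *: (x * y).
Proof. by rewrite !ratfun_scaleE mulrA. Qed.

Lemma poly_ratfunZ (a : K) (q : R) : P (a *: q) = a *: P q.
Proof. by rewrite ratfun_scaleE -poly_ratfunM mul_mpolyC. Qed.

Lemma euler_ratfunM (x y : F) : eulF (x * y) = (eulF x : F) * y + x * (eulF y : F).
Proof.
rewrite /euler mulr_suml mulr_sumr -big_split; apply: eq_bigr => i _ /=.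
rewrite ratfun_DM /ratfun_X mulrDr; congr (_ + _); [exact: mulrA | exact: mulrCA].
Qed.

Lemma euler_poly (a : R) d : a \is d.-homog -> eulF (P a) = d%:R *: P a.
Proof.
move=> ha; have PX mu : mdeg mu = d -> eulF (P 'X_[mu]) = d%:R *: P 'X_[mu].
  move=> <-; rewrite /euler mdegE natr_sum scaler_suml; apply: eq_bigr => i _ /=.
  rewrite ratfun_D_poly mderivX poly_ratfunZ /ratfun_X ratfun_scaleAr -poly_ratfunM -mpolyXD.
  have [-> |mui] := eqVneq (mu i) 0%N; first by rewrite !scale0r.
  rewrite addmC submK //; apply/mnm_lepP => j; rewrite mnm1E.
  by case: eqVneq => // <-; rewrite lt0n.
rewrite (mpolyE a) /poly_ratfun raddf_sum [LHS]linear_sum scaler_sumr.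
rewrite !big_seq; apply: eq_bigr => mu mus /=.
rewrite -/(@poly_ratfun K m _) poly_ratfunZ linearZ /= PX; last exact: (dhomog_mf ha).
by rewrite !scalerA mulrC.
Qed.

Lemma euler_frac (a b : R) d e : b != 0 -> a \is d.-homog -> b \is e.-homog ->
  eulF (P a / P b) = (d%:R - e%:R) *: (P a / P b).
Proof.
move=> b0 ha hb; set x := P a / P b.
have Pb0 : P b != 0 by rewrite poly_ratfun_eq0.
have xb : x * P b = P a by rewrite /x mulfVK.
apply: (mulIf Pb0); have := euler_ratfunM x (P b).
rewrite xb (euler_poly ha) (euler_poly hb) ratfun_scaleAr xb => /eqP.
by rewrite -subr_eq => /eqP <-; rewrite ratfun_scaleAl xb scalerBl.
Qed.

Lemma loc_semisimple (f : R) e (x : F) : f \is e.-homog -> in_loc f x ->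
  semisimple_at eulF x.
Proof.
move=> hf [a [k ->]]; have [->|f0] := eqVneq f 0.
  by exists [::] => //=; rewrite poly_ratfun0 expr0n invr0 mulr0.
(* The eigenvalues of the homogeneous components of a / f^(k+1). *)
pose t : seq K := undup [seq d%:R - (e * k.+1)%:R | d <- iota 0 (msize a)].
exists t; first exact: undup_uniq.
rewrite {1}(@pihomog_partitionE _ _ mdeg (msize a) a) // /poly_ratfun raddf_sum mulr_suml.
apply: (big_ind (fun y : F => shift_prod eulF t y = 0)).
- exact: shift_prod0.
- by move=> u v hu hv; rewrite shift_prodD hu hv addr0.
move=> d _; apply: (@shift_prod_eigen _ _ _ _ (d%:R - (e * k.+1)%:R)).
  by rewrite mem_undup; apply: map_f; rewrite mem_iota add0n ltn_ord.
rewrite -!/(@poly_ratfun K m _) -poly_ratfunX; apply: euler_frac.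
- exact: expf_neq0.
- exact: pihomogP.
- exact: dhomogMn.
Qed.

Lemma cech_semisimple_homog s (g : 'I_s -> R) p :
  (forall j, exists d, g j \is d.-homog) -> cech_semisimple g p.
Proof.
move=> hg w [hw _].
have /choice[t ht] (J : {set 'I_s}) : exists t, uniq t /\ shift_prod eulF t (w J) = 0.
  have [e he] : exists e, \prod_(j in J) g j \is e.-homog.
    apply: (big_ind (fun q : R => exists e, q \is e.-homog)) => //.
      by exists 0%N; exact: dhomog1.
    by move=> u v [d hd] [e he]; exists (d + e)%N; exact: dhomogM.
  by have [t] := loc_semisimple he (hw J).2; exists t.
exists (undup (flatten [seq t J | J <- enum {set 'I_s}])); first exact: undup_uniq.
rewrite (_ : shift_prod _ _ _ = 0); first exact: subspace0.
apply/ffunP => J; rewrite [RHS]ffunE shift_prod_ffun; have [ut t0] := ht J.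
apply: shift_prod_subset ut _ t0 => a at_; rewrite mem_undup.
by apply/flatten_mapP; exists J => //; rewrite mem_enum.
Qed.

End HomogeneousFractions.

Lemma eq_cech_semisimple (K : fieldType) m p t n (g : 'I_t -> {mpoly K[m]})
    (h : 'I_n -> {mpoly K[m]}) :
  t = n -> (forall (i : 'I_t) (j : 'I_n), i = j :> nat -> g i = h j) ->
  cech_semisimple g p -> cech_semisimple h p.
Proof.
move=> tn; case: n / tn h => h gh.
by have -> : h = g by apply/funext => i; rewrite (gh i i).
Qed.

(** * From homogeneous generators to arbitrary ones *)

Section HomogeneousIdeal.
Variables (K : fieldType) (m : nat) (A : {mpoly K[m]} -> Prop).
Local Notation R := {mpoly K[m]}.

(** Elements are appended one at a time; g stays among the earlier ones, so each new element lies in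
    their span. *)
Lemma cech_semisimple_prefix p t (g : 'I_t -> R) n (h : 'I_n -> R) :
  (forall x, A x -> span_of g x) ->
  (t <= n)%N -> (forall (i : 'I_t) (j : 'I_n), i = j :> nat -> g i = h j) ->
  (forall j, h j != 0) -> (forall j, A (h j)) ->
  cech_semisimple g p -> cech_semisimple h p.
Proof.
move=> Ag; elim: n h => [|n IH] h tn gh h0 Ah ss.
  by apply: eq_cech_semisimple gh ss; lia.
have [e|ne] := eqVneq t n.+1; first exact: eq_cech_semisimple gh ss.
have tn' : (t <= n)%N by lia.
have gh' (i : 'I_t) (j : 'I_n) : i = j :> nat -> g i = h (lift ord_max j).
  by move=> ij; apply: gh; rewrite lift_max.
apply: (cech_semisimple_add (k := ord_max)) => //.
  apply: span_trans (Ag _ (Ah _)) => i.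
  have -> : g i = h (lift ord_max (widen_ord tn' i)) by exact: gh'.
  exact: (span_gen (fun j => h (lift ord_max j))).
exact: IH.
Qed.

(** Elements are removed from the front; f stays at the end, so each removed element lies in the
    span of what remains. *)
Lemma cech_semisimple_suffix p s (f : 'I_s -> R) n (h : 'I_n -> R) :
  (forall x, A x -> span_of f x) ->
  (s <= n)%N -> (forall (i : 'I_s) (j : 'I_n), (i + (n - s) = j)%N -> h j = f i) ->
  (forall j, h j != 0) -> (forall j, A (h j)) ->
  cech_semisimple h p -> cech_semisimple f p.
Proof.
move=> Af; elim: n h => [|n IH] h sn fh h0 Ah ss.
  by apply: (eq_cech_semisimple _ _ ss) => [|i j ij]; [lia | apply: fh; lia].
have [e|ne] := eqVneq s n.+1.
  by apply: (eq_cech_semisimple _ _ ss) => // i j ij; apply: fh; lia.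
have sn' : (s <= n)%N by lia.
have fh' (i : 'I_s) (j : 'I_n) : (i + (n - s) = j)%N -> h (lift ord0 j) = f i.
  by move=> ij; apply: fh; rewrite lift0; lia.
apply: (IH (fun j => h (lift ord0 j))) => //.
apply: (cech_semisimple_remove (k := ord0)) => //.
apply: span_trans (Af _ (Ah _)) => i.
have lt : (i + (n - s) < n)%N by have := ltn_ord i; lia.
have <- : h (lift ord0 (Ordinal lt)) = f i by exact: fh'.
exact: (span_gen (fun j => h (lift ord0 j))).
Qed.

End HomogeneousIdeal.

(* If f j = 0, the localizations at j are 0 while the differential still adds
   the component w J to the component at j |: J, so that no nonzero w is a cocycle. *)
Lemma cech_cocycle_zero_gen (K : fieldType) m s (f : 'I_s -> {mpoly K[m]}) j p w :
  f j = 0 -> cocycles (cech_cochains f) (cech_diff K m s) p w -> w = 0.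
Proof.
move=> fj0 [hw dw].
have c0 : @contract_at K m s j w = 0.
  apply/ffunP => J; rewrite [RHS]ffunE contract_atE; case: ifPn => // jJ.
  have [_] := hw (j |: J); rewrite big_setU1 //= fj0 mul0r => -[q [k ->]].
  by rewrite poly_ratfun0 expr0n invr0 mulr0 scaler0.
rewrite -[LHS](@contract_at_homotopy K m s j) c0 linear0 add0r.
have -> : koszul_diff (fun _ : 'I_s => (idfun : {linear ratfun K m -> ratfun K m})) w = 0.
  exact: dw.
exact: linear0.
Qed.

Lemma cech_semisimple_ideal (K : fieldType) m (I : {mpoly K[m]} -> Prop) s
    (f : 'I_s -> {mpoly K[m]}) p :
  homogeneous_ideal I -> generates f I -> cech_semisimple f p.
Proof.
move=> [idI homI] genI.
(* The comparison of Cech complexes divides by powers of the generators, so a zero generator is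
   treated apart. *)
have [[j fj0]|nz] := pselect (exists j, f j = 0).
  move=> w Zw; exists [::] => //; rewrite (cech_cocycle_zero_gen fj0 Zw).
  exact: subspace0.
have f0 j : f j != 0 by apply/eqP => e; apply: nz; exists j.
have If x : I x -> span_of f x by move/genI.
have fI j : I (f j) by apply/genI; exact: span_gen.
(* Nonzero homogeneous components of the f_j: they lie in I because I is homogeneous, and they
   generate it. *)
pose gs := [seq a <- flatten [seq [seq pihomog mdeg d (f j) | d <- iota 0 (msize (f j))]
                              | j <- enum 'I_s] | a != 0].
have gsP a : a \in gs -> [/\ a != 0, I a & exists d, a \is d.-homog].
  rewrite mem_filter => /andP[a0 /flatten_mapP[j _ /mapP[d _ ae]]].
  by rewrite {a}ae in a0 *; split=> //; [exact: homI | exists d; exact: pihomogP].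
pose g (i : 'I_(size gs)) := nth 0 gs i.
have g_in i : g i \in gs by exact: mem_nth.
have span_gs a : a \in gs -> span_of g a.
  move=> ags; have lt : (index a gs < size gs)%N by rewrite index_mem.
  have -> : a = g (Ordinal lt) by rewrite /g nth_index.
  exact: span_gen.
have gf j : span_of g (f j).
  rewrite (@pihomog_partitionE _ _ mdeg (msize (f j)) (f j)) //.
  apply: (ideal_sum (span_ideal g)) => d _.
  have [->|n0] := eqVneq (pihomog mdeg d (f j)) 0; first exact: (span_ideal g).1.
  apply: span_gs; rewrite mem_filter n0; apply/flatten_mapP; exists j.
    by rewrite mem_enum.
  by apply: map_f; rewrite mem_iota add0n ltn_ord.
have Ig x : I x -> span_of g x by move/If; apply: span_trans.
pose fs := [seq f j | j <- enum 'I_s]; pose hs := gs ++ fs.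
have sfs : size fs = s by rewrite size_map size_enum_ord.
(* The concatenation links both families: it arises from [gs] by appending the f_j, and f is
   recovered by removing [gs]. *)
pose h (i : 'I_(size gs + s)) := nth 0 hs i.
have h_in i : h i \in hs by apply: mem_nth; rewrite size_cat sfs.
have hsP a : a \in hs -> a != 0 /\ I a.
  by rewrite mem_cat => /orP[/gsP[]//|/mapP[j _ ->]].
have h0 i : h i != 0 by case: (hsP _ (h_in i)).
have hI i : I (h i) by case: (hsP _ (h_in i)).
apply: (cech_semisimple_suffix (h := h) If) => //; first exact: leq_addl.
  move=> i j; rewrite addnK => ij; rewrite /h /hs nth_cat -ij ltnNge leq_addl /= addnK.
  by rewrite (nth_map i) ?nth_ord_enum // size_enum_ord.
apply: (cech_semisimple_prefix (g := g) Ig) => //; first exact: leq_addr.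
  by move=> i j ij; rewrite /h /hs nth_cat -ij ltn_ord.
by apply: cech_semisimple_homog => i; have [] := gsP _ (g_in i).
Qed.

Theorem theorem1p2 (K : fieldType) (charK : [pchar K] =i pred0) (n : nat)
    (I : {mpoly K[n.+1]} -> Prop) (homI : homogeneous_ideal I)
    (s : nat) (f : 'I_s -> {mpoly K[n.+1]}) (genI : generates f I) (i : nat) :
  chi_deRham (local_cohomology f i)
  = (-1) ^+ n.+1 * chi_Koszul (local_cohomology f i).
Proof.
have [c [F gF]] := growth_local_cohomology f i.
apply: euler_char_eulerian gF => //.
apply: local_cohomology_semisimple; exact: cech_semisimple_ideal homI genI.
Qed.
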